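(* Let $V_9$ be a $9$-dimensional vector space over a field $\mathbf{k}$ and let $\gamma\in\bigwedge^3V_9$ be stable with respect to the natural action of $\mathrm{SL}(V_9)$. Then $Y_\gamma\subset\mathbf{P}(V_9^* )$ and $D_\gamma\subset\mathbf{P}(V_9)$ are irreducible hypersurfaces.
   Context: $\mathbf{P}(V)$ denotes the space of lines in $V$. Stable means GIT-stable (closed orbit and finite stabilizer over an algebraic closure). Definition of $Y_\gamma$: via comultiplication $\bigwedge^3V_9\to\bigwedge^2V_9\otimes V_9$ and the surjection $V_9\otimes\mathcal{O}_{\mathbf{P}(V_9^* )}\to\mathcal{O}_{\mathbf{P}(V_9^* )}(1)$, $\gamma$ gives a family of skew-symmetric matrices $\Phi_\gamma\colon V_9^*\to V_9\otimes\mathcal{O}_{\mathbf{P}(V_9^* )}(1)$ over $\mathbf{P}(V_9^* )$ (at the line spanned by $x\in V_9^*$ it is the contraction $\gamma(x,-,-)$). Then $Y_\gamma=\{x\in\mathbf{P}(V_9^* )\mid\operatorname{rank}(\Phi_\gamma|_x)\le6\}$. Definition of $D_\gamma$: in characteristic $0$ there is, up to scalar, a unique $\mathrm{SL}_8$-invariant polynomial of degree $16$ on $\bigwedge^3$ of an $8$-dimensional space; scaled to be a primitive polynomial with integer coefficients it makes sense over any field, and is called the hyperdiscriminant $f_{16}$. $D_\gamma$ is the subscheme of points $\ell\in\mathbf{P}(V_9)$ where the image of $\gamma$ in $\bigwedge^3(V_9/\ell)$ has vanishing hyperdiscriminant; its equation is a section of $\mathcal{O}_{\mathbf{P}(V_9)}(6)$.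 Here irreducible refers to the underlying topological space ($D_\gamma$ is non-reduced in characteristic $2$). *)

(* Defs.v *)
From HB Require Import structures.
From mathcomp Require Import all_boot all_order all_algebra.
From mathcomp Require Import mpoly.

Set Implicit Arguments.
Unset Strict Implicit.
Unset Printing Implicit Defensive.

Import GRing.Theory.
Local Open Scope ring_scope.

(* Λ^3 V, for V finite dimensional, as the space of alternating trilinear forms
   on V^* = 'Hom(V, k^o); x ∧ y ∧ z is the form
   (f, g, h) |-> det of the 3 x 3 matrix of values of f, g, h on x, y, z.
   This identification holds in every characteristic. *)
Record trivector (k : fieldType) (V : vectType k) := Trivector {
  tv_fun :> 'Hom(V, k^o) -> 'Hom(V, k^o) -> 'Hom(V, k^o) -> k;
  tv_linear1 : forall a f f' g h,
    tv_fun (a *: f + f') g h = a * tv_fun f g h + tv_fun f' g h;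
  tv_linear2 : forall a f g g' h,
    tv_fun f (a *: g + g') h = a * tv_fun f g h + tv_fun f g' h;
  tv_linear3 : forall a f g h h',
    tv_fun f g (a *: h + h') = a * tv_fun f g h + tv_fun f g h';
  tv_alt12 : forall f h, tv_fun f f h = 0;
  tv_alt23 : forall f h, tv_fun f h h = 0;
  tv_alt13 : forall f h, tv_fun f h f = 0
}.

(* Λ^3 (R^n) inside R^n ⊗ R^n ⊗ R^n: the alternating cubic arrays. *)
Definition tensor3 (R : Type) (n : nat) := {ffun 'I_n * 'I_n * 'I_n -> R}.

Definition alternating (R : nzRingType) (n : nat) (c : tensor3 R n) : Prop :=
  (forall i l, [/\ c (i, i, l) = 0, c (i, l, l) = 0 & c (i, l, i) = 0]) /\
  (forall i j l, c (j, i, l) = - c (i, j, l) /\ c (i, l, j) = - c (i, j, l)).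

(* Coordinates of γ in the library's basis of V, extended to K along iota;
   taking K = k and iota the identity gives the coordinates of γ itself. *)
Definition tv_coords (k : fieldType) (V : vectType k) (gamma : trivector V)
    (K : fieldType) (iota : {rmorphism k -> K}) : tensor3 K (\dim {:V}) :=
  let dual i := linfun (coord (vbasis {:V}) i : V -> k^o) in
  [ffun t => iota (gamma (dual t.1.1) (dual t.1.2) (dual t.2))].

(* The map Λ^3 (R^n) -> Λ^3 (R^m) induced by a matrix M : R^n -> R^m acting on
   column vectors. *)
Definition wedge3 (R : nzRingType) (m n : nat) (M : 'M[R]_(m, n))
    (c : tensor3 R n) : tensor3 R m :=
  [ffun t => \sum_(i < n) \sum_(j < n) \sum_(l < n)
     M t.1.1 i * M t.1.2 j * M t.2 l * c (i, j, l)].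

(* Independent coordinates on Λ^3 of an n-dimensional space: i < j < l. *)
Definition triple (n : nat) :=
  {t : 'I_n * 'I_n * 'I_n | (t.1.1 < t.1.2)%N && (t.1.2 < t.2)%N}.

(* Value, at an alternating array over S, of a polynomial function on Λ^3 with
   coefficients in R, read in S along phi. *)
Definition eval3 (R S : nzRingType) (phi : R -> S) (n : nat)
    (f : {mpoly R[#|{: triple n}|]}) (c : tensor3 S n) : S :=
  mmap phi (fun s => c (val (enum_val s))) f.

(* In characteristic 0 the degree 16 invariants form a line, so f_16 is
   determined up to sign by this predicate. *)
Definition hyperdiscriminant (f : {mpoly int[#|{: triple 8}|]}) : Prop :=
  [/\ f \is (16%N).-homog,
      forall d : int, (forall m, (d %| f@_m)%Z) -> d \is a GRing.unit
    & forall (F : fieldType), [pchar F] =i pred0 ->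
      forall (g : 'M[F]_8) (c : tensor3 F 8), alternating c -> \det g = 1 ->
        eval3 intr f (wedge3 g c) = eval3 intr f c].

Definition orbit_closed (K : fieldType) (n : nat) (c : tensor3 K n) : Prop :=
  exists S : {mpoly K[#|{: triple n}|]} -> Prop,
    forall c' : tensor3 K n, alternating c' ->
      ((exists2 g : 'M[K]_n, \det g = 1 & c' = wedge3 g c) <->
       (forall p, S p -> eval3 idfun p c' = 0)).

Definition stabilizer_finite (K : fieldType) (n : nat) (c : tensor3 K n) : Prop :=
  exists s : seq 'M[K]_n,
    forall g : 'M[K]_n, \det g = 1 -> wedge3 g c = c -> g \in s.

(* To be used with iota an algebraic closure of k. *)
Definition stable (k : fieldType) (kbar : closedFieldType)
    (iota : {rmorphism k -> kbar}) (V : vectType k) (gamma : trivector V) : Prop :=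
  orbit_closed (tv_coords gamma iota) /\
  stabilizer_finite (tv_coords gamma iota).

(* Points of the scheme P^(n-1) over k, given by nonzero vectors over arbitrary
   extension fields of k (not only k-rational points).  Two such vectors
   represent the same point exactly when the same homogeneous polynomials over
   k vanish on them, so Zariski closed sets are well defined on scheme points. *)
Record point (k : fieldType) (n : nat) := Point {
  pt_field : fieldType;
  pt_emb : {rmorphism k -> pt_field};
  pt_vec : 'cV[pt_field]_n;
  pt_neq0 : pt_vec != 0
}.

Section Projective.
Variables (k : fieldType) (n : nat).
Implicit Types (Z : point k n -> Prop) (F : {mpoly k[n]}).

Definition vanishes F (P : point k n) : Prop :=
  mmap (pt_emb P) (fun i => pt_vec P i 0) F = 0.

Definition zariski_closed Z : Prop :=
  exists S : {mpoly k[n]} -> Prop,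
    (forall F, S F -> exists d : nat, F \is d.-homog) /\
    (forall P, Z P <-> forall F, S F -> vanishes F P).

Definition irreducible Z : Prop :=
  (exists P, Z P) /\
  forall Z1 Z2, zariski_closed Z1 -> zariski_closed Z2 ->
    (forall P, Z P -> Z1 P \/ Z2 P) ->
    (forall P, Z P -> Z1 P) \/ (forall P, Z P -> Z2 P).

Definition hypersurface Z : Prop :=
  exists (d : nat) F,
    [/\ (0 < d)%N, F != 0, F \is d.-homog & forall P, Z P <-> vanishes F P].

End Projective.

(* A point of the dual projective space is given by its coordinates in the basis
   dual to vbasis {:V}; phi_matrix is the matrix of γ(x, -, -). *)
Definition phi_matrix (R : nzRingType) (n : nat) (c : tensor3 R n) (x : 'cV[R]_n) :
    'M[R]_n :=
  \matrix_(j < n, l < n) \sum_(i < n) x i 0 * c (i, j, l).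

Definition Y_locus (k : fieldType) (V : vectType k) (gamma : trivector V)
    (P : point k (\dim {:V})) : Prop :=
  (\rank (phi_matrix (tv_coords gamma (pt_emb P)) (pt_vec P)) <= 6)%N.

(* M identifies V/ℓ with K^8, so wedge3 M is V -> V/ℓ on Λ^3; by
   SL_8-invariance and homogeneity the vanishing of f does not depend on M. *)
Definition D_locus (f : {mpoly int[#|{: triple 8}|]}) (k : fieldType)
    (V : vectType k) (gamma : trivector V) (P : point k (\dim {:V})) : Prop :=
  exists M : 'M[pt_field P]_(8, \dim {:V}),
    [/\ \rank M = 8%N, M *m pt_vec P = 0
      & eval3 intr f (wedge3 M (tv_coords gamma (pt_emb P))) = 0].

(* Main.v *)
Require Import Defs.
From HB Require Import structures.
From mathcomp Require Import all_boot all_order all_algebra.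
From mathcomp Require Import mpoly.
From mathcomp Require Import algC ring zify.
From Stdlib Require Import Classical.

Set Implicit Arguments.
Unset Strict Implicit.
Unset Printing Implicit Defensive.

Import Order.Theory GRing.Theory Num.Theory.
Local Open Scope ring_scope.

(* Write T for the trilinear form of γ and Φ(x) for the matrix of T(x, -, -). By the easy half of
   the Hilbert-Mumford criterion, stability over the algebraic closure K forbids a 3-dimensional U
   with T(U, U, -) = 0 ("bad" tensors) and forces rank Φ(x) > 2 for x <> 0. Over k[x] the adjugate
   of Φ(x) is F^2 x x^T with F a cubic form, so the first locus is F = 0. The pencils
   Φ(x + t h) compute the gradient and the polar form of F at its zeros, and show that F vanishes
   on no hyperplane, so that F is prime over K.
   On an 8-dimensional space the tensors which are not bad form a single orbit, so the vanishing
   of the hyperdiscriminant means "bad"; semi-invariance under GL_8 gives a sextic form G for the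
   second locus. Its K-points are the functionals T(-, y, z) with T(x, y, -) = T(x, z, -) = 0, and a
   form which vanishes at all gradients dF(x), F(x) = 0, vanishes at all of them; so irreducibility
   of G = 0 follows from that of F = 0, and G <> 0 from a count of forms a with F | a(dF).
   Both statements descend from K to k since divisibility of polynomials does. *)

(** * Polynomials in several variables *)

(** The characteristic is arbitrary, and this shapes the tools. Pfaffians enter only through their
    squares: identities are proved between squares of linear forms, and a root is then extracted for
    all arguments at once, at the price of an unknown sign. Cubic forms are kept as trilinear
    tensors without symmetry. About f_16 only its invariance in characteristic 0, its degree and its
    primitivity are given, so semi-invariance is obtained as an identity between integer polynomials
    and carried to every ring. The sextic G can be non-reduced in characteristic 2, so no primality
    of G is attempted: a product of forms vanishing on G = 0 is pulled back by the gradient map to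
    the cubic, which is prime. The geometry takes place at K-points, whereas irreducibility concerns
    points over all extension fields of k. The bridge is that a power of a form vanishing at the
    K-points of H = 0 is divisible by H, an identity that can be evaluated anywhere. *)

Lemma rmorph_mmap (n : nat) (R S T : nzRingType) (g : {rmorphism S -> T})
    (f : R -> S) (h : 'I_n -> S) (p : {mpoly R[n]}) :
  g (mmap f h p) = mmap (g \o f) (g \o h) p.
Proof.
rewrite /mmap rmorph_sum; apply: eq_bigr => m _.
rewrite rmorphM /= /mmap1 rmorph_prod; congr (_ * _).
by apply: eq_bigr => i _; rewrite rmorphXn.
Qed.

Lemma eq_mmap (n : nat) (R S : nzRingType) (f f' : R -> S) (h h' : 'I_n -> S)
    (p : {mpoly R[n]}) : f =1 f' -> h =1 h' -> mmap f h p = mmap f' h' p.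
Proof.
move=> ef eh; rewrite /mmap; apply: eq_bigr => m _; rewrite ef; congr (_ * _).
by rewrite /mmap1; apply: eq_bigr => i _; rewrite eh.
Qed.

Lemma mmap_map_mpoly (n : nat) (R S T : nzRingType) (g : {additive R -> S})
    (f : {additive S -> T}) (h : 'I_n -> T) (p : {mpoly R[n]}) :
  mmap f h (map_mpoly g p) = mmap (f \o g) h p.
Proof.
pose k := maxn (msize p) (msize (map_mpoly g p)).
rewrite (@mmapE _ _ _ h f _ k) ?leq_maxr // (@mmapE _ _ _ h (f \o g) _ k) ?leq_maxl //.
by apply: eq_bigr => m _; rewrite mcoeff_map_mpoly.
Qed.

Lemma mmap_id (n : nat) (R : nzRingType) (p : {mpoly R[n]}) :
  mmap (@mpolyC n R) (fun i => 'X_i) p = p.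
Proof.
rewrite [RHS]mpolyE /mmap; apply: eq_bigr => m _.
by rewrite mul_mpolyC mmap1_id.
Qed.

Lemma muniK n (R : comNzRingType) :
  cancel (@muni n R) (fun q => (map_poly (@mwiden n R) q).['X_ord_max]).
Proof.
move=> p; rewrite -[RHS]mmap_id.
rewrite -[LHS]/((horner_eval 'X_ord_max \o map_poly (@mwiden n R)) (muni p)).
rewrite /muni rmorph_mmap; apply: eq_mmap => [c|i] /=; rewrite /horner_eval.
  by rewrite map_polyC hornerC /= mwidenC.
case: splitP => j /= ej.
  rewrite map_polyC hornerC /= mwidenX mnmwiden1; congr 'X_[U_(_)].
  by apply/val_inj.
rewrite map_polyX hornerX; congr 'X_[U_(_)]; apply/val_inj => /=.
by rewrite ej ord1 addn0.
Qed.

Lemma poly_pointwise0 (K : closedFieldType) (q : {poly K}) :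
  (forall x, q.[x] = 0) -> q = 0.
Proof.
move=> q0; apply/eqP/negPn/negP => qn0.
by have /closed_nonrootP[x] := qn0; rewrite /root q0 eqxx.
Qed.

Lemma meval_pointwise0 (K : closedFieldType) n (p : {mpoly K[n]}) :
  (forall v, p.@[v] = 0) -> p = 0.
Proof.
elim: n p => [|n IH] p p0.
  by have := p0 (fun=> 0); rewrite (nvar0_mpolyC p) mevalC => ->; rewrite mpolyC0.
rewrite -[p]muniK; suff -> : muni p = 0 by rewrite rmorph0 horner0.
apply/polyP => i; rewrite coef0; apply: IH => v.
have : map_poly (meval v) (muni p) = 0; last first.
  by move/(congr1 (fun q : {poly K} => q`_i)); rewrite coef_map coef0.
apply: poly_pointwise0 => x.
pose w (j : 'I_n.+1) := if unlift ord_max j is Some j' then v j' else x.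
rewrite -(p0 w) -[LHS]/((horner_eval x \o map_poly (meval v)) (muni p)).
rewrite /muni rmorph_mmap /meval; apply: eq_mmap => [c|j] /=; rewrite /horner_eval.
  by rewrite map_polyC hornerC /= mevalC.
case: splitP => k /= ek.
  rewrite map_polyC hornerC /= mevalXU /w.
  have -> : j = lift ord_max k by apply/val_inj; rewrite /= /bump leqNgt ltn_ord add0n.
  by rewrite liftK.
rewrite map_polyX hornerX /w.
have -> : j = ord_max by apply/val_inj => /=; rewrite ek ord1 /= addn0.
by rewrite unlift_none.
Qed.

(** Induction on the leading monomial: the leading term of [p] is cancelled by a multiple of [q]
    when [mlead q] divides it, and moved to the remainder otherwise. *)
Lemma mpoly_division n (K : fieldType) (q : {mpoly K[n]}) : q != 0 ->
  forall p : {mpoly K[n]}, exists s r : {mpoly K[n]}, p = q * s + r /\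
    (forall m, m \in msupp r -> ~~ (mlead q <= m)%MM).
Proof.
move=> qn0; elim/mleadrect => p IH.
have [->|pn0] := eqVneq p 0.
  by exists 0, 0; split; [rewrite mulr0 addr0 | move=> m; rewrite msupp0].
pose p' := p - p@_(mlead p) *: 'X_[mlead p].
have IH' : exists s r : {mpoly K[n]}, p' = q * s + r /\
    (forall m, m \in msupp r -> ~~ (mlead q <= m)%MM).
  have [->|p'n0] := eqVneq p' 0.
    by exists 0, 0; split; [rewrite mulr0 addr0 | move=> m; rewrite msupp0].
  by apply: IH; apply: ltm_mleadD.
have [le_qp|nle_qp] := boolP (mlead q <= mlead p)%MM; last first.
  have [s [r [e hr]]] := IH'.
  exists s, (r + p@_(mlead p) *: 'X_[mlead p]); split.
    by rewrite addrA -e /p' subrK.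
  move=> m /msuppD_le; rewrite mem_cat => /orP[/hr //|].
  by move/msuppZ_le; rewrite msuppX inE => /eqP ->.
pose c := p@_(mlead p) / q@_(mlead q).
pose t := c *: 'X_[mlead p - mlead q].
have [p2 | p2n0] := eqVneq (p - q * t) 0.
  exists t, 0; split; last by move=> m; rewrite msupp0.
  by rewrite addr0; apply/eqP; rewrite -subr_eq0 p2.
have lcq : q@_(mlead q) != 0 by rewrite mleadc_eq0.
have cn0 : c != 0 by rewrite mulf_neq0 ?invr_eq0 ?mleadc_eq0.
have Xn0 : 'X_[mlead p - mlead q] != 0 :> {mpoly K[n]} by rewrite -msize_poly_eq0 msizeX.
have tn0 : t != 0 by rewrite /t mscalerI negb_or cn0.
have lqt : mlead (q * t) = mlead p.
  by rewrite mleadM // mleadZ // mleadXm addmC submK.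
have lcqt : (q * t)@_(mlead p) = p@_(mlead p).
  rewrite -{1}lqt mleadM // mleadcM mleadZ // mleadcZ /c.
  by rewrite mleadXm mcoeffX eqxx mulr1 mulrCA divff // mulr1.
have [|s [r [e hr]]] := IH (p - q * t).
  rewrite lt_neqAle; apply/andP; split; last first.
    by apply: le_trans (mleadB_le _ _) _; rewrite lqt joinxx.
  apply/eqP => e; have : (p - q * t)@_(mlead p) == 0.
    by rewrite mcoeffB lcqt subrr.
  by rewrite -e mleadc_eq0 (negbTE p2n0).
exists (t + s), r; split=> //.
by rewrite mulrDr -addrA -e addrCA subrr addr0.
Qed.

Lemma mpoly_reduced_dvd n (K : fieldType) (q r s : {mpoly K[n]}) :
  (forall m, m \in msupp r -> ~~ (mlead q <= m)%MM) -> r = q * s -> r = 0.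
Proof.
move=> hr e; apply/eqP/negPn/negP => rn0.
have qn0 : q != 0 by apply: contraNneq rn0 => q0; rewrite e q0 mul0r.
have sn0 : s != 0 by apply: contraNneq rn0 => q0; rewrite e q0 mulr0.
by have /negP := hr _ (mlead_supp rn0); rewrite e mleadM // lem_addr.
Qed.

(** Dividing over [k] gives a remainder that stays reduced over [K], because the extension changes
    neither supports nor leading monomials; divisibility over [K] then makes it zero. *)
Lemma mpoly_dvd_descent n (k K : fieldType) (f : {rmorphism k -> K})
    (p q : {mpoly k[n]}) (s : {mpoly K[n]}) :
  map_mpoly f p = map_mpoly f q * s -> exists s', p = q * s'.
Proof.
have finj : injective f by apply: fmorph_inj.
have minj (r : {mpoly k[n]}) : map_mpoly f r = 0 -> r = 0.
  move=> /mpolyP r0; apply/mpolyP => m; apply: finj.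
  by rewrite -mcoeff_map_mpoly r0 !mcoeff0 rmorph0.
have [->|qn0] := eqVneq q 0.
  by rewrite rmorph0 mul0r => /minj ->; exists 0; rewrite mulr0.
move=> e; have [s' [r [ep hr]]] := mpoly_division qn0 p.
exists s'; rewrite ep; suff -> : r = 0 by rewrite addr0.
have supE (t : {mpoly k[n]}) : msupp (map_mpoly f t) =i msupp t.
  by move=> m; apply/perm_mem/msupp_map_mpoly.
apply: minj; apply: (@mpoly_reduced_dvd _ _ (map_mpoly f q) _ (s - map_mpoly f s')).
  have -> : mlead (map_mpoly f q) = mlead q.
    by rewrite /mlead (perm_big _ (msupp_map_mpoly _ finj)).
  by move=> m; rewrite supE => /hr.
by rewrite mulrBr -rmorphM -e ep rmorphD addrC addKr.
Qed.

(* If p/q is almost integral, so is r/q with r the remainder of p by q, and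
   comparing leading monomials of q^j | c r^j for large j gives mlead q <= mlead r. *)
Lemma mpoly_almost_integral n (K : fieldType) (p q c : {mpoly K[n]}) :
  q != 0 -> c != 0 -> (forall j, exists s, c * p ^+ j = q ^+ j * s) ->
  exists s, p = q * s.
Proof.
move=> qn0 cn0 h; have [s [r [ep hr]]] := mpoly_division qn0 p.
exists s; rewrite ep; suff -> : r = 0 by rewrite addr0.
apply/eqP/negPn/negP => rn0.
have {}h j : exists s, c * r ^+ j = q ^+ j * s.
  have -> : r = p - q * s by rewrite ep addrC addKr.
  rewrite exprBn big_distrr /=.
  apply: (@big_ind _ (fun x => exists s, x = q ^+ j * s)).
  - by exists 0; rewrite mulr0.
  - by move=> x y [sx ->] [sy ->]; exists (sx + sy); rewrite mulrDr.
  move=> i _; have [u eu] := h (j - i)%N.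
  exists ((-1) ^+ i * u * s ^+ i *+ 'C(j, i)).
  have -> : q ^+ j = q ^+ (j - i) * q ^+ i by rewrite -exprD subnK // -ltnS.
  rewrite !mulrnAr; congr (_ *+ _); rewrite exprMn.
  transitivity ((-1) ^+ i * (c * p ^+ (j - i)) * (q ^+ i * s ^+ i)); first by ring.
  by rewrite eu; ring.
have /negP := hr _ (mlead_supp rn0); apply; apply/mnm_lepP => i.
rewrite leqNgt; apply/negP => lt_i.
(* The excess of the exponent of variable [i] in [mlead q] is multiplied by the power j, so j =
   [(mlead c i).+1] already exceeds what [c] can contribute. *)
have [u eu] := h (mlead c i).+1.
have un0 : u != 0.
  apply: contraTneq (mulf_neq0 cn0 (expf_neq0 (mlead c i).+1 rn0)) => u0.
  by rewrite eu u0 mulr0 eqxx.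
have := congr1 (fun t => mlead t i) eu.
rewrite /= !mleadM ?expf_neq0 // !mleadX // !mnmDE !mulmnE => ee.
have : ((mlead r i).+1 * (mlead c i).+1 <= mlead c i + mlead r i * (mlead c i).+1)%N.
  by rewrite ee (leq_trans _ (leq_addr _ _)) // leq_mul2r lt_i orbT.
by rewrite mulSn leq_add2r ltnn.
Qed.

(** The hypothesis is f(p/q) = 0 cleared of denominators. A monic equation of degree d reduces all
    powers of p/q to those below d, so the single factor q^d clears every denominator and
    [mpoly_almost_integral] applies. *)
Lemma mpoly_normal n (K : fieldType) (f : {poly {mpoly K[n]}}) (p q : {mpoly K[n]}) :
  q != 0 -> f \is monic -> \sum_(i < size f) f`_i * p ^+ i * q ^+ ((size f).-1 - i) = 0 ->
  exists s, p = q * s.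
Proof.
move=> qn0 fmon; have fn0 := monic_neq0 fmon.
case ef : (size f) => [|d]; first by move/eqP: ef; rewrite size_poly_eq0 (negbTE fn0).
rewrite big_ord_recr /= subnn expr0 mulr1.
have -> : f`_d = 1 by move/monicP: fmon; rewrite lead_coefE ef.
rewrite mul1r addrC => /eqP; rewrite addr_eq0 => /eqP ed.
apply: (@mpoly_almost_integral _ _ p q (q ^+ d)) => //; first exact: expf_neq0.
move=> j; have [m lejm] := ubnP j; elim: m j lejm => // m IH j lejm.
have [ltjd|ledj] := ltnP j d.
  exists (q ^+ (d - j) * p ^+ j).
  by rewrite mulrA -exprD subnKC // ltnW.
have -> : p ^+ j = p ^+ (j - d) * p ^+ d by rewrite -exprD subnK.
rewrite ed mulrA mulrN big_distrr /= -mulrN1.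
suff [s ->] : exists s, \sum_(i < d) q ^+ d * p ^+ (j - d) * (f`_i * p ^+ i * q ^+ (d - i))
   = q ^+ j * s by exists (- s); rewrite mulrN1 mulrN.
apply: (@big_ind _ (fun x => exists s, x = q ^+ j * s)).
- by exists 0; rewrite mulr0.
- by move=> x y [sx ->] [sy ->]; exists (sx + sy); rewrite mulrDr.
move=> i _; have [|u eu] := IH (j - d + i)%N.
  rewrite -ltnS; apply: leq_trans lejm; rewrite ltnS -{2}(subnK ledj).
  by rewrite ltn_add2l.
exists (f`_i * u).
have -> : q ^+ j = q ^+ (j - d + i) * q ^+ (d - i).
  by rewrite -exprD -addnA subnKC ?subnK // ltnW.
transitivity (f`_i * (q ^+ d * p ^+ (j - d + i)) * q ^+ (d - i)).
  by rewrite exprD; ring.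
by rewrite eu; ring.
Qed.

(** * Alternating matrices *)

(** The zero diagonal is a separate condition because of characteristic 2. *)
Definition altmx (R : nzRingType) n (A : 'M[R]_n) : Prop :=
  A^T = - A /\ forall i, A i i = 0.

Lemma altmx_congr (R : comNzRingType) m n (A : 'M[R]_n) (C : 'M[R]_(m, n)) :
  altmx A -> altmx (C *m A *m C^T).
Proof.
move=> [At A0]; split.
  by rewrite !trmx_mul trmxK At mulNmx mulmxN mulmxA.
move=> i; rewrite mxE.
under eq_bigr => j _ do rewrite !mxE big_distrl /=.
have Aij j l : A j l = - A l j by have := congr1 (fun M : 'M_n => M l j) At; rewrite !mxE.
rewrite pair_big_dep /= (bigID (fun p : 'I_n * 'I_n => (p.2 < p.1)%N)) /=.
rewrite [X in _ + X](bigID (fun p : 'I_n * 'I_n => (p.1 < p.2)%N)) /=.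
rewrite [X in _ + (_ + X)]big1 ?addr0; last first.
  move=> [j l] /=; rewrite -!leqNgt => /andP[h1 h2].
  have -> : j = l by apply/val_inj/eqP; rewrite eqn_leq h1 h2.
  by rewrite A0 mulr0 mul0r.
rewrite [X in _ + X](reindex_inj (h := fun p : 'I_n * 'I_n => (p.2, p.1))) /=; last first.
  by move=> [a b] [c d] /= [-> ->].
rewrite [X in _ + X](eq_bigl (fun p : 'I_n * 'I_n => (p.2 < p.1)%N)); last first.
  by move=> [a b] /=; rewrite -leqNgt; case: ltngtP.
rewrite -big_split big1 //= => p _; rewrite (Aij p.2).
by rewrite mulrN mulNr addrC; apply/eqP; rewrite subr_eq0; apply/eqP; ring.
Qed.

Lemma det_mx2 (R : comNzRingType) (M : 'M[R]_2) :
  \det M = M 0 0 * M 1 1 - M 0 1 * M 1 0.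
Proof.
rewrite (expand_det_row _ ord0) !big_ord_recl big_ord0 addr0 /cofactor !det_mx11 !mxE /=.
rewrite /bump /= expr0 mul1r addn0 expr1 mulN1r mulrN.
by congr (_ * M _ _ - M _ _ * M _ _); apply/val_inj.
Qed.

Lemma ord2P (P : 'I_2 -> Prop) : P 0 -> P 1 -> forall i, P i.
Proof.
by move=> P0 P1 [[|[|//]] lti]; [move: P0|move: P1]; congr P; apply/val_inj.
Qed.

Section AlternatingField.
Variable K : fieldType.

(** Orthogonal splitting along a plane where the form is nondegenerate: pairing a relation among the
    rows with [P] kills its [P] part first. *)
Lemma alt_split_step m (A : 'M[K]_(2 + m)) (P : 'M_(2, 2 + m)) (C : 'M_(m, 2 + m)) :
  P *m A *m P^T \in unitmx -> C *m A *m P^T = 0 -> P *m A *m C^T = 0 -> row_free C ->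
  let B := col_mx P C in B \in unitmx /\
   B *m A *m B^T = block_mx (P *m A *m P^T) 0 0 (C *m A *m C^T).
Proof.
move=> uJ CAP PAC fC B; split; last first.
  by rewrite /B tr_col_mx mul_col_mx mul_col_row CAP PAC.
rewrite -row_free_unit -kermx_eq0; apply/eqP/row_matrixP => i; rewrite row0.
set u := row i _; have uB : u *m B = 0.
  by apply/sub_kermxP; exact: row_sub.
move: uB; rewrite -[u]hsubmxK /B mul_row_col => e.
have u1 : lsubmx u = 0.
  have : (lsubmx u *m P + rsubmx u *m C) *m (A *m P^T) = 0 by rewrite e mul0mx.
  rewrite mulmxDl -[rsubmx u *m C *m _]mulmxA [C *m (_ *m _)]mulmxA CAP mulmx0 addr0.
  rewrite -[lsubmx u *m P *m _]mulmxA [P *m (_ *m _)]mulmxA => /(congr1 (mulmx^~ (invmx (P *m A *m P^T)))).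
  by rewrite mulmxK // mul0mx.
have u2 : rsubmx u = 0.
  by apply: (row_free_inj fC); rewrite mul0mx -e u1 mul0mx add0r.
by rewrite u1 u2 row_mx0.
Qed.

(** A hyperbolic plane is split off and its orthogonal complement is treated by induction. The root
    [d] takes the place of the Pfaffian. *)
Lemma altmx_rank_det n (A : 'M[K]_n) :
  altmx A -> ~~ odd (\rank A) /\ exists d, \det A = d ^+ 2.
Proof.
have [m lenm] := ubnP n; elim: m n A lenm => // m IH n A lenm altA.
have [At A0] := altA.
have [-> | An0] := eqVneq A 0.
  split; first by rewrite mxrank0.
  case: n {A altA At A0 lenm} => [|n]; first by exists 1; rewrite det_mx00 expr1n.
  exists 0; rewrite expr0n /= (expand_det_row _ ord0) big1 // => i _.
  by rewrite mxE mul0r.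
have [i [j Aij]] : exists i j, A i j != 0.
  have /existsP[i /existsP[j h]] : [exists i, exists j, A i j != 0].
    apply: contraNT An0 => /existsPn h; apply/eqP/matrixP => i j.
    by have /existsPn/(_ j) := h i; rewrite negbK mxE => /eqP.
  by exists i, j.
pose e : 'rV[K]_n := delta_mx 0 i; pose f : 'rV[K]_n := (A i j)^-1 *: delta_mx 0 j.
pose P := col_mx e f.
have eA (v : 'rV_n) : e *m A *m v^T = (A *m v^T) i 0 *: 1.
  rewrite -mulmxA -rowE; apply/matrixP => a b; rewrite !ord1 !mxE eqxx mulr1.
  by [].
have PP : P *m A *m P^T = block_mx 0 1 (-1) 0 :> 'M_(1 + 1).
  have altP := altmx_congr P altA.
  have [t d] := altP; rewrite /P tr_col_mx mul_col_mx mul_col_row in t d *.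
  have h12 : e *m A *m f^T = 1.
    rewrite eA /f linearZ /= trmx_delta -scalemxAr mxE -colE mxE mulVf //.
    by rewrite scale1r.
  have h21 : f *m A *m e^T = - 1.
    apply: trmx_inj; rewrite !trmx_mul trmxK At mulNmx mulmxN mulmxA h12.
    by rewrite linearN /= trmx1.
  have z v : v *m A *m v^T = 0 :> 'M_1.
    by have [_ h] := altmx_congr v altA; apply/matrixP => a b; rewrite !ord1 h mxE.
  by rewrite h12 h21 !z.
have uJ : P *m A *m P^T \in unitmx.
  rewrite PP unitmxE (_ : block_mx _ _ _ _ = block_mx 0 1 1 0 *m block_mx (-1) 0 0 1).
    rewrite det_mulmx det_ublock !det1 mulr1 [\det (-1)]det_mx11 !mxE eqxx.
    have : block_mx 0 1 1 0 *m block_mx 0 1 1 0 = 1%:M :> 'M[K]_(1+1).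
      by rewrite mulmx_block !mul0mx !mulmx0 !mul1mx !addr0 !add0r -scalar_mx_block.
    move/(congr1 (@determinant _ _)); rewrite det_mulmx det1 => h.
    rewrite unitrM unitrN1 andbT; apply/unitrP; by exists (\det (block_mx 0 1 1 0 : 'M[K]_(1+1))); rewrite h.
  by rewrite mulmx_block !mul0mx !mulmx0 !mul1mx !addr0 !add0r.
pose W := kermx (A *m P^T).
have rAP : \rank (A *m P^T) = 2%N.
  apply/eqP; rewrite eqn_leq rank_leq_col /=.
  by have := mxrankM_maxr P (A *m P^T); rewrite mulmxA (mxrank_unit uJ).
have rW : (n = 2 + \rank W)%N.
  by rewrite mxrank_ker rAP subnKC // -rAP rank_leq_row.
have [C' fC' CAP'] : exists2 C' : 'M_(\rank W, n), row_free C' & C' *m A *m P^T = 0.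
  exists (row_base W); first exact: row_base_free.
  by rewrite -mulmxA; apply/sub_kermxP; rewrite eq_row_base.
move: (\rank W) rW C' fC' CAP' => p en; subst n.
clear W rAP eA => C fC CAP.
have PAC : P *m A *m C^T = 0.
  apply: trmx_inj; rewrite !trmx_mul trmxK At mulNmx mulmxN mulmxA CAP.
  by rewrite trmx0 oppr0.
have [uB eB] := alt_split_step uJ CAP PAC fC.
set B := col_mx P C in uB eB.
have [||par [d dd]] := IH p (C *m A *m C^T).
- by rewrite -ltnS (leq_trans _ lenm).
- exact: altmx_congr.
split.
  have <- : \rank (B *m A *m B^T) = \rank A.
    rewrite mxrankMfree ?row_free_unit ?unitmx_tr //.
    by rewrite eqmxMfull // row_full_unit.
  by rewrite eB rank_diag_block_mx oddD (mxrank_unit uJ).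
have dJ : \det (P *m A *m P^T) = 1.
  rewrite PP; set M := block_mx _ _ _ _; rewrite (@det_mx2 K M) /M.
  have sp0 : split (0 : 'I_(1 + 1)) = inl 0.
    by case: splitP => k; rewrite ?ord1 // => _; congr inl; apply/val_inj.
  have sp1 : split (1 : 'I_(1 + 1)) = inr 0.
    by case: splitP => k; rewrite ?ord1 // => _; congr inr; apply/val_inj.
  by rewrite !mxE !sp0 !sp1 !mxE !sp0 !sp1 !mxE eqxx mul0r sub0r mul1r opprK.
exists (d / \det B).
have := congr1 determinant eB; rewrite !det_mulmx det_tr det_ublock dJ dd mul1r.
move=> e2; rewrite expr_div_n -e2 expr2; field.
by move: uB; rewrite unitmxE unitfE.
Qed.

(** Clear for nonzero determinants, by cancelling the product. In general M is replaced by M + X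
    over the polynomial ring, where the determinant is monic, and X is set to 0 at the end. *)
Lemma adj_mulmx n (A B : 'M[K]_n) : \adj (A *m B) = \adj B *m \adj A.
Proof.
pose f := @polyC K.
pose s (M : 'M[K]_n) : 'M[{poly K}]_n := map_mx f M + 'X%:M.
have sn0 M : \det (s M) != 0.
  have -> : s M = char_poly_mx (- M).
    by rewrite /char_poly_mx map_mxN opprK addrC.
  exact/monic_neq0/char_poly_monic.
have s0 M : map_mx (horner_eval 0) (s M) = M.
  apply/matrixP => i j; rewrite !mxE /horner_eval hornerD hornerC hornerMn hornerX.
  by rewrite mul0rn addr0.
have key : \adj (s A *m s B) = \adj (s B) *m \adj (s A).
  have dn0 : \det (s A *m s B) != 0 by rewrite det_mulmx mulf_neq0.
  have e : (\adj (s A *m s B) - \adj (s B) *m \adj (s A)) *m (s A *m s B) = 0.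
    rewrite mulmxBl mul_adj_mx !mulmxA -[_ *m \adj (s A) *m s A]mulmxA mul_adj_mx.
    rewrite mul_mx_scalar -scalemxAl mul_adj_mx det_mulmx.
    by rewrite scale_scalar_mx ?subrr // mulrC subrr.
  have := congr1 (mulmx^~ (\adj (s A *m s B))) e.
  rewrite mul0mx -mulmxA mul_mx_adj mul_mx_scalar => /eqP.
  rewrite scalemx_eq0 (negbTE dn0) subr_eq0 => /eqP //.
have := congr1 (map_mx (horner_eval 0)) key.
by rewrite map_mx_adj !map_mxM !map_mx_adj !s0.
Qed.

(** The constant part of the pencil lives in the lower right block only, so each of the first [k]
    rows is divisible by t; what remains is block triangular at t = 0. *)
Lemma det_block_expand k m (B11 : 'M[K]_k) (B12 : 'M_(k, m)) (B21 : 'M_(m, k))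
    (A22 B22 : 'M_m) :
  exists D : {poly K}, D.[0] = \det B11 * \det A22 /\
    forall t, \det (block_mx (t *: B11) (t *: B12) (t *: B21) (A22 + t *: B22)) = t ^+ k * D.[t].
Proof.
pose c p q (M : 'M[K]_(p, q)) := map_mx (@polyC K) M.
exists (\det (block_mx (c _ _ B11) (c _ _ B12) ('X *: c _ _ B21) (c _ _ A22 + 'X *: c _ _ B22))).
have ev t : (\det (block_mx (c _ _ B11) (c _ _ B12) ('X *: c _ _ B21) (c _ _ A22 + 'X *: c _ _ B22))).[t]
   = \det (block_mx B11 B12 (t *: B21) (A22 + t *: B22)).
  rewrite -[LHS]/(horner_eval t _) -det_map_mx map_block_mx; congr (\det (block_mx _ _ _ _)).
  - by apply/matrixP => i j; rewrite /c !mxE /= /horner_eval hornerC.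
  - by apply/matrixP => i j; rewrite /c !mxE /= /horner_eval hornerC.
  - by apply/matrixP => i j; rewrite /c !mxE /= /horner_eval hornerM hornerX hornerC.
  - by apply/matrixP => i j; rewrite /c !mxE /= /horner_eval hornerD hornerM hornerX !hornerC.
split; first by rewrite ev scale0r scale0r addr0 det_ublock.
move=> t; rewrite ev.
have -> : block_mx (t *: B11) (t *: B12) (t *: B21) (A22 + t *: B22) =
   block_mx t%:M 0 0 1%:M *m block_mx B11 B12 (t *: B21) (A22 + t *: B22).
  by rewrite mulmx_block !mul0mx !mul1mx !add0r !addr0 !mul_scalar_mx.
by rewrite det_mulmx det_ublock det_scalar det1 mulr1.
Qed.
End AlternatingField.

(** * Trilinear forms *)

Section Trilinear.
Variables (R : comNzRingType) (n : nat).
Implicit Types (c : tensor3 R n) (x y z u v w : 'rV[R]_n).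

Definition tri c x y z : R :=
  \sum_i \sum_j \sum_l x 0 i * y 0 j * z 0 l * c (i, j, l).

Lemma tri1P c a x x' y z : tri c (a *: x + x') y z = a * tri c x y z + tri c x' y z.
Proof.
rewrite /tri big_distrr -big_split; apply: eq_bigr => i _ /=.
rewrite big_distrr -big_split; apply: eq_bigr => j _ /=.
rewrite big_distrr -big_split; apply: eq_bigr => l _ /=.
by rewrite !mxE; ring.
Qed.

Lemma tri2P c a x y y' z : tri c x (a *: y + y') z = a * tri c x y z + tri c x y' z.
Proof.
rewrite /tri big_distrr -big_split; apply: eq_bigr => i _ /=.
rewrite big_distrr -big_split; apply: eq_bigr => j _ /=.
rewrite big_distrr -big_split; apply: eq_bigr => l _ /=.
by rewrite !mxE; ring.
Qed.

Lemma tri3P c a x y z z' : tri c x y (a *: z + z') = a * tri c x y z + tri c x y z'.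
Proof.
rewrite /tri big_distrr -big_split; apply: eq_bigr => i _ /=.
rewrite big_distrr -big_split; apply: eq_bigr => j _ /=.
rewrite big_distrr -big_split; apply: eq_bigr => l _ /=.
by rewrite !mxE; ring.
Qed.

Lemma tri10 c y z : tri c 0 y z = 0.
Proof. by rewrite /tri big1 // => i _; rewrite big1 // => j _; rewrite big1 // => l _; rewrite mxE !mul0r. Qed.
Lemma tri20 c y z : tri c y 0 z = 0.
Proof. by rewrite /tri big1 // => i _; rewrite big1 // => j _; rewrite big1 // => l _; rewrite [(0 : 'rV_n) _ _]mxE mulr0 !mul0r. Qed.
Lemma tri30 c y z : tri c y z 0 = 0.
Proof. by rewrite /tri big1 // => i _; rewrite big1 // => j _; rewrite big1 // => l _; rewrite [(0 : 'rV_n) _ _]mxE mulr0 !mul0r. Qed.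
Lemma tri1Z c a x y z : tri c (a *: x) y z = a * tri c x y z.
Proof. by rewrite -[a *: x]addr0 tri1P tri10 addr0. Qed.
Lemma tri2Z c a x y z : tri c x (a *: y) z = a * tri c x y z.
Proof. by rewrite -[a *: y]addr0 tri2P tri20 addr0. Qed.
Lemma tri3Z c a x y z : tri c x y (a *: z) = a * tri c x y z.
Proof. by rewrite -[a *: z]addr0 tri3P tri30 addr0. Qed.
Lemma tri1D c x x' y z : tri c (x + x') y z = tri c x y z + tri c x' y z.
Proof. by rewrite -[x in LHS]scale1r tri1P mul1r. Qed.
Lemma tri2D c x y y' z : tri c x (y + y') z = tri c x y z + tri c x y' z.
Proof. by rewrite -[y in LHS]scale1r tri2P mul1r. Qed.
Lemma tri3D c x y z z' : tri c x y (z + z') = tri c x y z + tri c x y z'.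
Proof. by rewrite -[z in LHS]scale1r tri3P mul1r. Qed.
Lemma tri1N c x y z : tri c (- x) y z = - tri c x y z.
Proof. by rewrite -scaleN1r tri1Z mulN1r. Qed.
Lemma tri2N c x y z : tri c x (- y) z = - tri c x y z.
Proof. by rewrite -scaleN1r tri2Z mulN1r. Qed.
Lemma tri3N c x y z : tri c x y (- z) = - tri c x y z.
Proof. by rewrite -scaleN1r tri3Z mulN1r. Qed.

Definition triE := (tri1D, tri1Z, tri1N, tri10, tri2D, tri2Z, tri2N, tri20,
  tri3D, tri3Z, tri3N, tri30).

Lemma tri1_sum c I (r : seq I) (P : pred I) (F : I -> 'rV_n) y z :
  tri c (\sum_(i <- r | P i) F i) y z = \sum_(i <- r | P i) tri c (F i) y z.
Proof.
by apply: (big_morph (fun x => tri c x y z)) => [u v|]; rewrite (tri1D, tri10).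
Qed.

Lemma tri2_sum c I (r : seq I) (P : pred I) (F : I -> 'rV_n) y z :
  tri c y (\sum_(i <- r | P i) F i) z = \sum_(i <- r | P i) tri c y (F i) z.
Proof.
by apply: (big_morph (fun x => tri c y x z)) => [u v|]; rewrite (tri2D, tri20).
Qed.

Lemma tri3_sum c I (r : seq I) (P : pred I) (F : I -> 'rV_n) y z :
  tri c y z (\sum_(i <- r | P i) F i) = \sum_(i <- r | P i) tri c y z (F i).
Proof.
by apply: (big_morph (fun x => tri c y z x)) => [u v|]; rewrite (tri3D, tri30).
Qed.

Lemma tri_phi c x y z : tri c x y z = (y *m phi_matrix c x^T *m z^T) 0 0.
Proof.
rewrite mxE /tri exchange_big /=.
under [RHS]eq_bigr => l _ do rewrite !mxE big_distrl /=.
rewrite [RHS]exchange_big /=; apply: eq_bigr => j _.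
rewrite exchange_big /=; apply: eq_bigr => l _.
rewrite !mxE big_distrr big_distrl /=; apply: eq_bigr => i _.
by rewrite !mxE; ring.
Qed.

Lemma tri_delta c i j l :
  tri c (delta_mx 0 i) (delta_mx 0 j) (delta_mx 0 l) = c (i, j, l).
Proof.
by rewrite tri_phi -rowE !trmx_delta -colE !mxE (bigD1 i) //= big1 ?addr0;
  [rewrite !mxE !eqxx mul1r | move=> k /negbTE ki; rewrite !mxE ki /= mul0r].
Qed.

Lemma phi_matrixP a x x' c :
  phi_matrix c (a *: x + x')^T = a *: phi_matrix c x^T + phi_matrix c x'^T.
Proof.
apply/matrixP => j l; rewrite !mxE big_distrr -big_split; apply: eq_bigr => i _ /=.
by rewrite !mxE; ring.
Qed.

Lemma phi_altmx c x : alternating c -> altmx (phi_matrix c x^T).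
Proof.
move=> [h1 h2]; split; last first.
  by move=> i; rewrite mxE big1 // => j _; have [_ -> _] := h1 j i; rewrite mulr0.
apply/matrixP => i j; rewrite !mxE -sumrN; apply: eq_bigr => l _.
by have [_ ->] := h2 l i j; rewrite mulrN.
Qed.

Section Alternating.
Variable c : tensor3 R n.
Hypothesis altc : alternating c.

Lemma tri23 x y : tri c x y y = 0.
Proof. by rewrite tri_phi; case: (altmx_congr y (phi_altmx x altc)). Qed.

Lemma tri_swap23 x y z : tri c x z y = - tri c x y z.
Proof.
by apply/eqP; rewrite -addr_eq0; have := tri23 x (y + z);
   rewrite !triE !tri23 add0r addr0 addrC => ->.
Qed.

Lemma tri_swap12 x y z : tri c y x z = - tri c x y z.
Proof.
rewrite /tri exchange_big -sumrN /=; apply: eq_bigr => i _.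
rewrite -sumrN; apply: eq_bigr => j _; rewrite -sumrN; apply: eq_bigr => l _.
by have [_ h] := altc; have [-> _] := h i j l; ring.
Qed.

Lemma tri12 x y : tri c x x y = 0.
Proof. by rewrite tri_swap23 tri_swap12 tri23 !oppr0. Qed.

Lemma tri13 x y : tri c x y x = 0.
Proof. by rewrite tri_swap23 tri12 oppr0. Qed.

End Alternating.
End Trilinear.

Definition triA := (tri12, tri13, tri23).

Section Wedge.
Variables (R : comNzRingType).

Lemma wedge3E m n (M : 'M[R]_(m, n)) c i j l :
  wedge3 M c (i, j, l) = tri c (row i M) (row j M) (row l M).
Proof.
rewrite ffunE /=; apply: eq_bigr => a _; apply: eq_bigr => b _; apply: eq_bigr => d _.
by rewrite !mxE.
Qed.

Lemma tri_wedge3 m n (M : 'M[R]_(m, n)) c x y z :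
  tri (wedge3 M c) x y z = tri c (x *m M) (y *m M) (z *m M).
Proof.
rewrite (mulmx_sum_row x) tri1_sum; apply: eq_bigr => i _.
rewrite (mulmx_sum_row y) tri2_sum; apply: eq_bigr => j _.
rewrite (mulmx_sum_row z) tri3_sum; apply: eq_bigr => l _.
by rewrite !triE wedge3E; ring.
Qed.

Lemma wedge3_mul p m n (N : 'M[R]_(p, m)) (M : 'M[R]_(m, n)) c :
  wedge3 (N *m M) c = wedge3 N (wedge3 M c).
Proof. by apply/ffunP => -[[i j] l]; rewrite !wedge3E tri_wedge3 !row_mul. Qed.

Lemma wedge3_1 n c : wedge3 (1%:M : 'M[R]_n) c = c.
Proof. by apply/ffunP => -[[i j] l]; rewrite wedge3E !row1 tri_delta. Qed.

Lemma wedge3_alt m n (M : 'M[R]_(m, n)) c : alternating c -> alternating (wedge3 M c).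
Proof.
move=> altc; split=> [i l|i j l]; rewrite !wedge3E.
  by rewrite !triA.
by rewrite tri_swap12 // [in X in _ /\ X]tri_swap23.
Qed.

End Wedge.

(** * The Hilbert-Mumford criterion *)

Definition indep3 (K : fieldType) n (x y z : 'rV[K]_n) : Prop :=
  forall a b d, a *: x + b *: y + d *: z = 0 -> [/\ a = 0, b = 0 & d = 0].

Definition notbad (K : fieldType) n (c : tensor3 K n) : Prop :=
  forall x y z : 'rV[K]_n, indep3 x y z -> (forall w, tri c x y w = 0) ->
    (forall w, tri c x z w = 0) -> (forall w, tri c y z w = 0) -> False.

Section LinearAlgebra.
Variable K : fieldType.

Lemma row_base_rank m n r (A : 'M[K]_(m, n)) :
  \rank A = r -> exists B : 'M[K]_(r, n), (B :=: A)%MS.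
Proof. by case: r /; exists (row_base A); exact: eq_row_base. Qed.

Lemma complete_basis m p (U : 'M[K]_(m, m + p)) :
  row_free U -> exists V : 'M[K]_(p, m + p), col_mx U V \in unitmx.
Proof.
move=> fU; have rC : \rank (U^C)%MS = p by rewrite mxrank_compl (eqP fU) addKn.
have [V eV] := row_base_rank rC; exists V.
rewrite -row_full_unit /row_full eqn_leq rank_leq_row /=.
rewrite -addsmxE (adds_eqmx (eqmx_refl U) eV) -[X in (X <= _)%N](mxrank1 K (m + p)).
by apply: mxrankS; rewrite submx_full // addsmx_compl_full.
Qed.

End LinearAlgebra.

Section HilbertMumford.
Variables (K : closedFieldType) (n : nat).
Implicit Types (c : tensor3 K n).

Lemma exp_not_finite (m : nat) (s : seq K) :
  (0 < m)%N -> ~ (forall t : K, t != 0 -> t ^+ m \in s).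
Proof.
move=> m0 h; pose q := 'X * \prod_(a <- s) ('X^m - a%:P).
have qn0 : q != 0.
  rewrite mulf_neq0 ?polyX_eq0 // prodf_seq_neq0; apply/allP => a _ /=.
  by rewrite monic_neq0 // monicXnsubC.
have /closed_nonrootP[x /negP] := qn0; apply; rewrite /root hornerM hornerX.
have [->|xn0] := eqVneq x 0; first by rewrite mul0r.
rewrite horner_prod mulf_eq0 prodf_seq_eq0; apply/orP; right; apply/hasP.
by exists (x ^+ m); [exact: h | rewrite hornerD hornerN hornerXn hornerC subrr eqxx].
Qed.

(** The one-parameter group with weights [w] in the basis [B] has a limit on [c] as t tends to 0,
    since the coefficients of negative weight vanish. The orbit is closed, so the limit is g0 c. It
    is fixed by the one-parameter group, and conjugating by g0 gives infinitely many elements in the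
    stabilizer of [c]. *)
Lemma hilbert_mumford c (B : 'M[K]_n) (w : 'I_n -> int) :
  alternating c -> orbit_closed c -> stabilizer_finite c ->
  B \in unitmx -> \sum_i w i = 0 -> (exists i, w i != 0) ->
  (forall i j l, (w i + w j + w l < 0) ->
     tri c (row i B) (row j B) (row l B) = 0) -> False.
Proof.
move=> altc [S hS] [s hs] uB w0 [i0 wi0] hw.
pose cB := wedge3 B c.
have altcB : alternating cB by exact: wedge3_alt.
(* The factor t^weight as a polynomial; the value 0 at negative weights is harmless, since the
   coefficient of [cB] is zero there. *)
pose ph (i j l : 'I_n) : {poly K} :=
  if (w i + w j + w l >= 0) then 'X^(`|(w i + w j + w l)%R|%N) else 0.
pose CP : tensor3 {poly K} n := [ffun t => (cB t)%:P * ph t.1.1 t.1.2 t.2].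
pose Bi := map_mx (@polyC K) (invmx B).
pose WP := wedge3 Bi CP.
pose C t : tensor3 K n := [ffun p => (CP p).[t]].
have WE t p : (WP p).[t] = wedge3 (invmx B) (C t) p.
  case: p => [[i j] l]; rewrite !ffunE /= horner_sum; apply: eq_bigr => a _.
  rewrite horner_sum; apply: eq_bigr => b _; rewrite horner_sum; apply: eq_bigr => d _.
  by rewrite !hornerM /Bi !mxE !hornerC [C t _]ffunE.
have CE t i j l : C t (i, j, l) = cB (i, j, l) * (ph i j l).[t].
  by rewrite [LHS]ffunE [CP _]ffunE hornerM hornerC.
have altC t : alternating (C t).
  have [h1 h2] := altcB; split=> [i l|i j l]; rewrite !CE.
    by have [-> -> ->] := h1 i l; rewrite !mul0r.
  have [-> ->] := h2 i j l; rewrite !mulNr; split; congr (- (_ * _)); rewrite /ph.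
    by rewrite (addrC (w j)).
  by rewrite -addrA (addrC (w l)) addrA.
pose D t : 'M[K]_n := diag_mx (\row_i (t ^ w i)).
have detD t : t != 0 -> \det (D t) = 1.
  move=> tn0; rewrite det_diag; under eq_bigr => i _ do rewrite mxE.
  have : \prod_i t ^ w i = t ^ (\sum_i w i).
    apply: (big_ind2 (fun x y => x = t ^ y)) => [|x1 x2 y1 y2 -> ->|//]; first by rewrite expr0z.
    by rewrite expfzDr.
  by move=> ->; rewrite w0 expr0z.
have DE t (c' : tensor3 K n) i j l : wedge3 (D t) c' (i, j, l) = t ^ w i * t ^ w j * t ^ w l * c' (i, j, l).
  rewrite wedge3E; have rD k : row k (D t) = t ^ w k *: delta_mx 0 k.
    by rewrite /D row_diag_mx !mxE.
  by rewrite !rD !triE tri_delta; ring.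
have DC t : t != 0 -> wedge3 (D t) cB = C t.
  move=> tn0; apply/ffunP => -[[i j] l]; rewrite DE CE -!expfzDr // /ph.
  have [ge0|lt0] := lerP 0 (w i + w j + w l).
    by rewrite hornerXn [LHS]mulrC -{1}(gez0_abs ge0).
  by rewrite /cB wedge3E hw // mulr0 mul0r.
pose g t := invmx B *m D t *m B.
have detg t : t != 0 -> \det (g t) = 1.
  move=> tn0; rewrite !det_mulmx detD // mulr1 -det_mulmx mulVmx // det1 //.
have gc t : t != 0 -> wedge3 (g t) c = wedge3 (invmx B) (C t).
  by move=> tn0; rewrite /g !wedge3_mul -/cB DC.
pose c0 := wedge3 (invmx B) (C 0).
have altc0 : alternating c0 by exact: wedge3_alt.
have [g0 dg0 ec0] : exists2 g : 'M[K]_n, \det g = 1 & c0 = wedge3 g c.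
  apply/(hS _ altc0) => p Sp.
  pose q : {poly K} := eval3 (@polyC K) p WP.
  have qE t : q.[t] = eval3 idfun p (wedge3 (invmx B) (C t)).
    rewrite -[LHS]/(horner_eval t q) /q /eval3 rmorph_mmap; apply: eq_mmap => [a|i] /=.
      by rewrite /horner_eval hornerC.
    by rewrite /horner_eval WE.
  (* The equation is known for t != 0 only; the factor X makes it hold at every t, and cancelling it
     gives the limit t = 0. *)
  suff q0 : 'X * q = 0.
    have := q0; move/eqP; rewrite mulf_eq0 polyX_eq0 /= => /eqP q00.
    by rewrite /c0 -qE q00 horner0.
  apply: poly_pointwise0 => t; rewrite hornerM hornerX.
  have [->|tn0] := eqVneq t 0; first by rewrite mul0r.
  rewrite qE -gc //.
  have /(hS _ (wedge3_alt (g t) altc)) -> : exists2 g' : 'M_n, \det g' = 1 & wedge3 (g t) c = wedge3 g' c.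
    by exists (g t) => //; exact: detg.
  - by rewrite mulr0.
  by [].
have ug0 : g0 \in unitmx by rewrite unitmxE dg0 unitr1.
have gc0 t : t != 0 -> wedge3 (g t) c0 = c0.
  move=> tn0; rewrite /c0 -wedge3_mul /g mulmxK // wedge3_mul; congr wedge3.
  apply/ffunP => -[[i j] l]; rewrite DE CE -!expfzDr // /ph.
  have [ge0|lt0] := lerP 0 (w i + w j + w l); last by rewrite horner0 !mulr0.
  rewrite hornerXn; have [->|sn0] := eqVneq (w i + w j + w l) 0; first by rewrite expr0z mul1r.
  by rewrite expr0n absz_eq0 (negbTE sn0) !mulr0.
have hst t : t != 0 -> invmx g0 *m g t *m g0 \in s.
  move=> tn0; apply: hs.
    by rewrite det_mulmx [\det (_ *m g t)]det_mulmx detg // mulr1 -det_mulmx mulVmx // det1.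
  rewrite wedge3_mul -ec0 wedge3_mul gc0 // ec0.
  by rewrite -wedge3_mul mulVmx // wedge3_1.
pose f (h : 'M[K]_n) := (B *m (g0 *m h *m invmx g0) *m invmx B) i0 i0.
have fE t : f (invmx g0 *m g t *m g0) = t ^ w i0.
  rewrite /f; have -> : g0 *m (invmx g0 *m g t *m g0) *m invmx g0 = g t.
    by move: (g t) => G; rewrite -!mulmxA mulmxV // mulmx1 mulKVmx.
  have -> : B *m g t *m invmx B = D t.
    by rewrite /g; move: (D t) => G; rewrite -!mulmxA mulmxV // mulmx1 mulKVmx.
  by rewrite !mxE eqxx mulr1n.
have fin t : t != 0 -> t ^ w i0 \in map f s.
  by move=> tn0; rewrite -fE; apply: map_f; exact: hst.
have n0 : (0 < `|w i0|)%N by rewrite absz_gt0.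
(* The weight of [i0] may be negative; adding the inverses to the list allows its absolute value as
   exponent. *)
apply: (@exp_not_finite _ (map f s ++ map GRing.inv (map f s)) n0) => t tn0.
rewrite mem_cat; have := fin t tn0; case: (w i0) => k /= h.
  by rewrite h.
apply/orP; right; apply/mapP; exists (t ^ Negz k) => //.
by rewrite NegzE -invr_expz invrK.
Qed.

End HilbertMumford.

(** * Extending independent rows inside a given row space *)

Section Extension.
Variable K : fieldType.

Lemma row_free_lincomb m n (F : 'I_m -> 'rV[K]_n) :
  (forall u : 'rV_m, \sum_k u 0 k *: F k = 0 -> u = 0) -> row_free (\matrix_k F k).
Proof.
move=> h; rewrite -kermx_eq0; apply/eqP/row_matrixP => i; rewrite row0; apply: h.
have : row i (kermx (\matrix_k F k)) *m \matrix_k F k = 0.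
  by apply/sub_kermxP; exact: row_sub.
by rewrite mulmx_sum_row; under eq_bigr => k _ do rewrite rowK.
Qed.

Lemma subbasis m n r (A : 'M[K]_(m, n)) : (r <= \rank A)%N ->
  exists W : 'M_(r, n), row_free W /\ (W <= A)%MS.
Proof.
move=> ler; exists (pid_mx r *m row_base A); split.
  by rewrite /row_free mxrankMfree ?row_base_free // rank_pid_mx.
by rewrite (submx_trans (submxMl _ _)) // eq_row_base.
Qed.

Lemma extend_basis p m n r (U : 'M[K]_(m, n)) (A : 'M[K]_(p, n)) :
  row_free U -> (m + r <= \rank A)%N ->
  exists W : 'M_(r, n), row_free (col_mx U W) /\ (W <= A)%MS.
Proof.
move=> fU hr; have [|W [fW sW]] := @subbasis _ _ r (A :\: U)%MS.
  have := mxrank_cap_compl A U.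
  have := mxrankS (capmxSr A U); rewrite (eqP fU).
  move=> h1 h2; rewrite -(leq_add2l m); apply: leq_trans hr _.
  by rewrite -h2 leq_add2r.
exists W; split; last by apply: submx_trans sW (diffmxSl _ _).
rewrite /row_free -addsmxE mxrank_disjoint_sum ?(eqP fU) ?(eqP fW) //.
apply/eqP; rewrite -submx0 -(capmx_diff A U) capmxC.
by rewrite capmxS.
Qed.

Lemma row_free1 n (x : 'rV[K]_n) : x != 0 -> row_free x.
Proof. by move=> x0; rewrite /row_free rank_rV x0. Qed.

Lemma kermx_phi_tri n (c : tensor3 K n) x y z : (y <= kermx (phi_matrix c x^T))%MS -> tri c x y z = 0.
Proof. by move/sub_kermxP; rewrite tri_phi => ->; rewrite mul0mx mxE. Qed.

Lemma tri_kermx_phi n (c : tensor3 K n) x y :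
  (forall z, tri c x y z = 0) -> (y <= kermx (phi_matrix c x^T))%MS.
Proof.
move=> h; apply/sub_kermxP/matrixP => i j; rewrite ord1 [RHS]mxE.
by have := h (delta_mx 0 j); rewrite tri_phi trmx_delta -colE mxE.
Qed.

End Extension.

(** * Two destabilizing one-parameter groups in dimension 9 *)

Section Stable.
Variables (K : closedFieldType) (c : tensor3 K 9).
Hypotheses (altc : alternating c) (oc : orbit_closed c) (sf : stabilizer_finite c).

(** Weights -2 on the span U of x, y, z and 1 on six complementary vectors: they sum to 0, and a
    triple has negative weight exactly when at least two of its members lie in U. *)
Lemma stable_notbad : notbad c.
Proof.
move=> x y z ind hxy hxz hyz.
pose F (k : 'I_3) := nth 0 [:: x; y; z] k.
have fU : row_free (\matrix_k F k).
  apply: row_free_lincomb => u; rewrite !big_ord_recl big_ord0 /F /= addr0 addrA => /ind[h0 h1 h2].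
  apply/rowP => i; rewrite [RHS]mxE; case: i => [[|[|[|//]]] lti].
  - by rewrite -[RHS]h0; congr (u _ _); apply/val_inj.
  - by rewrite -[RHS]h1; congr (u _ _); apply/val_inj.
  - by rewrite -[RHS]h2; congr (u _ _); apply/val_inj.
have [V uB] := @complete_basis K 3 6 _ fU.
set B := col_mx _ V in uB.
have rB (i : 'I_9) : (i < 3)%N -> row i B = nth 0 [:: x; y; z] i.
  move=> lti; have -> : i = lshift 6 (Ordinal lti) by apply/val_inj.
  rewrite (_ : row _ _ = row (Ordinal lti) (\matrix_k F k)); first by rewrite rowK.
  exact: (@rowKu K 3 6 9).
have FF (i j : 'I_9) w : (i < 3)%N -> (j < 3)%N -> tri c (row i B) (row j B) w = 0.
  move=> lti ltj; rewrite !rB //; case: i lti => -[|[|[|//]]] _ /= _;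
    case: j ltj => -[|[|[|//]]] _ /= _; rewrite ?triA //;
    by rewrite tri_swap12 // ?hxy ?hxz ?hyz oppr0.
apply: (@hilbert_mumford K 9 c B (fun i => if (i < 3)%N then - 2 else 1)) => //.
- by rewrite !big_ord_recl big_ord0.
- by exists ord0.
move=> i j l; case: (ltnP i 3) => hi; case: (ltnP j 3) => hj; case: (ltnP l 3) => hl h;
  first [by [] | by rewrite FF | by rewrite tri_swap23 // FF // oppr0
    | by rewrite tri_swap12 // tri_swap23 // FF // !oppr0].
Qed.

(** Weights -1 on x, 0 on seven vectors and 1 on the last. Rank at most 2 lets six of the seven be
    chosen in the kernel of Φ(x), so T(x, -, -) vanishes on any two of them; these are the triples
    of negative weight. *)
Lemma stable_rank_gt2 (x : 'rV[K]_9) : x != 0 -> (2 < \rank (phi_matrix c x^T))%N.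
Proof.
move=> x0; rewrite ltnNge; apply/negP => le2.
set Kx := kermx (phi_matrix c x^T).
have rK : (7 <= \rank Kx)%N.
  by rewrite mxrank_ker -(leq_add2r (\rank (phi_matrix c x^T))) subnK ?rank_leq_row // (@leq_trans (7 + 2)) // leq_add2l.
have [W [fW sW]] := @extend_basis K 9 1 9 6 x Kx (row_free1 x0) rK.
have [V uB] := @complete_basis K 7 2 _ fW.
set B := col_mx _ V in uB.
have rB0 (i : 'I_9) : (i < 1)%N -> row i B = x.
  move=> lti; have -> : i = lshift 2 (lshift 6 (Ordinal lti)) by apply/val_inj.
  rewrite (_ : row _ _ = row (lshift 6 (Ordinal lti)) (col_mx x W)); last exact: (@rowKu K 7 2 9).
  by rewrite rowKu row_id.
have rB1 (i : 'I_9) : (i < 7)%N -> (row i B <= Kx)%MS.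
  move=> lti; have -> : i = lshift 2 (Ordinal lti) by apply/val_inj.
  rewrite (_ : row _ _ = row (Ordinal lti) (col_mx x W)); last exact: (@rowKu K 7 2 9).
  have h : (col_mx x W <= Kx)%MS.
    by rewrite col_mx_sub sW andbT; apply: tri_kermx_phi => z; rewrite tri12.
  exact: submx_trans (row_sub _ _) h.
have x1 (i j l : 'I_9) : (i < 1)%N -> (j < 8)%N -> (l < 8)%N ->
   tri c (row i B) (row j B) (row l B) = 0.
  move=> lti ltj ltl; rewrite (rB0 i) //.
  have [lj|lj] := ltnP j 7; first by rewrite kermx_phi_tri // rB1.
  have [ll|ll] := ltnP l 7; first by rewrite tri_swap23 // kermx_phi_tri ?oppr0 // rB1.
  have -> : j = l by apply/val_inj/eqP; rewrite eqn_leq (leq_trans _ ll) ?(leq_trans _ lj).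
  by rewrite tri23.
apply: (@hilbert_mumford K 9 c B (fun i => if (i < 1)%N then - 1 else if (i < 8)%N then 0 else 1)) => //.
- by rewrite !big_ord_recl big_ord0.
- by exists ord0.
have lt8 (i j : 'I_9) : ~~ (i < 1)%N -> ~~ (j < 1)%N ->
    -1 + (if (i < 8)%N then 0 else 1) + (if (j < 8)%N then 0 else 1 : int) < 0 -> (i < 8)%N /\ (j < 8)%N.
  by case: (ltnP i 8) => hi; case: (ltnP j 8).
move=> i j l.
case hi: (i < 1)%N; case hj: (j < 1)%N; case hl: (l < 1)%N => //= h;
  rewrite ?(rB0 i hi) ?(rB0 j hj) ?(rB0 l hl) ?triA //.
- have [|||h1 h2] := lt8 j l; rewrite ?hj ?hl //.
  by rewrite -(rB0 i hi) x1.
- have [|||h1 h2] := lt8 i l; rewrite ?hi ?hl //; first by rewrite [-1 + _]addrC.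
  by rewrite -(rB0 j hj) tri_swap12 // x1 ?oppr0.
- have [|||h1 h2] := lt8 i j; rewrite ?hi ?hj //; first by rewrite -addrA addrC.
  by rewrite -(rB0 l hl) tri_swap23 // tri_swap12 // x1 ?opprK.
- by move: h; do 3!case: ifP.
Qed.

End Stable.

(** * The cubic form *)

Notation "x %:F" := (@FracField.tofrac _ x) : ring_scope.

Lemma fracP (R : idomainType) (x : {fraction R}) :
  exists p q : R, q != 0 /\ x = p%:F / q%:F.
Proof.
exists (frac (repr x)).1, (frac (repr x)).2.
have dn0 : (frac (repr x)).2 != 0 by exact: denom_ratioP.
split=> //; apply: canRL (mulfK _) _; first by rewrite tofrac_eq0.
rewrite -{1}[x]reprK; unlock FracField.tofrac; rewrite -[LHS]FracField.pi_mul.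
apply/eqmodP; rewrite /= FracField.equivfE /FracField.mulf.
by rewrite !numden_Ratio ?mulf_neq0 ?oner_neq0 // !mulr1 mulrC.
Qed.

(* The polynomial p(sX) in the new variable s. *)
Definition scaleX (k : comNzRingType) n (p : {mpoly k[n]}) : {poly {mpoly k[n]}} :=
  mmap (@polyC _ \o @mpolyC n k) (fun i => 'X_i *: 'X) p.

Lemma scaleX_mmap1 (k : comNzRingType) n (m : 'X_{1..n}) :
  mmap1 (fun i => ('X_i : {mpoly k[n]}) *: 'X) m = 'X_[m] *: 'X^(mdeg m) :> {poly {mpoly k[n]}}.
Proof.
rewrite /mmap1 mpolyXE_id mdegE -mul_polyC rmorph_prod /= -prodrXr -big_split.
by apply: eq_bigr => i _; rewrite /= -mul_polyC exprMn rmorphXn.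
Qed.

Lemma scaleX_coef (k : comNzRingType) n (p : {mpoly k[n]}) d m :
  ((scaleX p)`_d)@_m = if mdeg m == d then p@_m else 0.
Proof.
rewrite /scaleX /mmap coef_sum raddf_sum /=.
under eq_bigr => m' _ do rewrite scaleX_mmap1 coefCM coefZ coefXn mul_mpolyC mcoeffZ.
have [mp|mp] := boolP (m \in msupp p); last first.
  rewrite (memN_msupp_eq0 mp) if_same big_seq big1 // => m' m'p.
  case: (d =P _) => _; last by rewrite mulr0 mcoeff0 mulr0.
  rewrite mulr1 mcoeffX; case: eqP => [e|_]; last by rewrite mulr0.
  by rewrite -e m'p in mp.
rewrite (bigD1_seq m) ?msupp_uniq //= big1 ?addr0; last first.
  move=> m' /negbTE ne; case: (d =P _) => _; last by rewrite mulr0 mcoeff0 mulr0.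
  by rewrite mulr1 mcoeffX ne mulr0.
rewrite (eq_sym (mdeg m)); case: (d =P mdeg m) => _; last by rewrite mulr0 mcoeff0 mulr0.
by rewrite mulr1 mcoeffX eqxx mulr1.
Qed.

(** Homogeneity as an equation in a domain, where common factors can be cancelled and square roots
    compared without looking at monomials. *)
Lemma scaleX_dhomog (k : comNzRingType) n (p : {mpoly k[n]}) d :
  p \is d.-homog <-> scaleX p = p *: 'X^d.
Proof.
split=> [hp|e]; last first.
  apply/dhomogP => m; rewrite mcoeff_msupp => pm.
  have := scaleX_coef p (mdeg m) m; rewrite e eqxx coefZ coefXn.
  case: eqP => [e2 _|_]; first exact: e2.
  by rewrite mulr0 mcoeff0 => e'; rewrite -e' eqxx in pm.
apply/polyP => i; apply/mpolyP => m; rewrite scaleX_coef coefZ coefXn.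
case: eqP => [<-|ne]; case: eqP => [e|ne']; rewrite ?mulr1 ?mulr0 ?mcoeff0 //.
  by rewrite (dhomog_nemf_coeff hp) //; apply/eqP.
by rewrite (dhomog_nemf_coeff hp) // -e; apply/eqP.
Qed.

Lemma mpoly_frac_sqrt (k : fieldType) n (s : {fraction {mpoly k[n]}}) (e : {mpoly k[n]}) :
  s ^+ 2 = e%:F -> exists s0, s = s0%:F.
Proof.
have [p [q [qn0 ->]]] := fracP s => e2.
have qF : q%:F != 0 by rewrite tofrac_eq0.
have e3 : p ^+ 2 = e * q ^+ 2.
  apply/eqP; rewrite -tofrac_eq [(p ^+ 2)%:F]tofracXn [(_ * _)%:F]tofracM [(q ^+ 2)%:F]tofracXn -e2 expr_div_n.
  by rewrite divfK // expf_neq0.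
have sz : size ('X^2 - e%:P : {poly {mpoly k[n]}}) = 3 by rewrite size_XnsubC.
have [||s0 ->] := @mpoly_normal n k ('X^2 - e%:P) p q qn0.
- by rewrite monicXnsubC.
- rewrite sz !big_ord_recl big_ord0 !coefB !coefXn !coefC /= /bump /=.
  by rewrite expr0 !expr1 subn0 e3; ring.
by exists s0; rewrite rmorphM mulrC mulKf.
Qed.

Definition cmap (R S : Type) (f : R -> S) n (c : tensor3 R n) : tensor3 S n :=
  [ffun t => f (c t)].

Lemma cmap_alt (R S : nzRingType) (f : {rmorphism R -> S}) n (c : tensor3 R n) :
  alternating c -> alternating (cmap f c).
Proof.
move=> [h1 h2]; split=> [i l|i j l]; rewrite !ffunE.
  by have [-> -> ->] := h1 i l; rewrite rmorph0.
by have [-> ->] := h2 i j l; rewrite !rmorphN.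
Qed.

Lemma phi_matrix_map (R S : comNzRingType) (f : {rmorphism R -> S}) n (c : tensor3 R n) x :
  map_mx f (phi_matrix c x) = phi_matrix (cmap f c) (map_mx f x).
Proof.
apply/matrixP => j l; rewrite !mxE rmorph_sum; apply: eq_bigr => i _.
by rewrite !mxE ffunE rmorphM.
Qed.

Lemma phi_kerl (R : comNzRingType) n (c : tensor3 R n) x :
  alternating c -> x *m phi_matrix c x^T = 0.
Proof.
move=> altc; apply/matrixP => i j; rewrite ord1 [RHS]mxE.
by have := tri12 altc x (delta_mx 0 j); rewrite tri_phi trmx_delta -colE mxE.
Qed.

Lemma phi_kerr (R : comNzRingType) n (c : tensor3 R n) x :
  alternating c -> phi_matrix c x^T *m x^T = 0.
Proof.
move=> altc; apply: trmx_inj; rewrite trmx_mul trmxK trmx0.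
by have [-> _] := phi_altmx x altc; rewrite mulmxN phi_kerl // oppr0.
Qed.

Lemma phi_trmx (R : comNzRingType) n (c : tensor3 R n) x :
  alternating c -> (phi_matrix c x^T)^T = - phi_matrix c x^T.
Proof. by move=> altc; case: (phi_altmx x altc). Qed.

(** In a basis that starts with the common kernel vector the matrix has zero first row and column,
    so only one cofactor survives; multiplicativity of the adjugate brings it back. *)
Lemma adj_kernel (K : fieldType) n (A B : 'M[K]_n.+1) :
  B \in unitmx -> row 0 B *m A = 0 -> A *m (row 0 B)^T = 0 ->
  \adj A = (\det (row' 0 (col' 0 (B *m A *m B^T))) / \det B ^+ 2) *: ((row 0 B)^T *m row 0 B).
Proof.
move=> uB rA Ar; set N := B *m A *m B^T.
have N0 i : N 0 i = 0.
  have -> : N 0 i = (row 0 N) 0 i by rewrite [RHS]mxE.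
  by rewrite /N !row_mul rA mul0mx mxE.
have N0' i : N i 0 = 0.
  have -> : N i 0 = (col 0 N) i 0 by rewrite [RHS]mxE.
  by rewrite /N -!mulmxA colE -!mulmxA -colE -tr_row Ar mulmx0 mxE.
have det_row0 (M : 'M[K]_n) i : (forall j, M i j = 0) -> \det M = 0.
  by move=> M0; rewrite (expand_det_row _ i) big1 // => j _; rewrite M0 mul0r.
have det_col0 (M : 'M[K]_n) i : (forall j, M j i = 0) -> \det M = 0.
  by move=> M0; rewrite (expand_det_col _ i) big1 // => j _; rewrite M0 mul0r.
(* The position that index 0 takes once [lift 0 i] is removed: the zero row or column of [N]
   survives in those minors. *)
pose o (i : 'I_n) : 'I_n := Ordinal (leq_ltn_trans (leq0n i) (ltn_ord i)).
have l0 (i : 'I_n) : lift (lift 0 i) (o i) = 0.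
  by apply/val_inj.
have {N0 N0'} eN : \adj N = (\det (row' 0 (col' 0 N))) *: delta_mx 0 0.
  move: N N0 N0' => N N0 N0'.
  apply/matrixP => i j; rewrite !mxE /cofactor.
  case: (unliftP 0 i) => [i'|] ->; case: (unliftP 0 j) => [j'|] ->; rewrite /= ?mulr0.
  - by rewrite (det_row0 _ (o j')) ?mulr0 // => l; rewrite !mxE l0 N0.
  - by rewrite (det_col0 _ (o i')) ?mulr0 // => l; rewrite !mxE l0 N0'.
  - by rewrite (det_row0 _ (o j')) ?mulr0 // => l; rewrite !mxE l0 N0.
  - by rewrite addn0 expr0 mul1r mulr1.
have d0 : \det B != 0 by move: uB; rewrite unitmxE unitfE.
have e : B^T *m \adj N *m B = (\det B ^+ 2) *: \adj A.
  rewrite /N !adj_mulmx -trmx_adj !mulmxA -trmx_mul mul_adj_mx tr_scalar_mx.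
  by rewrite -mulmxA mul_adj_mx mul_mx_scalar mul_scalar_mx scalerA expr2.
apply: (scalerI (expf_neq0 2 d0)); rewrite -e eN scalerA mulrC divfK ?expf_neq0 //.
rewrite -scalemxAr -scalemxAl; congr (_ *: _).
rewrite [row 0 B]rowE trmx_mul trmx_delta !mulmxA; congr (_ *m B).
by rewrite -mulmxA mul_delta_mx.
Qed.

Lemma mpolyX_dvd (k : comNzRingType) n (m0 : 'X_{1..n}) (p : {mpoly k[n]}) :
  (forall m, m \in msupp p -> (m0 <= m)%MM) -> exists q, p = 'X_[m0] * q.
Proof.
move=> h; exists (\sum_(m <- msupp p) p@_m *: 'X_[m - m0]).
rewrite {1}[p]mpolyE big_distrr /= big_seq [RHS]big_seq; apply: eq_bigr => m mp.
by rewrite -scalerAr -mpolyXD addmC submK // h.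
Qed.

(** X_i^N and X_j^N are coprime: multiplying by X_j^N leaves the exponents of X_i unchanged. *)
Lemma mpolyXi_dvd (k : idomainType) n (i j : 'I_n) N (p q : {mpoly k[n]}) : i != j ->
  p * 'X_j ^+ N = 'X_i ^+ N * q -> exists r, p = 'X_i ^+ N * r.
Proof.
move=> nij e; rewrite mpolyXn; apply: mpolyX_dvd => m mp.
have : ((m + U_(j) *+ N)%MM \in msupp (p * 'X_j ^+ N)).
  by rewrite mcoeff_msupp mpolyXn addmC mcoeffMX -mcoeff_msupp.
rewrite e mpolyXn mulrC (perm_mem (msuppMX _ _)) => /mapP[m' _ e'].
apply/mnm_lepP => l; rewrite mulmnE mnm1E; case: eqP => [<-|_]; last by rewrite mul0n.
rewrite mul1n; have := congr1 (fun m : 'X_{1..n} => m i) e'.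
by rewrite /= !mnmDE !mulmnE !mnm1E eqxx eq_sym (negbTE nij) addn0 mul1n => ->; rewrite leq_addr.
Qed.

Definition ev9 (k L : fieldType) (f : {rmorphism k -> L}) (F : {mpoly k[9]}) (v : 'rV[L]_9) : L :=
  mmap f (fun i => v 0 i) F.

Lemma altmx_minor (R : nzRingType) n (N : 'M[R]_n) i : altmx N -> altmx (row' i (col' i N)).
Proof.
move=> [t d]; split=> [|j]; last by rewrite !mxE d.
apply/matrixP => j l; have := congr1 (fun M : 'M_n => M (lift i j) (lift i l)) t.
by rewrite !mxE.
Qed.

(** At the generic vector X, over the field of fractions, the adjugate is s^2 X^T X because the 8 x
    8 minor is a square. Normality makes each s X_i polynomial, and comparing two of them shows that
    s is polynomial. *)
Lemma cubic_exists (k : fieldType) (c : tensor3 k 9) : alternating c ->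
  exists F : {mpoly k[9]}, F \is 3.-homog /\
   forall (L : fieldType) (f : {rmorphism k -> L}) (v : 'rV[L]_9),
    \adj (phi_matrix (cmap f c) v^T) = ev9 f F v ^+ 2 *: (v^T *m v).
Proof.
move=> altc.
pose R := {mpoly k[9]}.
pose X : 'rV[R]_9 := \row_i 'X_i.
pose cR := cmap (@mpolyC 9 k) c.
have altR : alternating cR by exact: cmap_alt.
pose P := phi_matrix cR X^T.
have [F eF] : exists F, \adj P = F ^+ 2 *: (X^T *m X).
  pose XQ := map_mx (@FracField.tofrac R) X.
  pose PQ := map_mx (@FracField.tofrac R) P.
  have Xn0 (i : 'I_9) : ('X_i : R)%:F != 0.
    by rewrite tofrac_eq0 -msize_poly_eq0 msizeX.
  have XQn0 : XQ != 0.
    by apply/eqP => /matrixP/(_ 0 0); rewrite !mxE; apply/eqP.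
  have [V uB] := @complete_basis _ 1 8 _ (row_free1 XQn0).
  set B : 'M_(8.+1) := col_mx XQ V in uB.
  have rB : row 0 B = XQ.
    have <- : row (lshift 8 0) (col_mx XQ V) = XQ by rewrite rowKu row_id.
    by congr row; apply/val_inj.
  have kl : row 0 B *m PQ = 0 by rewrite rB -map_mxM phi_kerl // map_mx0.
  have kr : PQ *m (row 0 B)^T = 0 by rewrite rB map_trmx -map_mxM phi_kerr // map_mx0.
  have := adj_kernel uB kl kr; rewrite rB.
  have altN : altmx (row' 0 (col' 0 (B *m PQ *m B^T))).
    apply: altmx_minor; apply: altmx_congr.
    by rewrite /PQ phi_matrix_map -map_trmx; apply: phi_altmx; exact: cmap_alt.
  have [_ [d ->]] := altmx_rank_det altN.
  rewrite -expr_div_n; set s := d / _ => eadj.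
  have eij i j : (\adj P i j)%:F = s ^+ 2 * (('X_i)%:F * ('X_j)%:F).
    have := congr1 (fun M : 'M_9 => M i j) eadj.
    rewrite -map_mx_adj mxE => ->; rewrite mxE; congr (_ * _).
    by rewrite mxE big_ord1 !mxE.
  have sqi (i : 'I_9) : exists p : R, s * ('X_i)%:F = p%:F.
    by apply: (@mpoly_frac_sqrt _ _ _ (\adj P i i)); rewrite exprMn eij expr2.
  have [p0 e0] := sqi 0; have [p1 e1] := sqi 1.
  have e01 : p0 * 'X_1 = 'X_0 * p1.
    by apply/eqP; rewrite -tofrac_eq !tofracM -e0 -e1; apply/eqP; ring.
  have [F eF] := @mpolyXi_dvd _ 9 0 1 1 p0 p1 isT e01.
  have es : s = F%:F.
    by apply: (mulIf (Xn0 0)); rewrite e0 eF expr1 tofracM mulrC.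
  exists F; apply/matrixP => i j; apply/eqP; rewrite -tofrac_eq eij es.
  by rewrite mxE mxE big_ord1 !mxE -tofracXn -!tofracM.
exists F; split; last first.
  move=> L f v; pose ev := mmap f (fun i => v 0 i) : R -> L.
  have := congr1 (map_mx (ev : {rmorphism R -> L})) eF.
  rewrite map_mx_adj map_mxZ map_mxM -map_trmx /= rmorphXn /=.
  have -> : map_mx ev X = v by apply/rowP => i; rewrite !mxE /ev mmapX mmap1U.
  rewrite phi_matrix_map -map_trmx.
  have -> : map_mx ev X = v by apply/rowP => i; rewrite !mxE /ev mmapX mmap1U.
  have -> : cmap ev cR = cmap f c by apply/ffunP => t; rewrite !ffunE /ev /= mmapC.
  by [].
have scX (i : 'I_9) : scaleX ('X_i : R) = 'X_i *: 'X.
  by rewrite /scaleX mmapX mmap1U.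
pose sc := (mmap (@polyC _ \o @mpolyC 9 k) (fun i => 'X_i *: 'X) : {rmorphism R -> {poly R}}).
have scP : map_mx sc P = 'X *: map_mx (@polyC R) P.
  apply/matrixP => i j; rewrite !mxE !rmorph_sum big_distrr /=; apply: eq_bigr => l _.
  rewrite !mxE rmorphM /= !ffunE /= mmapX mmap1U mmapC /= rmorphM /=.
  by rewrite -mul_polyC; ring.
have e2 : (scaleX F) ^+ 2 = (F *: 'X^3) ^+ 2.
  have h1 : map_mx sc (\adj P) = 'X^8 *: map_mx (@polyC R) (\adj P).
    rewrite map_mx_adj scP. rewrite adjZ.
    rewrite [in RHS]map_mx_adj. done.
  have h2 : \adj P 0 0 = F ^+ 2 * ('X_0 * 'X_0).
    by rewrite eF mxE mxE big_ord1 !mxE.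
  have {h1} : sc (\adj P 0 0) = 'X^8 * (\adj P 0 0)%:P.
    by move/matrixP/(_ 0 0): h1; rewrite [LHS]mxE => ->; rewrite !mxE.
  rewrite h2 !rmorphM /= -/(scaleX F) -/(scaleX 'X_0) scX => e.
  have n0 : ('X_0 *: 'X : {poly R}) ^+ 2 != 0.
    by rewrite expf_neq0 // -size_poly_eq0 size_scale ?size_polyX // -msize_poly_eq0 msizeX.
  apply: (mulIf n0); rewrite [in LHS]expr2 [('X_0 *: 'X) ^+ 2]expr2 e.
  by rewrite -!mul_polyC; ring.
(* The adjugate has degree 8 = 2 * 3 + 2. The square root leaves a sign, and either sign kills the
   coefficients outside degree 3. *)
have pm : scaleX F = F *: 'X^3 \/ scaleX F = - (F *: 'X^3).
  by move/eqP: e2; rewrite eqf_sqr => /orP[] /eqP ->; [left|right].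
apply/dhomogP => m; rewrite mcoeff_msupp => Fm; apply/eqP; apply: contraNT Fm => ne.
have := scaleX_coef F (mdeg m) m; rewrite eqxx => <-.
case: pm => ->; rewrite ?coefN coefZ coefXn.
  by rewrite (negbTE (ne : mdeg m != 3)) mulr0 mcoeff0.
by rewrite (negbTE (ne : mdeg m != 3)) mulr0 oppr0 mcoeff0.
Qed.

Lemma tri_tensorD (R : comNzRingType) n (C D : tensor3 R n) x y z :
  tri [ffun t => C t + D t] x y z = tri C x y z + tri D x y z.
Proof.
rewrite /tri -big_split; apply: eq_bigr => i _; rewrite -big_split; apply: eq_bigr => j _.
by rewrite -big_split; apply: eq_bigr => l _; rewrite !ffunE mulrDr.
Qed.

Lemma tri_tensor1 (R : comNzRingType) n (a b d : 'I_n) (e : R) x y z :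
  tri [ffun t => e *+ (t == (a, b, d))] x y z = e * x 0 a * y 0 b * z 0 d.
Proof.
rewrite /tri (bigD1 a) //= [X in _ + X]big1 => [|i ia]; last first.
  rewrite big1 // => j _; rewrite big1 // => l _; rewrite ffunE !xpair_eqE (negbTE ia).
  by rewrite mulr0n mulr0.
rewrite addr0 (bigD1 b) //= [X in _ + X]big1 => [|j jb]; last first.
  by rewrite big1 // => l _; rewrite ffunE !xpair_eqE (negbTE jb) andbF mulr0n mulr0.
rewrite addr0 (bigD1 d) //= [X in _ + X]big1 => [|l ld]; last first.
  by rewrite ffunE !xpair_eqE (negbTE ld) !andbF mulr0n mulr0.
by rewrite addr0 ffunE eqxx mulr1n; ring.
Qed.

(** Each monomial is written with its three factors in one arbitrary order. The tensor is not
    symmetric: symmetrizing would divide by 6. *)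
Lemma cubic_tensor (k : fieldType) n (F : {mpoly k[n]}) : F \is 3.-homog ->
  exists C : tensor3 k n, forall (L : fieldType) (f : {rmorphism k -> L}) (v : 'rV[L]_n),
    mmap f (fun i => v 0 i) F = tri (cmap f C) v v v.
Proof.
move=> hF; rewrite [F]mpolyE.
have : forall m, m \in msupp F -> mdeg m = 3%N by move=> m mF; exact: (dhomog_mf hF).
elim: (msupp F) => [_|m s IH hs].
  exists [ffun=> 0] => L f v; rewrite big_nil rmorph0 /tri big1 // => i _.
  by rewrite big1 // => j _; rewrite big1 // => l _; rewrite !ffunE rmorph0 mulr0.
have [|C hC] := IH; first by move=> m' m's; apply: hs; rewrite inE m's orbT.
have ex1 (m' : 'X_{1..n}) d : mdeg m' = d.+1 -> exists i m'', m' = (U_(i) + m'')%MM /\ mdeg m'' = d.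
  move=> e; have /existsP[i mi] : [exists i, m' i != 0%N].
    apply: contraPT e => /existsPn h; rewrite mdegE big1 // => i _.
    by have := h i; rewrite negbK => /eqP.
  have le : (U_(i) <= m')%MM by rewrite lep1mP.
  exists i, (m' - U_(i))%MM; split; first by rewrite addmC submK.
  by have := congr1 mdeg (submK le); rewrite mdegD mdeg1 e addn1 => -[].
have [a [m1 [em m1d]]] := ex1 m 2%N (hs m (mem_head _ _)).
have [b [m2 [em1 m2d]]] := ex1 m1 1%N m1d.
have [d [m3 [em2 m3d]]] := ex1 m2 0%N m2d.
move/eqP: m3d; rewrite mdeg_eq0 => /eqP m30.
exists [ffun t => C t + [ffun t => F@_m *+ (t == (a, b, d))] t] => L f v.
rewrite big_cons rmorphD /= hC mmapZ mmapX {2}em em1 em2 m30 addm0.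
have mM (m5 m6 : 'X_{1..n}) : mmap1 (fun i => v 0 i) (m5 + m6)%MM = mmap1 (fun i => v 0 i) m5 * mmap1 (fun i => v 0 i) m6.
  by apply: commr_mmap1_M => i y; rewrite /GRing.comm mulrC.
rewrite !mM !mmap1U addrC.
have -> : cmap f [ffun t => C t + [ffun t => F@_m *+ (t == (a, b, d))] t] =
   [ffun t => cmap f C t + [ffun t => f F@_m *+ (t == (a, b, d))] t].
  by apply/ffunP => t; rewrite !ffunE rmorphD rmorphMn.
by rewrite tri_tensorD tri_tensor1 !mulrA.
Qed.

(** In the frame made of x and U, the determinant on U is the (0, 0) entry of the adjugate, and
    [eta] is the x-coordinate of w. The frame stays fixed while w moves, as is needed along a
    pencil. *)
Lemma adj_minor (K : fieldType) n (A : 'M[K]_(1 + n)) (w x : 'rV_(1 + n)) (U : 'M_(n, 1 + n)) s eta y :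
  \adj A = s *: (w^T *m w) -> w = eta *: x + y *m U ->
  \det (U *m A *m U^T) = s * (\det (col_mx x U) * eta) ^+ 2.
Proof.
move=> eA ew; set B := col_mx x U.
have eB : w = row_mx eta%:M y *m B by rewrite mul_row_col mul_scalar_mx.
have ewa : w *m \adj B = \det B *: row_mx eta%:M y.
  by rewrite eB -mulmxA mul_mx_adj mul_mx_scalar.
have eN : \adj (B *m A *m B^T) = s * \det B ^+ 2 *: ((row_mx eta%:M y)^T *m row_mx eta%:M y).
  rewrite !adj_mulmx eA -trmx_adj -scalemxAl -scalemxAr -scalerA; congr (_ *: _).
  rewrite !mulmxA -trmx_mul -mulmxA !ewa.
  by rewrite [(_ *: _)^T]linearZ /= -scalemxAl -scalemxAr scalerA expr2.
have e0 : (0 : 'I_(1 + n)) = lshift n 0 by apply/val_inj.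
have el (i : 'I_n) : lift (0 : 'I_(1 + n)) i = rshift 1 i by apply/val_inj.
have bN : B *m A *m B^T = block_mx (x *m A *m x^T) (x *m A *m U^T) (U *m A *m x^T) (U *m A *m U^T).
  by rewrite /B tr_col_mx mul_col_mx mul_col_row.
have := congr1 (fun M : 'M_(1 + n) => M 0 0) eN.
rewrite mxE /cofactor addn0 expr0 mul1r.
have -> : row' 0 (col' 0 (B *m A *m B^T)) = U *m A *m U^T.
  apply/matrixP => i j; rewrite bN [LHS]mxE [LHS]mxE !el.
  exact: block_mxEdr.
move=> ->; move: (row_mx _ _) (row_mxEl eta%:M y 0 (0 : 'I_1)) => r.
rewrite -e0 [eta%:M _ _]mxE eqxx mulr1n => <-.
by rewrite [LHS]mxE [(_ *m _) 0 0]mxE big_ord1 [_^T _ _]mxE; ring.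
Qed.

(** The differential of the cubic at x in the direction h, summed over the three slots because [C]
    is not symmetric. *)
Definition cub1 (R : comNzRingType) n (C : tensor3 R n) x h :=
  tri C h x x + tri C x h x + tri C x x h.

(** The full polarization of the cubic; for fixed x, the polar form of the quadratic form
    [cub1 C h x] in h. *)
Definition cub3 (R : comNzRingType) n (C : tensor3 R n) x h v :=
  tri C x h v + tri C h x v + tri C x v h + tri C h v x + tri C v x h + tri C v h x.

Section CubicExpand.
Variables (R : comNzRingType) (n : nat) (C : tensor3 R n).
Implicit Types x h v : 'rV[R]_n.

Lemma cub_expand x h t : tri C (x + t *: h) (x + t *: h) (x + t *: h) =
  tri C x x x + t * cub1 C x h + t ^+ 2 * cub1 C h x + t ^+ 3 * tri C h h h.
Proof. by rewrite /cub1 !triE; ring. Qed.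

Lemma cub1_expand x h t v : cub1 C (x + t *: h) v =
  cub1 C x v + t * cub3 C x h v + t ^+ 2 * cub1 C h v.
Proof. by rewrite /cub1 /cub3 !triE; ring. Qed.

Lemma cub1_lin x a h h' : cub1 C x (a *: h + h') = a * cub1 C x h + cub1 C x h'.
Proof. by rewrite /cub1 !triE; ring. Qed.

Lemma cub3_lin x h a v v' : cub3 C x h (a *: v + v') = a * cub3 C x h v + cub3 C x h v'.
Proof. by rewrite /cub3 !triE; ring. Qed.

Lemma cub1_quad x h v s : cub1 C (h + s *: v) x =
  cub1 C h x + s * cub3 C x h v + s ^+ 2 * cub1 C v x.
Proof. by rewrite /cub1 /cub3 !triE; ring. Qed.

Lemma cub3_swap x h v : cub3 C x h v = cub3 C h x v.
Proof. by rewrite /cub3; ring. Qed.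

End CubicExpand.

(** The sign cannot depend on the argument: the sum of a vector that excludes one sign and a vector
    that excludes the other would satisfy neither. *)
Lemma linear_sq_eq (K : idomainType) n (p q : 'rV[K]_n -> K) (k0 : K) :
  (forall a h h', p (a *: h + h') = a * p h + p h') ->
  (forall a h h', q (a *: h + h') = a * q h + q h') ->
  k0 != 0 -> (forall h, p h ^+ 2 = (k0 * q h) ^+ 2) ->
  exists k1, k1 != 0 /\ forall h, p h = k1 * q h.
Proof.
move=> hp hq k0n0 e.
have [ep|/not_all_ex_not[h1 n1]] := classic (forall h, p h = k0 * q h); first by exists k0.
have [em|/not_all_ex_not[h2 n2]] := classic (forall h, p h = - k0 * q h).
  by exists (- k0); rewrite oppr_eq0.
have pm h : p h = k0 * q h \/ p h = - k0 * q h.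
  by have /eqP := e h; rewrite eqf_sqr => /orP[] /eqP ->; [left|right; rewrite mulNr].
exfalso.
have e1 : p h1 = - k0 * q h1 by have [//|] := pm h1.
have e2 : p h2 = k0 * q h2 by have [|//] := pm h2.
have [] := pm (h1 + h2); rewrite -[h1]scale1r hp hq !mul1r mulrDr.
  by rewrite e2 => /addIr /n1.
by rewrite e1 => /addrI /n2.
Qed.

(* The kernel rows P contribute nothing, so the rank is read off the complement W. *)
Lemma rank_on_complement (K : fieldType) k m n (A : 'M[K]_n) (P : 'M_(k, n)) (W : 'M_(m, n)) :
  altmx A -> (k + m)%N = n -> row_free (col_mx P W) -> P *m A = 0 -> \rank (W *m A *m W^T) = \rank A.
Proof.
move=> [tA _] en fB PA; set B := col_mx P W in fB.
have uB : row_full B by rewrite /row_full (eqP fB) en.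
have AP : A *m P^T = 0.
  by apply: trmx_inj; rewrite trmx_mul trmxK tA mulmxN PA oppr0 trmx0.
have <- : \rank (B *m A *m B^T) = \rank A.
  rewrite -mulmxA eqmxMfull // -mxrank_tr trmx_mul trmxK eqmxMfull //.
  by rewrite mxrank_tr.
rewrite /B tr_col_mx mul_col_mx mul_col_row PA mul0mx mul0mx -[W *m A *m P^T]mulmxA AP mulmx0.
by rewrite rank_diag_block_mx mxrank0.
Qed.

(** The rank is even and is that of an 8 x 8 matrix on a complement of v, so it is at most 6 unless
    this matrix is invertible; its determinant is s times a nonzero square. *)
Lemma rank_le6 (L : fieldType) (c : tensor3 L 9) (v : 'rV[L]_9) s :
  alternating c -> v != 0 -> \adj (phi_matrix c v^T) = s *: (v^T *m v) ->
  (\rank (phi_matrix c v^T) <= 6)%N = (s == 0).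
Proof.
move=> altc v0 e; set A := phi_matrix c v^T.
have [W uB] := @complete_basis L 1 8 v (row_free1 v0).
have altA : altmx A by exact: phi_altmx.
have rA : \rank (W *m A *m W^T) = \rank A.
  apply: (@rank_on_complement _ 1 8 9 A v W altA) => //; last exact: phi_kerl.
  by rewrite row_free_unit.
have := @adj_minor L 8 A v v W s 1 0 e; rewrite scale1r mul0mx addr0 mulr1 => /(_ erefl) dW.
have d0 : \det (col_mx v W) != 0 by move: uB; rewrite unitmxE unitfE.
have [par _] := altmx_rank_det altA.
have [s0|sn0] := eqVneq s 0.
  have : \rank (W *m A *m W^T) != 8%N.
    apply: contraPneq s0 => r8.
    have : W *m A *m W^T \in unitmx by rewrite -row_free_unit /row_free r8.
    by rewrite unitmxE unitfE dW mulf_eq0 negb_or => /andP[/negP h _] s0; apply: h; rewrite s0.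
  move: (rank_leq_row (W *m A *m W^T)); rewrite rA; move: par.
  by case: (\rank A) => [|[|[|[|[|[|[|[|[|r]]]]]]]]].
have : W *m A *m W^T \in unitmx by rewrite unitmxE unitfE dW mulf_neq0 // expf_neq0.
by move/mxrank_unit; rewrite rA => ->.
Qed.

(** The determinant of Φ(x + t h) on the span of P and W is computed twice: the rows P in the kernel
    of Φ(x) make it divisible by t^k, and the adjugate formula expresses it by the square of the
    cubic. The factor [g] is linear in t because x + t h has x-coordinate 1 + t eta. *)
Lemma pencil_det (K : fieldType) k m (c C : tensor3 K (1 + (k + m))) (x h : 'rV[K]_(1 + (k + m)))
    (P : 'M_(k, 1 + (k + m))) (W : 'M_(m, 1 + (k + m))) :
  alternating c -> (forall v, \adj (phi_matrix c v^T) = (tri C v v v) ^+ 2 *: (v^T *m v)) ->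
  col_mx x (col_mx P W) \in unitmx -> P *m phi_matrix c x^T = 0 ->
  exists D g : {poly K}, [/\ D.[0] = \det (P *m phi_matrix c h^T *m P^T) * \det (W *m phi_matrix c x^T *m W^T),
    g.[0] = \det (col_mx x (col_mx P W)) &
    forall t, t ^+ k * D.[t] = tri C (x + t *: h) (x + t *: h) (x + t *: h) ^+ 2 * g.[t] ^+ 2].
Proof.
move=> altc hadj uB Px; set U := col_mx P W; set B := col_mx x U in uB *.
have eh : h = lsubmx (h *m invmx B) 0 0 *: x + rsubmx (h *m invmx B) *m U.
  rewrite -mul_scalar_mx -mx11_scalar -mul_row_col hsubmxK mulmxKV //.
set eta := lsubmx _ 0 0 in eh; set y := rsubmx _ in eh.
have xP : phi_matrix c x^T *m P^T = 0.
  by apply: trmx_inj; rewrite trmx_mul trmxK phi_trmx // mulmxN Px oppr0 trmx0.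
have [D [D0 hD]] := det_block_expand (P *m phi_matrix c h^T *m P^T) (P *m phi_matrix c h^T *m W^T)
  (W *m phi_matrix c h^T *m P^T) (W *m phi_matrix c x^T *m W^T) (W *m phi_matrix c h^T *m W^T).
exists D, ((\det B)%:P * (1 + eta *: 'X)); split=> //.
  by rewrite hornerM hornerC hornerD hornerZ hornerX -[1]/(1%:P) hornerC mulr0 addr0 mulr1.
move=> t; rewrite -hD.
have ew : x + t *: h = (1 + t * eta) *: x + (t *: y) *m U.
  by rewrite {1}eh scalerDr scalerDl scale1r -scalemxAl scalerA addrA.
have := adj_minor (hadj (x + t *: h)) ew.
have -> : phi_matrix c (x + t *: h)^T = phi_matrix c x^T + t *: phi_matrix c h^T.
  by rewrite addrC phi_matrixP addrC.
rewrite -/B; have -> : U *m (phi_matrix c x^T + t *: phi_matrix c h^T) *m U^T =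
   block_mx (t *: (P *m phi_matrix c h^T *m P^T)) (t *: (P *m phi_matrix c h^T *m W^T))
  (t *: (W *m phi_matrix c h^T *m P^T)) (W *m phi_matrix c x^T *m W^T + t *: (W *m phi_matrix c h^T *m W^T)).
  rewrite /U tr_col_mx mul_col_mx mul_col_row !mulmxDr !mulmxDl Px !mul0mx !add0r.
  by rewrite -[W *m phi_matrix c x^T *m P^T]mulmxA xP mulmx0 add0r -!scalemxAr -!scalemxAl.
move=> ->; congr (_ * _); rewrite hornerM hornerC hornerD hornerZ hornerX -[X in X.[t]]/(1%:P) hornerC.
by rewrite [eta * t]mulrC.
Qed.

Lemma complete_basis2 (K : fieldType) k m (x : 'rV[K]_(1 + (k + m))) (P : 'M_(k, 1 + (k + m))) :
  row_free (col_mx x P) -> exists W : 'M_(m, 1 + (k + m)),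
    row_free (col_mx (col_mx x P) W) /\ col_mx x (col_mx P W) \in unitmx.
Proof.
move=> fP; have [|W [fW _]] := @extend_basis K _ _ _ m (col_mx x P) 1%:M fP.
  by rewrite mxrank1.
exists W; split=> //; rewrite -row_free_unit /row_free -addsmxE.
rewrite (adds_eqmx (eqmx_refl x) (eqmx_sym (addsmxE P W))) addsmxA.
rewrite (adds_eqmx (addsmxE x P) (eqmx_refl W)) addsmxE (eqP fW).
by rewrite addnA.
Qed.

Lemma row_free_indep3 (K : fieldType) n (x y z : 'rV[K]_n) :
  indep3 x y z -> row_free (col_mx x (col_mx y z)).
Proof.
move=> ind; rewrite -kermx_eq0; apply/eqP/row_matrixP => i; rewrite row0.
set u := row i _; have : u *m col_mx x (col_mx y z) = 0 by apply/sub_kermxP; exact: row_sub.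
rewrite -[u]hsubmxK -[rsubmx u]hsubmxK !mul_row_col addrA.
rewrite [lsubmx u]mx11_scalar [lsubmx (rsubmx u)]mx11_scalar [rsubmx (rsubmx u)]mx11_scalar.
rewrite !mul_scalar_mx => /ind[-> -> ->].
by rewrite !raddf0 !row_mx0.
Qed.

Lemma mul_phi_entry (R : comNzRingType) n k m (c : tensor3 R n) h (P : 'M[R]_(k, n)) (W : 'M_(m, n)) i j :
  (P *m phi_matrix c h^T *m W^T) i j = tri c h (row i P) (row j W).
Proof.
by rewrite tri_phi -row_mul [RHS]mxE [LHS]mxE; apply: eq_bigr => l _; rewrite !mxE.
Qed.

Lemma col_mx_congr (R : comNzRingType) n k m (A : 'M[R]_n) (P : 'M_(k, n)) (W : 'M_(m, n)) :
  col_mx P W *m A *m (col_mx P W)^T =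
  block_mx (P *m A *m P^T) (P *m A *m W^T) (W *m A *m P^T) (W *m A *m W^T).
Proof. by rewrite tr_col_mx mul_col_mx mul_col_row. Qed.

Lemma row2_0 (R : nzRingType) n (y z : 'rV[R]_n) : row (0 : 'I_2) (col_mx y z) = y.
Proof.
transitivity (row (lshift 1 0) (col_mx y z)); last by rewrite rowKu row_id.
by congr row; apply/val_inj.
Qed.

Lemma row2_1 (R : nzRingType) n (y z : 'rV[R]_n) : row (1 : 'I_2) (col_mx y z) = z.
Proof.
transitivity (row (rshift 1 0) (col_mx y z)); last by rewrite rowKd row_id.
by congr row; apply/val_inj.
Qed.

Lemma det_phi2 (R : comNzRingType) n (c : tensor3 R n) h y z : alternating c ->
  \det (col_mx y z *m phi_matrix c h^T *m (col_mx y z)^T) = tri c h y z ^+ 2.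
Proof.
move=> altc.
by rewrite det_mx2 !mul_phi_entry row2_0 row2_1 !triA // tri_swap23 //; ring.
Qed.

(** * Differential and polar form of the cubic at its zeros of rank 6 and 4 *)

Section CubicForm.
Variables (K : closedFieldType) (c C : tensor3 K 9).
Hypothesis altc : alternating c.
Hypothesis hadj : forall v, \adj (phi_matrix c v^T) = (tri C v v v) ^+ 2 *: (v^T *m v).

Definition cubp (x h : 'rV[K]_9) : {poly K} :=
  (tri C x x x)%:P + (cub1 C x h) *: 'X + (cub1 C h x) *: 'X^2 + (tri C h h h) *: 'X^3.

Lemma cubpE x h t : (cubp x h).[t] = tri C (x + t *: h) (x + t *: h) (x + t *: h).
Proof.
rewrite cub_expand /cubp !hornerD !hornerZ !hornerXn hornerX hornerC; ring.
Qed.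

Lemma cubic_rank_le6 v : v != 0 -> (\rank (phi_matrix c v^T) <= 6)%N = (tri C v v v == 0).
Proof.
by move=> v0; rewrite (rank_le6 altc v0 (hadj v)) sqrf_eq0.
Qed.

(* The kernel of c(x, -, -) is spanned by x, y, z: the linear term of the pencil
   determinant computes the differential of the cubic up to sign. *)
Lemma rank6_cub1 x y z : indep3 x y z ->
  (forall w, tri c x y w = 0) -> (forall w, tri c x z w = 0) ->
  \rank (phi_matrix c x^T) = 6%N ->
  exists k1, k1 != 0 /\ forall h, cub1 C x h = k1 * tri c h y z.
Proof.
move=> ind hy hz r6.
pose P := col_mx y z.
have [W [fW uB]] := @complete_basis2 K 2 6 x P (row_free_indep3 ind).
have xn0 : x != 0.
  apply/eqP => x0; have [] := ind 1 0 0; first by rewrite x0 scaler0 !scale0r !addr0.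
  by move/eqP; rewrite oner_eq0.
have Fx0 : tri C x x x = 0 by apply/eqP; rewrite -cubic_rank_le6 // r6.
have Px : P *m phi_matrix c x^T = 0.
  by rewrite /P mul_col_mx (sub_kermxP (tri_kermx_phi hy)) (sub_kermxP (tri_kermx_phi hz)) col_mx0.
have altx := phi_altmx x altc.
have xPx : col_mx x P *m phi_matrix c x^T = 0 by rewrite mul_col_mx Px phi_kerl // col_mx0.
have rW : \rank (W *m phi_matrix c x^T *m W^T) = 6%N.
  rewrite -[RHS]r6; apply: (@rank_on_complement _ 3 6 9 _ (col_mx x P) W altx) => //.
have uA : W *m phi_matrix c x^T *m W^T \in unitmx by rewrite -row_free_unit /row_free rW.
have [_ [d dA]] := altmx_rank_det (altmx_congr W altx).
have dn0 : d != 0.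
  by apply: contraTneq uA => d0; rewrite unitmxE unitfE dA d0 expr0n eqxx.
set b := \det (col_mx x (col_mx P W)).
have bn0 : b != 0 by move: uB; rewrite unitmxE unitfE.
apply: (@linear_sq_eq K 9 _ _ (d / b)).
- by move=> a h h'; rewrite cub1_lin.
- by move=> a h h'; rewrite tri1P.
- by rewrite mulf_neq0 // invr_eq0.
move=> h; have [D [g [D0 g0 hD]]] := @pencil_det K 2 6 c C x h P W altc hadj uB Px.
(* This is F(x + t h) / t, as F(x) = 0; its square matches the factor t^2 of the pencil
   determinant. *)
pose f' := (cub1 C x h)%:P + (cub1 C h x) *: 'X + (tri C h h h) *: 'X^2.
have e : D = f' ^+ 2 * g ^+ 2.
  apply/eqP; rewrite -subr_eq0; apply/eqP.
  have X2 : 'X^2 != 0 :> {poly K} by rewrite expf_neq0 // polyX_eq0.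
  apply: (mulfI X2); rewrite mulr0; apply: poly_pointwise0 => t.
  rewrite hornerM hornerXn hornerD hornerN mulrBr hD -cubpE /cubp Fx0.
  rewrite !(hornerM, hornerXn, hornerD, hornerZ, hornerX, hornerC, horner_exp); ring.
have := congr1 (fun p => p.[0]) e.
rewrite D0 hornerM !horner_exp g0 /f' !(hornerD, hornerZ, hornerXn, hornerX, hornerC).
rewrite dA -/b expr0n /= !mulr0 !addr0 => e1.
have dP : \det (P *m phi_matrix c h^T *m P^T) = tri c h y z ^+ 2.
  exact: det_phi2.
rewrite dP in e1; rewrite exprMn expr_div_n -mulrA [X in _ * X]mulrC mulrA [d ^+ 2 * _]mulrC e1.
by rewrite mulfK // expf_neq0.
Qed.

(** The kernel has dimension 5, so t^4 divides F(x + t h)^2: the linear term vanishes, and the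
    square of the quadratic term is read off from the determinant of Φ(h) on the part P of the
    kernel. *)
Lemma rank4_cub x (P : 'M[K]_(4, 9)) : row_free (col_mx x P) ->
  P *m phi_matrix c x^T = 0 -> \rank (phi_matrix c x^T) = 4%N ->
  (forall h, cub1 C x h = 0) /\
  exists k1, k1 != 0 /\ forall h, cub1 C h x ^+ 2 = k1 ^+ 2 * \det (P *m phi_matrix c h^T *m P^T).
Proof.
move=> fP Px r4.
have [W [fW uB]] := @complete_basis2 K 4 4 x P fP.
have xn0 : x != 0.
  apply: contraTneq fP => ->; rewrite /row_free -addsmxE adds0mx.
  by rewrite neq_ltn ltnS rank_leq_row.
have Fx0 : tri C x x x = 0 by apply/eqP; rewrite -cubic_rank_le6 // r4.
have altx := phi_altmx x altc.
have xPx : col_mx x P *m phi_matrix c x^T = 0 by rewrite mul_col_mx Px phi_kerl // col_mx0.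
have rW : \rank (W *m phi_matrix c x^T *m W^T) = 4%N.
  by rewrite -[RHS]r4; apply: (@rank_on_complement _ 5 4 9 _ (col_mx x P) W altx).
have uA : W *m phi_matrix c x^T *m W^T \in unitmx by rewrite -row_free_unit /row_free rW.
have [_ [d dA]] := altmx_rank_det (altmx_congr W altx).
have dn0 : d != 0.
  by apply: contraTneq uA => d0; rewrite unitmxE unitfE dA d0 expr0n eqxx.
set b := \det (col_mx x (col_mx P W)).
have bn0 : b != 0 by move: uB; rewrite unitmxE unitfE.
have main h : cub1 C x h = 0 /\ cub1 C h x ^+ 2 = (d / b) ^+ 2 * \det (P *m phi_matrix c h^T *m P^T).
  have [D [g [D0 g0 hD]]] := @pencil_det K 4 4 c C x h P W altc hadj uB Px.
  have X2 : 'X^2 != 0 :> {poly K} by rewrite expf_neq0 // polyX_eq0.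
  pose f1 := (cub1 C x h)%:P + (cub1 C h x) *: 'X + (tri C h h h) *: 'X^2.
  have e : 'X^2 * D = f1 ^+ 2 * g ^+ 2.
    apply/eqP; rewrite -subr_eq0; apply/eqP.
    apply: (mulfI X2); rewrite mulr0; apply: poly_pointwise0 => t.
    rewrite hornerM hornerXn hornerD hornerN mulrBr hornerM hornerXn mulrA -exprD hD -cubpE /cubp Fx0.
    rewrite !(hornerM, hornerXn, hornerD, hornerZ, hornerX, hornerC, horner_exp); ring.
  have F10 : cub1 C x h = 0.
    have := congr1 (fun p => p.[0]) e.
    rewrite [LHS]hornerM hornerXn [RHS]hornerM !horner_exp g0 /f1 !(hornerD, hornerZ, hornerXn, hornerX, hornerC).
    rewrite expr0n /= mul0r !mulr0 !addr0 => /esym/eqP.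
    by rewrite mulf_eq0 !sqrf_eq0 (negbTE bn0) orbF => /eqP.
  split=> //.
  pose f2 := (cub1 C h x)%:P + (tri C h h h) *: 'X.
  have {}e : D = f2 ^+ 2 * g ^+ 2.
    apply: (mulfI X2); rewrite e /f1 /f2 F10 -!mul_polyC; ring.
  have := congr1 (fun p => p.[0]) e.
  rewrite D0 [RHS]hornerM !horner_exp g0 /f2 !(hornerD, hornerZ, hornerXn, hornerX, hornerC).
  rewrite dA -/b !mulr0 !addr0 => e1.
  by rewrite expr_div_n -mulrA [X in _ * X]mulrC mulrA [d ^+ 2 * _]mulrC e1 mulfK // expf_neq0.
split=> [h|]; first by case: (main h).
exists (d / b); split=> [|h]; first by rewrite mulf_neq0 // invr_eq0.
by case: (main h).
Qed.

(** On the span of P the form T(h, -, -) has rank 2 and radical y, z. Its Pfaffian, which is the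
    quadratic term up to a constant, vanishes at h, and its derivative there in the direction v is
    T(v, y, z) T(h, k3, k4) up to sign. *)
Lemma rank4_polar x y z k3 k4 (P := col_mx (col_mx y z) (col_mx k3 k4)) h :
  row_free (col_mx x P) -> P *m phi_matrix c x^T = 0 -> \rank (phi_matrix c x^T) = 4%N ->
  tri c h y z = 0 -> tri c h y k3 = 0 -> tri c h y k4 = 0 -> tri c h z k3 = 0 -> tri c h z k4 = 0 ->
  tri c h k3 k4 != 0 ->
  cub1 C h x = 0 /\ exists k1, k1 != 0 /\ forall v, cub3 C x h v = k1 * tri c v y z.
Proof.
move=> fP Px r4 h1 h2 h3 h4 h5 en0.
have [_ [k0 [k0n0 hk0]]] := @rank4_cub x P fP Px r4.
set e := tri c h k3 k4 in en0.
have main v : cub1 C h x = 0 /\ cub3 C x h v ^+ 2 = (k0 * e * tri c v y z) ^+ 2.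
  pose Y := col_mx y z; pose Z := col_mx k3 k4.
  have [D [D0 hD]] := det_block_expand (Y *m phi_matrix c v^T *m Y^T) (Y *m phi_matrix c v^T *m Z^T)
     (Z *m phi_matrix c v^T *m Y^T) (Z *m phi_matrix c h^T *m Z^T) (Z *m phi_matrix c v^T *m Z^T).
  rewrite !det_phi2 // in D0.
  have YhY : Y *m phi_matrix c h^T *m Y^T = 0.
    apply/matrixP => i j; rewrite mul_phi_entry [RHS]mxE.
    by elim/ord2P: i; elim/ord2P: j; rewrite ?row2_0 ?row2_1 ?triA // tri_swap23 // h1 oppr0.
  have YhZ : Y *m phi_matrix c h^T *m Z^T = 0.
    apply/matrixP => i j; rewrite mul_phi_entry [RHS]mxE.
    by elim/ord2P: i; elim/ord2P: j; rewrite ?row2_0 ?row2_1.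
  have ZhY : Z *m phi_matrix c h^T *m Y^T = 0.
    by apply: trmx_inj; rewrite !trmx_mul trmxK phi_trmx // mulNmx mulmxN mulmxA YhZ oppr0 trmx0.
  have hq s : (cub1 C h x + s * cub3 C x h v + s ^+ 2 * cub1 C v x) ^+ 2 = k0 ^+ 2 * (s ^+ 2 * D.[s]).
    rewrite -cub1_quad hk0 -hD; congr (_ * \det _).
    have -> : phi_matrix c (h + s *: v)^T = phi_matrix c h^T + s *: phi_matrix c v^T.
      by rewrite addrC phi_matrixP addrC.
    apply: (etrans (col_mx_congr _ Y Z)); rewrite !mulmxDr !mulmxDl YhY YhZ ZhY !add0r.
    by rewrite -!scalemxAr -!scalemxAl.
  have X2 : 'X^2 != 0 :> {poly K} by rewrite expf_neq0 // polyX_eq0.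
  have q0 : cub1 C h x = 0.
    have := hq 0; rewrite !expr0n /= !mul0r !addr0 mulr0 => /eqP.
    by rewrite sqrf_eq0 => /eqP.
  split=> //.
  have ee : ((cub3 C x h v)%:P + cub1 C v x *: 'X) ^+ 2 = (k0 ^+ 2)%:P * D.
    apply/eqP; rewrite -subr_eq0; apply/eqP.
    apply: (mulfI X2); rewrite mulr0; apply: poly_pointwise0 => t.
    rewrite hornerM hornerXn hornerD hornerN mulrBr [((k0 ^+ 2)%:P * D).[t]]hornerM hornerC mulrCA -hq q0.
    rewrite !(hornerM, hornerXn, hornerD, hornerZ, hornerX, hornerC, horner_exp); ring.
  have := congr1 (fun p => p.[0]) ee.
  rewrite horner_exp hornerM D0 !(hornerD, hornerZ, hornerX, hornerC) mulr0 addr0 => ->.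
  by rewrite -/e; ring.
split; first by case: (main 0).
apply: (@linear_sq_eq K 9 _ _ (k0 * e)) => [a u u'|a u u'||u].
- exact: cub3_lin.
- exact: tri1P.
- exact: mulf_neq0.
by case: (main u).
Qed.

End CubicForm.

(** * The cubic contains no hyperplane *)

Notation "''o4' k" := (@inord 3 k) (at level 8, k at level 2).
Notation "''o6' k" := (@inord 5 k) (at level 8, k at level 2).

Lemma sum4 (V : nmodType) (F : 'I_4 -> V) : \sum_i F i = F ('o4 0) + F ('o4 1) + F ('o4 2) + F ('o4 3).
Proof.
rewrite !big_ord_recl big_ord0 /= addr0 !addrA.
by congr (F _ + F _ + F _ + F _); apply/val_inj; rewrite /= inordK.
Qed.

Lemma sum6 (V : nmodType) (F : 'I_6 -> V) :
  \sum_i F i = F ('o6 0) + F ('o6 1) + F ('o6 2) + F ('o6 3) + F ('o6 4) + F ('o6 5).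
Proof.
rewrite !big_ord_recl big_ord0 /= addr0 !addrA.
by congr (F _ + F _ + F _ + F _ + F _ + F _); apply/val_inj; rewrite /= inordK.
Qed.

Lemma ord6P (P : 'I_6 -> Prop) :
  P ('o6 0) -> P ('o6 1) -> P ('o6 2) -> P ('o6 3) -> P ('o6 4) -> P ('o6 5) -> forall i, P i.
Proof.
move=> P0 P1 P2 P3 P4 P5 i; rewrite -(inord_val i).
by case: i => [[|[|[|[|[|[|]]]]]]].
Qed.

Lemma ord4P (P : 'I_4 -> Prop) :
  P ('o4 0) -> P ('o4 1) -> P ('o4 2) -> P ('o4 3) -> forall i, P i.
Proof.
by move=> P0 P1 P2 P3 i; rewrite -(inord_val i); case: i => [[|[|[|[|]]]]].
Qed.

(* Plücker coordinates in the order 01, 02, 03, 12, 13, 23. *)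
Definition row6 (R : nzRingType) (a0 a1 a2 a3 a4 a5 : R) : 'rV[R]_6 :=
  \row_k nth 0 [:: a0; a1; a2; a3; a4; a5] k.

Lemma row6E (R : nzRingType) (a0 a1 a2 a3 a4 a5 : R) (r := row6 a0 a1 a2 a3 a4 a5) :
  ((r 0 ('o6 0) = a0) * (r 0 ('o6 1) = a1) * (r 0 ('o6 2) = a2) * (r 0 ('o6 3) = a3) *
  (r 0 ('o6 4) = a4) * (r 0 ('o6 5) = a5))%type.
Proof. by rewrite /r; do !split; rewrite mxE inordK. Qed.

Section Wedge2.
Variable K : closedFieldType.
Implicit Types (u v : 'rV[K]_4) (p : 'rV[K]_6).

Definition wv u v : 'rV[K]_6 :=
  let w i j := u 0 ('o4 i) * v 0 ('o4 j) - u 0 ('o4 j) * v 0 ('o4 i) in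
  row6 (w 0%N 1%N) (w 0%N 2%N) (w 0%N 3%N) (w 1%N 2%N) (w 1%N 3%N) (w 2%N 3%N).

(** The quadratic form whose zeros are the decomposable bivectors. *)
Definition pf p : K := p 0 ('o6 0) * p 0 ('o6 5) - p 0 ('o6 1) * p 0 ('o6 4) + p 0 ('o6 2) * p 0 ('o6 3).

Definition row4 (a0 a1 a2 a3 : K) : 'rV[K]_4 := \row_k nth 0 [:: a0; a1; a2; a3] k.

Lemma row4E a0 a1 a2 a3 (r := row4 a0 a1 a2 a3) :
  ((r 0 ('o4 0) = a0) * (r 0 ('o4 1) = a1) * (r 0 ('o4 2) = a2) * (r 0 ('o4 3) = a3))%type.
Proof. by rewrite /r; do !split; rewrite mxE inordK. Qed.

(** Rows i and j of the skew matrix of [p] satisfy r_i ^ r_j = p_ij p modulo the quadric, so any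
    nonzero coordinate of [p] selects two vectors. *)
Lemma plucker p : p != 0 -> pf p = 0 -> exists u v, wv u v = p.
Proof.
move=> pn0 pf0.
have : exists k, p 0 k != 0.
  have /existsP[k hk] : [exists k, p 0 k != 0]; last by exists k.
  apply: contraNT pn0 => /existsPn h; apply/eqP/rowP => k; rewrite mxE.
  by have := h k; rewrite negbK => /eqP.
rewrite /pf in pf0.
set p0 := p 0 ('o6 0) in pf0; set p1 := p 0 ('o6 1) in pf0; set p2 := p 0 ('o6 2) in pf0.
set p3 := p 0 ('o6 3) in pf0; set p4 := p 0 ('o6 4) in pf0; set p5 := p 0 ('o6 5) in pf0.
pose r0 := row4 0 p0 p1 p2; pose r1 := row4 (- p0) 0 p3 p4.
pose r2 := row4 (- p1) (- p3) 0 p5; pose r3 := row4 (- p2) (- p4) (- p5) 0.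
have main a b e : e != 0 -> wv a b = e *: p -> exists u v, wv u v = p.
  move=> en0 h; exists (e^-1 *: a), b; apply: (scalerI en0); rewrite -h.
  by apply/rowP; elim/ord6P; rewrite [LHS]mxE !row6E !mxE; field.
have pl (x : K) : x = p0 * p5 - p1 * p4 + p2 * p3 -> x = 0 by rewrite pf0.
have pl' (x : K) : x = - (p0 * p5 - p1 * p4 + p2 * p3) -> x = 0 by rewrite pf0 oppr0.
move=> [k]; elim/ord6P: k => hk; [apply: (main r0 r1 p0 hk)|apply: (main r0 r2 p1 hk)|
  apply: (main r0 r3 p2 hk)|apply: (main r1 r2 p3 hk)|apply: (main r1 r3 p4 hk)|apply: (main r2 r3 p5 hk)];
  apply/rowP; elim/ord6P; rewrite [RHS]mxE !row6E /r0 /r1 /r2 /r3 !row4E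
    -?/p0 -?/p1 -?/p2 -?/p3 -?/p4 -?/p5;
  try ring; apply/eqP; rewrite -subr_eq0; apply/eqP;
  first [apply: pl; ring | apply: pl'; ring].
Qed.

Lemma quad_root (a b d : K) : a != 0 -> exists t, a * t ^+ 2 + b * t + d = 0.
Proof.
move=> an0; pose q := a *: 'X^2 + b *: 'X + d%:P.
have /closed_rootP[t /rootP] : size q != 1%N.
  have : size q = 3; last by move=> ->.
  have s2 : (size (b *: 'X + d%:P)%R < size (a *: 'X^2)%R)%N.
    rewrite size_scale // size_polyXn; apply: leq_ltn_trans (size_polyD _ _) _.
    rewrite gtn_max size_polyC; apply/andP; split; last by case: (d != 0).
    by apply: leq_ltn_trans (size_scale_leq _ _) _; rewrite size_polyX.
  by rewrite /q -addrA size_polyDl // size_scale // size_polyXn.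
by move=> h; exists t; rewrite -h /q !hornerD !hornerZ hornerXn hornerX hornerC.
Qed.

(** The kernel has dimension at least 2, and over an algebraically closed field every line in the
    projective space of bivectors meets the quadric [pf = 0]. *)
Lemma wedge_dec m (M : 'M[K]_(6, m)) : (\rank M <= 4)%N ->
  exists u v, wv u v != 0 /\ wv u v *m M = 0.
Proof.
move=> rM; have [|W [fW /sub_kermxP WM]] := @subbasis _ _ _ 2 (kermx M).
  by rewrite mxrank_ker leq_subRL ?(leq_trans rM) // addnC (@leq_trans (4 + 2)) // ?leq_add2r.
pose al := row 0 W; pose be := row 1 W.
have abM (s t : K) : (s *: al + t *: be) *m M = 0.
  by rewrite mulmxDl -!scalemxAl -!row_mul WM !row0 !scaler0 addr0.
have ind (s t : K) : s *: al + t *: be = 0 -> s = 0 /\ t = 0.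
  move=> e; pose r : 'rV[K]_2 := \row_i (if i == 0 then s else t).
  have r0 : r = 0.
    apply: (row_free_inj fW); rewrite mul0mx mulmx_sum_row !big_ord_recl big_ord0 addr0.
    rewrite !mxE /= -[RHS]e; congr (_ *: row _ _ + _ *: row _ _); exact/val_inj.
  by split; [have := congr1 (fun x : 'rV_2 => x 0 0) r0 | have := congr1 (fun x : 'rV_2 => x 0 1) r0];
     rewrite !mxE.
have [p [pn0 pM pf0]] : exists p, [/\ p != 0, p *m M = 0 & pf p = 0].
  have [q0|qn0] := eqVneq (pf al) 0.
    exists al; split=> //; last by rewrite -[al]addr0 -[al]scale1r -[0](scale0r be) abM.
    by apply/eqP => e; have [] := ind 1 0; [rewrite e scaler0 scale0r addr0|move/eqP; rewrite oner_eq0].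
  (* The polar form of [pf] at [al] and [be]. *)
  pose b := al 0 ('o6 0) * be 0 ('o6 5) + be 0 ('o6 0) * al 0 ('o6 5)
     - al 0 ('o6 1) * be 0 ('o6 4) - be 0 ('o6 1) * al 0 ('o6 4)
     + al 0 ('o6 2) * be 0 ('o6 3) + be 0 ('o6 2) * al 0 ('o6 3).
  have [t ht] := @quad_root (pf al) b (pf be) qn0.
  exists (t *: al + 1 *: be); split=> //.
    by apply/eqP => /ind[_ /eqP]; rewrite oner_eq0.
  by rewrite -ht /pf /b [in LHS]scale1r !mxE; ring.
by have [u [v e]] := plucker pn0 pf0; exists u, v; rewrite e.
Qed.
End Wedge2.

Section Nmx.
Variables (K : closedFieldType) (n : nat) (c : tensor3 K n).
Hypothesis altc : alternating c.

(* The linear map of wedge^2 K^4 to the dual space induced by c and the rows of P. *)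
Definition Nmx (P : 'M[K]_(4, n)) : 'M[K]_(6, n) :=
  let t i j l := tri c (row ('o4 i) P) (row ('o4 j) P) (delta_mx 0 l) in
  \matrix_(k, l) nth 0 [:: t 0%N 1%N l; t 0%N 2%N l; t 0%N 3%N l; t 1%N 2%N l; t 1%N 3%N l; t 2%N 3%N l] k.

Lemma NmxT P w (t := fun i j => tri c (row ('o4 i) P) (row ('o4 j) P) w) :
  w *m (Nmx P)^T = row6 (t 0%N 1%N) (t 0%N 2%N) (t 0%N 3%N) (t 1%N 2%N) (t 1%N 3%N) (t 2%N 3%N).
Proof.
have row_c k x y : (forall l, Nmx P k l = tri c x y (delta_mx 0 l)) ->
    (w *m (Nmx P)^T) 0 k = tri c x y w.
  move=> h; rewrite mxE [w in RHS]row_sum_delta tri3_sum; apply: eq_bigr => l _.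
  by rewrite mxE h !triE.
by apply/rowP; elim/ord6P; rewrite row6E; apply: row_c => l; rewrite mxE inordK.
Qed.

Lemma NmxE P (p : 'rV[K]_6) w (t := fun i j => tri c (row ('o4 i) P) (row ('o4 j) P) w) :
  (p *m Nmx P *m w^T) 0 0 = p 0 ('o6 0) * t 0%N 1%N + p 0 ('o6 1) * t 0%N 2%N + p 0 ('o6 2) * t 0%N 3%N
   + p 0 ('o6 3) * t 1%N 2%N + p 0 ('o6 4) * t 1%N 3%N + p 0 ('o6 5) * t 2%N 3%N.
Proof.
rewrite -mulmxA -[Nmx P]trmxK -trmx_mul NmxT mxE sum6.
by rewrite ![(_^T) _ _]mxE !row6E.
Qed.

Lemma wv_Nmx P u v w : (wv u v *m Nmx P *m w^T) 0 0 = tri c (u *m P) (v *m P) w.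
Proof.
rewrite NmxE !mulmx_sum_row !sum4 !triE !row6E !triA //.
set k0 := row ('o4 0) P; set k1 := row ('o4 1) P; set k2 := row ('o4 2) P; set k3 := row ('o4 3) P.
rewrite (tri_swap12 altc k0 k1) (tri_swap12 altc k0 k2) (tri_swap12 altc k0 k3).
rewrite (tri_swap12 altc k1 k2) (tri_swap12 altc k1 k3) (tri_swap12 altc k2 k3); ring.
Qed.

Lemma wv_Nmx0 P u v : wv u v *m Nmx P = 0 -> forall w, tri c (u *m P) (v *m P) w = 0.
Proof. by move=> e w; rewrite -wv_Nmx e mul0mx mxE. Qed.

Lemma wv_indep m (P : 'M[K]_(4, m)) (x : 'rV_m) u v :
  row_free (col_mx x P) -> wv u v != 0 -> indep3 x (u *m P) (v *m P).
Proof.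
move=> fP wn0 a b d e.
have : row_mx a%:M (b *: u + d *: v) = 0 :> 'rV_(1 + 4).
  apply: (row_free_inj fP); rewrite mul0mx mul_row_col mul_scalar_mx mulmxDl -!scalemxAl.
  by rewrite addrA.
rewrite -[0]row_mx0 => /eq_row_mx[/matrixP/(_ 0 0)]; rewrite !mxE eqxx mulr1n => -> uv.
split=> //.
  have e2 : b *: wv u v = wv (b *: u + d *: v) v.
    by apply/rowP; elim/ord6P; rewrite [LHS]mxE !row6E !mxE; ring.
  apply/eqP; have : b *: wv u v == 0.
    by rewrite e2 uv; apply/eqP/rowP; elim/ord6P; rewrite !row6E !mxE; ring.
  by rewrite scalemx_eq0 (negbTE wn0) orbF.
have e2 : d *: wv u v = wv u (b *: u + d *: v).
  by apply/rowP; elim/ord6P; rewrite [LHS]mxE !row6E !mxE; ring.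
apply/eqP; have : d *: wv u v == 0.
  by rewrite e2 uv; apply/eqP/rowP; elim/ord6P; rewrite !row6E !mxE; ring.
by rewrite scalemx_eq0 (negbTE wn0) orbF.
Qed.

(** The span of x, u P, v P would be bad: x lies in the kernel with P, and [Nmx] gives the remaining
    pair. *)
Lemma notbad_wedge P x u v : notbad c -> row_free (col_mx x P) -> P *m phi_matrix c x^T = 0 ->
  wv u v != 0 -> wv u v *m Nmx P = 0 -> False.
Proof.
move=> nb fP Px wn0 wN; apply: (nb _ _ _ (wv_indep fP wn0)).
- by move=> w; apply: kermx_phi_tri; apply/sub_kermxP; rewrite -mulmxA Px mulmx0.
- by move=> w; apply: kermx_phi_tri; apply/sub_kermxP; rewrite -mulmxA Px mulmx0.
- exact: wv_Nmx0.
Qed.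

End Nmx.

(* If the rank were 5, the kernel is spanned by a nondegenerate bivector, which forces
   c to vanish on the span of x and P; that span is then too big for the kernel. *)
Lemma tdim (K : closedFieldType) (c : tensor3 K 9) x (P : 'M[K]_(4, 9)) :
  alternating c -> notbad c ->
  row_free (col_mx x P) -> P *m phi_matrix c x^T = 0 -> \rank (Nmx c P) = 6%N.
Proof.
move=> altc nb fP Px; apply/eqP; rewrite eqn_leq rank_leq_row /= leqNgt ltnS; apply/negP => r5.
have : \rank (Nmx c P) != 5 \/ \rank (Nmx c P) = 5 by case: eqP; [right|left].
case=> [n5|e5].
  have [|u [v [wn0 wN]]] := @wedge_dec K _ (Nmx c P).
    by rewrite -ltnS ltn_neqAle n5.
  exact: (notbad_wedge altc nb fP Px wn0 wN).
have [p [pn0 pN]] : exists p : 'rV_6, p != 0 /\ p *m Nmx c P = 0.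
  have : kermx (Nmx c P) != 0 by rewrite kermx_eq0 /row_free e5.
  case/rowV0Pn => p pk pn0; exists p; split=> //; exact/sub_kermxP.
have [pf0|pfn0] := eqVneq (pf p) 0.
  have [u [v e]] := plucker pn0 pf0; rewrite -e in pn0 pN.
  exact: (notbad_wedge altc nb fP Px pn0 pN).
set k0 := row ('o4 0) P; set k1 := row ('o4 1) P; set k2 := row ('o4 2) P; set k3 := row ('o4 3) P.
have ev w : p 0 ('o6 0) * tri c k0 k1 w + p 0 ('o6 1) * tri c k0 k2 w + p 0 ('o6 2) * tri c k0 k3 w
   + p 0 ('o6 3) * tri c k1 k2 w + p 0 ('o6 4) * tri c k1 k3 w + p 0 ('o6 5) * tri c k2 k3 w = 0.
  by rewrite -NmxE pN mul0mx mxE.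
have := ev k0; have := ev k1; have := ev k2; have := ev k3; rewrite !triA // !mulr0 !addr0 !add0r.
rewrite /pf in pfn0.
set p0 := p 0 ('o6 0) in pfn0 *; set p1 := p 0 ('o6 1) in pfn0 *; set p2 := p 0 ('o6 2) in pfn0 *.
set p3 := p 0 ('o6 3) in pfn0 *; set p4 := p 0 ('o6 4) in pfn0 *; set p5 := p 0 ('o6 5) in pfn0 *.
have s1 : tri c k0 k2 k1 = - tri c k0 k1 k2 by rewrite tri_swap23.
have s2 : tri c k0 k3 k1 = - tri c k0 k1 k3 by rewrite tri_swap23.
have s3 : tri c k0 k3 k2 = - tri c k0 k2 k3 by rewrite tri_swap23.
have s4 : tri c k1 k3 k2 = - tri c k1 k2 k3 by rewrite tri_swap23.
have s5 a b : tri c a b k0 = tri c k0 a b by rewrite tri_swap23 // tri_swap12 // opprK.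
have s6 : tri c k2 k3 k1 = tri c k1 k2 k3 by rewrite tri_swap23 // tri_swap12 // opprK.
rewrite s1 s2 s3 s4 !s5 s6.
set t012 := tri c k0 k1 k2; set t013 := tri c k0 k1 k3; set t023 := tri c k0 k2 k3; set t123 := tri c k1 k2 k3.
move=> e3 e2 e1 e0.
have can t : (p0 * p5 - p1 * p4 + p2 * p3) * t = 0 -> t = 0.
  by move/eqP; rewrite mulf_eq0 (negbTE pfn0) => /eqP.
have E0 : p3 * t012 + p4 * t013 + p5 * t023 = 0 by rewrite -e0; ring.
have E1 : - p1 * t012 - p2 * t013 + p5 * t123 = 0 by rewrite -e1; ring.
have E2 : p0 * t012 - p2 * t023 - p4 * t123 = 0 by rewrite -e2; ring.
have E3 : p0 * t013 + p1 * t023 + p3 * t123 = 0 by rewrite -e3; ring.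
have z012 : t012 = 0.
  apply: can; transitivity (p5 * (p0 * t012 - p2 * t023 - p4 * t123)
    + p4 * (- p1 * t012 - p2 * t013 + p5 * t123) + p2 * (p3 * t012 + p4 * t013 + p5 * t023)).
    by ring.
  by rewrite E0 E1 E2 !mulr0 !addr0.
have z013 : t013 = 0.
  apply: can; transitivity (p5 * (p0 * t013 + p1 * t023 + p3 * t123)
    - p3 * (- p1 * t012 - p2 * t013 + p5 * t123) - p1 * (p3 * t012 + p4 * t013 + p5 * t023)).
    by ring.
  by rewrite E0 E1 E3 !mulr0 !subr0.
have z023 : t023 = 0.
  apply: can; transitivity (- p4 * (p0 * t013 + p1 * t023 + p3 * t123)
    - p3 * (p0 * t012 - p2 * t023 - p4 * t123) + p0 * (p3 * t012 + p4 * t013 + p5 * t023)).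
    by ring.
  by rewrite E0 E2 E3 !mulr0 subr0 addr0.
have z123 : t123 = 0.
  apply: can; transitivity (p2 * (p0 * t013 + p1 * t023 + p3 * t123)
    + p1 * (p0 * t012 - p2 * t023 - p4 * t123) + p0 * (- p1 * t012 - p2 * t013 + p5 * t123)).
    by ring.
  by rewrite E1 E2 E3 !mulr0 !addr0.
have xk i w : tri c x (row i P) w = 0.
  by apply: kermx_phi_tri; apply/sub_kermxP; rewrite -row_mul Px row0.
have sx i j : tri c (row i P) (row j P) x = 0.
  by rewrite tri_swap23 // tri_swap12 // xk !oppr0.
have ker : (col_mx x P <= kermx (Nmx c P)^T)%MS.
  rewrite col_mx_sub; apply/andP; split.
    by apply/sub_kermxP; rewrite NmxT !sx; apply/rowP; elim/ord6P; rewrite row6E mxE.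
  apply/row_subP => i; apply/sub_kermxP; rewrite NmxT -/k0 -/k1 -/k2 -/k3.
  elim/ord4P: i; rewrite -?/k0 -?/k1 -?/k2 -?/k3 !triA // ?s1 ?s2 ?s3 ?s4 ?s5 ?s6 -?/t012 -?/t013 -?/t023 -?/t123
    ?z012 ?z013 ?z023 ?z123 ?oppr0;
  by apply/rowP; elim/ord6P; rewrite row6E mxE.
have := mxrankS ker; rewrite mxrank_ker mxrank_tr e5 (eqP fP).
by [].
Qed.

Section PolyCoef.
Variable K : closedFieldType.

Lemma cubic_fun0 (a b d e : K) :
  (forall t, a + t * b + t ^+ 2 * d + t ^+ 3 * e = 0) -> [/\ a = 0, b = 0, d = 0 & e = 0].
Proof.
move=> h; pose q := a%:P + b *: 'X + d *: 'X^2 + e *: 'X^3.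
have q0 : q = 0.
  apply: poly_pointwise0 => t; rewrite -(h t) /q !hornerD !hornerZ !hornerXn hornerX hornerC; ring.
have co i : q`_i = 0 by rewrite q0 coef0.
have := co 0%N; have := co 1%N; have := co 2%N; have := co 3%N.
rewrite /q !coefD !coefZ !coefXn !coefX !coefC /=.
by rewrite !mulr0 !mulr1 !addr0 !add0r.
Qed.

Lemma quad_fun0 (a b d : K) :
  (forall t, a + t * b + t ^+ 2 * d = 0) -> [/\ a = 0, b = 0 & d = 0].
Proof.
move=> h; have [|-> -> -> _] := @cubic_fun0 a b d 0; last by split.
by move=> t; rewrite mulr0 addr0.
Qed.

Lemma isotropic_vec m n (A : 'M[K]_(m, n)) (q : 'rV[K]_n -> K) (b : 'rV[K]_n -> 'rV[K]_n -> K) :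
  (forall t u v, q (t *: u + v) = t ^+ 2 * q u + t * b u v + q v) -> (1 < \rank A)%N ->
  exists v, [/\ v != 0, (v <= A)%MS & q v = 0].
Proof.
move=> hq r2; have [W [fW sW]] := @subbasis _ _ _ 2 A r2.
have ind (s t : K) : s *: row 0 W + t *: row 1 W = 0 -> s = 0 /\ t = 0.
  move=> e; pose r : 'rV[K]_2 := \row_i (if i == 0 then s else t).
  have r0 : r = 0.
    apply: (row_free_inj fW); rewrite mul0mx mulmx_sum_row !big_ord_recl big_ord0 addr0.
    rewrite !mxE /= -[RHS]e; congr (_ *: row _ _ + _ *: row _ _); exact/val_inj.
  by split; [have := congr1 (fun x : 'rV_2 => x 0 0) r0 | have := congr1 (fun x : 'rV_2 => x 0 1) r0];
     rewrite !mxE.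
have sub i : (row i W <= A)%MS by apply: submx_trans sW; exact: row_sub.
have [q0|qn0] := eqVneq (q (row 0 W)) 0.
  exists (row 0 W); split=> //.
  by apply/eqP => e; have [] := ind 1 0; [rewrite e scaler0 scale0r addr0|move/eqP; rewrite oner_eq0].
have [t ht] := @quad_root K (q (row 0 W)) (b (row 0 W) (row 1 W)) (q (row 1 W)) qn0.
exists (t *: row 0 W + row 1 W); split.
- by apply/eqP => e; have [] := ind t 1; [rewrite scale1r|move=> _ /eqP; rewrite oner_eq0].
- by rewrite addmx_sub // scalemx_sub.
by rewrite hq -[RHS]ht; ring.
Qed.

End PolyCoef.

(** * Singular points of the cubic *)

Section Singular.
Variables (K : closedFieldType) (c C : tensor3 K 9).
Hypothesis altc : alternating c.
Hypothesis hadj : forall v, \adj (phi_matrix c v^T) = (tri C v v v) ^+ 2 *: (v^T *m v).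
Hypothesis nb : notbad c.
Hypothesis rk2 : forall x : 'rV[K]_9, x != 0 -> (2 < \rank (phi_matrix c x^T))%N.

Lemma kernel_basis k (x : 'rV[K]_9) : x != 0 -> (\rank (phi_matrix c x^T) + k.+1 = 9)%N ->
  exists P : 'M_(k, 9), row_free (col_mx x P) /\ P *m phi_matrix c x^T = 0.
Proof.
move=> x0 r; have [|P [fP /sub_kermxP Px]] := @extend_basis K 9 1 9 k x (kermx (phi_matrix c x^T)) (row_free1 x0).
  by rewrite mxrank_ker leq_subRL ?rank_leq_row // r.
by exists P.
Qed.

Lemma kernel_basis2 (x : 'rV[K]_9) : x != 0 -> \rank (phi_matrix c x^T) = 6%N ->
  exists y z, [/\ indep3 x y z, forall w, tri c x y w = 0 & forall w, tri c x z w = 0].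
Proof.
move=> x0 r; have [|P [fP Px]] := @kernel_basis 2 x x0; first by rewrite r.
have k0 i w : tri c x (row i P) w = 0.
  by apply: kermx_phi_tri; apply/sub_kermxP; rewrite -row_mul Px row0.
exists (row 0 P), (row 1 P); split=> // a b d e.
pose r2 : 'rV[K]_2 := \row_i (if i == 0 then b else d).
have : row_mx a%:M r2 = 0 :> 'rV_(1 + 2).
  apply: (row_free_inj fP); rewrite mul0mx mul_row_col mul_scalar_mx mulmx_sum_row.
  rewrite !big_ord_recl big_ord0 addr0 !mxE /= -[RHS]e -addrA.
  by congr (_ + (_ *: row _ _ + _ *: row _ _)); exact/val_inj.
rewrite -[0]row_mx0 => /eq_row_mx[/matrixP/(_ 0 0)]; rewrite !mxE eqxx mulr1n => -> r20.
by split=> //; [have := congr1 (fun x : 'rV_2 => x 0 0) r20 | have := congr1 (fun x : 'rV_2 => x 0 1) r20];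
     rewrite !mxE.
Qed.

Lemma cubic_zero_rank (x : 'rV[K]_9) : x != 0 -> tri C x x x = 0 ->
  \rank (phi_matrix c x^T) = 4%N \/ \rank (phi_matrix c x^T) = 6%N.
Proof.
move=> x0 Fx; have := cubic_rank_le6 altc hadj x0; rewrite Fx eqxx.
have := rk2 x0; have [] := altmx_rank_det (phi_altmx x altc).
by case: (\rank _) => [|[|[|[|[|[|[|r]]]]]]] //; [left|right].
Qed.

(** At rank 6 the differential is a nonzero multiple of T(-, y, z), and its vanishing would make the
    kernel a bad subspace. *)
Lemma sing_rank4 (x : 'rV[K]_9) : x != 0 -> tri C x x x = 0 -> (forall h, cub1 C x h = 0) ->
  \rank (phi_matrix c x^T) = 4%N.
Proof.
move=> x0 Fx dF; have [//|r6] := cubic_zero_rank x0 Fx.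
have [y [z [ind hy hz]]] := kernel_basis2 x0 r6.
have [k1 [k1n0 hk]] := rank6_cub1 altc hadj ind hy hz r6.
exfalso; apply: (nb ind hy hz) => w.
have : k1 * tri c w y z == 0 by rewrite -hk dF.
rewrite mulf_eq0 (negbTE k1n0) => /eqP e.
by rewrite tri_swap23 // tri_swap12 // opprK e.
Qed.

Lemma col_mx_rows4 (P : 'M[K]_(4, 9)) :
  col_mx (col_mx (row ('o4 0) P) (row ('o4 1) P)) (col_mx (row ('o4 2) P) (row ('o4 3) P)) = P.
Proof.
apply/row_matrixP; elim/ord4P.
- transitivity (row (lshift 2 (0 : 'I_2)) (col_mx (col_mx (row ('o4 0) P) (row ('o4 1) P)) (col_mx (row ('o4 2) P) (row ('o4 3) P)))).
    by congr row; apply/val_inj; rewrite /= inordK.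
  by rewrite rowKu row2_0.
- transitivity (row (lshift 2 (1 : 'I_2)) (col_mx (col_mx (row ('o4 0) P) (row ('o4 1) P)) (col_mx (row ('o4 2) P) (row ('o4 3) P)))).
    by congr row; apply/val_inj; rewrite /= inordK.
  by rewrite rowKu row2_1.
- transitivity (row (rshift 2 (0 : 'I_2)) (col_mx (col_mx (row ('o4 0) P) (row ('o4 1) P)) (col_mx (row ('o4 2) P) (row ('o4 3) P)))).
    by congr row; apply/val_inj; rewrite /= inordK.
  by rewrite rowKd row2_0.
- transitivity (row (rshift 2 (1 : 'I_2)) (col_mx (col_mx (row ('o4 0) P) (row ('o4 1) P)) (col_mx (row ('o4 2) P) (row ('o4 3) P)))).
    by congr row; apply/val_inj; rewrite /= inordK.
  by rewrite rowKd row2_1.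
Qed.

Lemma indep3_rows (x : 'rV[K]_9) (P : 'M[K]_(4, 9)) : row_free (col_mx x P) ->
  indep3 x (row ('o4 0) P) (row ('o4 1) P).
Proof.
move=> fP; rewrite !rowE; apply: wv_indep fP _.
apply/eqP => /(congr1 (fun r : 'rV_6 => r 0 ('o6 0))); rewrite row6E !mxE !eqxx /=.
by rewrite -!val_eqE /= !inordK //= mulr1 mulr0 subr0; apply/eqP; exact: oner_neq0.
Qed.

(** On the span of P the form T(h, -, -) is degenerate, because its Pfaffian is the quadratic term
    at h; so its rank is 0 or 2. In rank 2 the polar form of h is a nonzero multiple of T(-, y, z)
    with y, z in the radical, and its vanishing gives a bad subspace. *)
Lemma sing_tangent (x : 'rV[K]_9) (P : 'M[K]_(4, 9)) h :
  row_free (col_mx x P) -> P *m phi_matrix c x^T = 0 -> \rank (phi_matrix c x^T) = 4%N ->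
  cub1 C h x = 0 -> (forall v, cub3 C x h v = 0) -> h *m (Nmx c P)^T = 0.
Proof.
move=> fP Px r4 q0 b0.
have [_ [k0 [k0n0 hk0]]] := rank4_cub altc hadj fP Px r4.
set A := P *m phi_matrix c h^T *m P^T in hk0.
have dA : \det A = 0.
  have := hk0 h; rewrite q0 expr0n /= => /esym/eqP.
  by rewrite mulf_eq0 sqrf_eq0 (negbTE k0n0) => /eqP.
have altA : altmx A by apply: altmx_congr; exact: phi_altmx.
have TA i j : tri c h (row i P) (row j P) = A i j by rewrite mul_phi_entry.
suff A0 : A = 0.
  rewrite NmxT; apply/rowP; elim/ord6P; rewrite row6E [RHS]mxE;
  by rewrite tri_swap23 // tri_swap12 // opprK TA A0 mxE.
have rA : (\rank A <= 2)%N.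
  have [par _] := altmx_rank_det altA.
  have : \rank A != 4%N.
    apply/eqP => r; have : A \in unitmx by rewrite -row_free_unit /row_free r.
    by rewrite unitmxE unitfE dA eqxx.
  by move: par (rank_leq_row A); case: (\rank A) => [|[|[|[|[|r]]]]].
have [|Y [fY /sub_kermxP YA]] := @subbasis K _ _ 2 (kermx A).
  by rewrite mxrank_ker; apply: (@leq_trans (4 - 2)) => //; exact: leq_sub2l.
have [V uG] := @complete_basis K 2 2 Y fY.
pose G : 'M[K]_4 := col_mx Y V; have {}uG : G \in unitmx by [].
have AY : A *m Y^T = 0.
  by apply: trmx_inj; rewrite trmx_mul trmxK; case: altA => -> _; rewrite mulmxN YA oppr0 trmx0.
pose P' := G *m P.
have fP' : row_free (col_mx x P').
  rewrite /row_free -addsmxE (adds_eqmx (eqmx_refl x) (eqmxMfull P _)); last by rewrite row_full_unit.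
  by rewrite addsmxE.
have P'x : P' *m phi_matrix c x^T = 0 by rewrite /P' -mulmxA Px mulmx0.
have TA' i j : tri c h (row i P') (row j P') = (G *m A *m G^T) i j.
  by rewrite -mul_phi_entry /P' /A trmx_mul !mulmxA.
have rG0 (i : 'I_4) : (i < 2)%N -> row i G *m A = 0.
  move=> i2; have -> : row i G = row (Ordinal i2) Y.
    transitivity (row (lshift 2 (Ordinal i2)) (col_mx Y V)); last exact: rowKu.
    by congr row; apply/val_inj.
  by rewrite -row_mul YA row0.
have z1 (i j : 'I_4) : (i < 2)%N -> tri c h (row i P') (row j P') = 0.
  move=> i2; rewrite TA'; have -> : (G *m A *m G^T) i j = (row i G *m A *m G^T) 0 j.
    by rewrite -!row_mul [RHS]mxE.
  by rewrite rG0 // mul0mx mxE.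
have [e0|en0] := eqVneq (tri c h (row ('o4 2) P') (row ('o4 3) P')) 0.
  have GAG : G *m A *m G^T = 0.
    apply/matrixP => i j; rewrite -TA' [RHS]mxE.
    have [i2|i2] := ltnP i 2; first exact: z1.
    have [j2|j2] := ltnP j 2; first by rewrite tri_swap23 // z1 // oppr0.
    elim/ord4P: i i2; rewrite ?inordK // => _; elim/ord4P: j j2; rewrite ?inordK // => _; rewrite ?triA //.
    by rewrite tri_swap23 // e0 oppr0.
  have := congr1 (fun M => invmx G *m M *m invmx G^T) GAG.
  by rewrite /= !mulmxA mulVmx // mul1mx mulmxK ?unitmx_tr // mulmx0 mul0mx.
exfalso; have [|||||||||_ [k1 [k1n0 hk]]] :=
  @rank4_polar K c C altc hadj x (row ('o4 0) P') (row ('o4 1) P') (row ('o4 2) P') (row ('o4 3) P') h;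
  rewrite ?col_mx_rows4 //; try by rewrite z1 // inordK.
have xk i w : tri c x (row i P') w = 0.
  by apply: kermx_phi_tri; apply/sub_kermxP; rewrite -row_mul P'x row0.
apply: (nb (indep3_rows fP') (xk _) (xk _)) => w.
have /eqP : k1 * tri c w (row ('o4 0) P') (row ('o4 1) P') = 0 by rewrite -hk b0.
rewrite mulf_eq0 (negbTE k1n0) => /eqP e.
by rewrite tri_swap23 // tri_swap12 // opprK e.
Qed.

End Singular.

(* On a hyperplane contained in the cubic the differential is Q times its equation, so Q-isotropic
   points have rank 4; the Q-isotropic directions at such a point exceed the 3-dimensional
   tangent space of the rank 4 locus. *)
Lemma no_hyperplane (K : closedFieldType) (c C : tensor3 K 9) (l : 'cV[K]_9) :
  alternating c ->
  (forall v, \adj (phi_matrix c v^T) = (tri C v v v) ^+ 2 *: (v^T *m v)) ->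
  notbad c -> (forall x : 'rV[K]_9, x != 0 -> (2 < \rank (phi_matrix c x^T))%N) ->
  l != 0 -> exists v, v *m l = 0 /\ tri C v v v != 0.
Proof.
move=> altc hadj nb rk2 l0.
apply: NNPP => /not_ex_all_not H.
have {}H v : v *m l = 0 -> tri C v v v = 0.
  by move=> vl; have /not_and_or[//|/negP] := H v; rewrite negbK => /eqP.
have [e el] : exists e : 'rV_9, e *m l = 1%:M.
  have /existsP[i li] : [exists i, l i 0 != 0].
    apply: contraNT l0 => /existsPn h; apply/eqP/colP => i; rewrite mxE.
    by have := h i; rewrite negbK => /eqP.
  exists ((l i 0)^-1 *: delta_mx 0 i); rewrite -scalemxAl -rowE; apply/matrixP => a b.
  by rewrite !ord1 !mxE mulVf.
pose lv (v : 'rV_9) := (v *m l) 0 0.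
have tan v w : v *m l = 0 -> w *m l = 0 -> cub1 C v w = 0.
  move=> vl wl; have [|_ -> //] := @cubic_fun0 K (tri C v v v) (cub1 C v w) (cub1 C w v) (tri C w w w).
  move=> t; rewrite -cub_expand; apply: H.
  by rewrite mulmxDl -scalemxAl vl wl scaler0 addr0.
pose Q v := cub1 C v e.
have dFQ v h : v *m l = 0 -> cub1 C v h = lv h * Q v.
  move=> vl; have eh : h = lv h *: e + (h - lv h *: e) by rewrite addrC subrK.
  rewrite {1}eh cub1_lin [X in _ + X]tan ?addr0 // mulmxBl -scalemxAl el.
  by rewrite scalemx1 /lv -mx11_scalar subrr.
have rH : \rank (kermx l) = 8%N by rewrite mxrank_ker -mxrank_tr rank_rV trmx_eq0 l0.
have Qq t u v : Q (t *: u + v) = t ^+ 2 * Q u + t * cub3 C v u e + Q v.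
  by rewrite /Q addrC cub1_expand; ring.
have [|x [x0 /sub_kermxP xl Qx]] := isotropic_vec Qq (A := kermx l); first by rewrite rH.
have Fx := H _ xl.
have dFx h : cub1 C x h = 0 by rewrite dFQ // Qx mulr0.
have r4 := sing_rank4 altc hadj nb rk2 x0 Fx dFx.
have [|P [fP Px]] := @kernel_basis K c 4 x x0; first by rewrite r4.
have rN := tdim altc nb fP Px.
pose lb : 'cV[K]_9 := \col_i cub3 C x (delta_mx 0 i) e.
have lbE h : h *m lb = (cub3 C x h e)%:M.
  apply/matrixP => i j; rewrite !ord1 !mxE eqxx mulr1n.
  have lin a u v : cub3 C x (a *: u + v) e = a * cub3 C x u e + cub3 C x v e.
    by rewrite /cub3 !triE; ring.
  have lin0 : cub3 C x 0 e = 0 by rewrite /cub3 !triE; ring.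
  rewrite [h in RHS]row_sum_delta.
  rewrite (big_morph (fun u => cub3 C x u e) (id1 := 0) (op1 := +%R)) //.
    apply: eq_bigr => k _; rewrite mxE.
    by rewrite -[_ *: _]addr0 lin lin0 addr0.
  by move=> u v; rewrite -[u]scale1r lin !scale1r mul1r.
(* Two linear conditions: h stays in the hyperplane and is polar to x for Q. Modulo the
   3-dimensional T at least 4 dimensions are left, enough for an isotropic h, and then Q vanishes on
   the whole line x + t h. *)
pose L := kermx (row_mx l lb).
have rL : (7 <= \rank L)%N.
  rewrite mxrank_ker; apply: (@leq_trans (9 - 2)) => //.
  by apply: leq_sub2l; exact: rank_leq_col.
pose T := kermx (Nmx c P)^T.
have rT : \rank T = 3%N by rewrite mxrank_ker mxrank_tr rN.
have [|h [h0 sh Qh]] := isotropic_vec Qq (A := (L :\: T)%MS).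
  have := mxrank_cap_compl L T.
  have := mxrankS (capmxSr L T); rewrite rT => h1 h2.
  have : (7 <= 3 + \rank (L :\: T))%N by rewrite (leq_trans rL) // -h2 leq_add2r.
  by case: (\rank _) => [|[|r]].
have hL : (h <= L)%MS := submx_trans sh (diffmxSl _ _).
have [hl hlb] : h *m l = 0 /\ h *m lb = 0.
  have : h *m row_mx l lb = 0 by apply/sub_kermxP.
  by rewrite mul_mx_row -[0]row_mx0 => /eq_row_mx.
have b0 : cub3 C x h e = 0.
  by move/matrixP/(_ 0 0): hlb; rewrite lbE !mxE eqxx mulr1n.
have dFxh t v : cub1 C (x + t *: h) v = 0.
  rewrite dFQ; last by rewrite mulmxDl -scalemxAl xl hl scaler0 addr0.
  by rewrite addrC Qq Qx Qh b0 !mulr0 !addr0 mulr0.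
have ht : h *m (Nmx c P)^T = 0.
  apply: (sing_tangent altc hadj nb fP Px r4); first by rewrite dFQ // Qh mulr0.
  move=> v; have [|_ -> //] := @quad_fun0 K (cub1 C x v) (cub3 C x h v) (cub1 C h v).
  by move=> t; rewrite -cub1_expand dFxh.
have : (h <= (L :\: T) :&: T)%MS by rewrite sub_capmx sh; apply/sub_kermxP.
by rewrite capmx_diff submx0 (negbTE h0).
Qed.

(** * Nullstellensatz and primality for the cubic *)

Section Shift.
Variables (K : fieldType) (n : nat) (v0 : 'I_n -> K).
Let R := {mpoly K[n]}.

(* The polynomial p(X + t v0) in the variable t. *)
Definition shp (p : R) : {poly R} :=
  mmap (@polyC _ \o @mpolyC n K) (fun i => ('X_i)%:P + (v0 i)%:MP *: 'X) p.

HB.instance Definition _ := GRing.RMorphism.copy shp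
  (mmap (@polyC _ \o @mpolyC n K) (fun i => ('X_i)%:P + (v0 i)%:MP *: 'X)).

Lemma shp_eval x p t : (map_poly (meval x) (shp p)).[t] = p.@[fun i => x i + t * v0 i].
Proof.
rewrite -[LHS]/((horner_eval t \o map_poly (meval x)) (shp p)) /shp rmorph_mmap.
apply: eq_mmap => [a|i] /=; rewrite /horner_eval.
  by rewrite map_polyC hornerC /= mevalC.
rewrite rmorphD /= map_polyC /= mevalXU map_polyZ map_polyX /= mevalC.
by rewrite hornerD hornerC hornerZ hornerX mulrC.
Qed.

Lemma shp0 p : (shp p).[0] = p.
Proof.
rewrite -[RHS]mmap_id -[LHS]/(horner_eval 0 (shp p)) /shp rmorph_mmap.
apply: eq_mmap => [a|i] /=; rewrite /horner_eval ?hornerC //.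
by rewrite hornerD hornerC hornerZ hornerX mulr0 addr0.
Qed.

(** A degree bound together with the coefficient there, which may be zero: in this form it is
    multiplicative without case distinctions. *)
Definition topcoef (q : {poly R}) d l := (size q <= d.+1)%N /\ q`_d = l.

Lemma topcoefM q1 q2 d1 d2 l1 l2 :
  topcoef q1 d1 l1 -> topcoef q2 d2 l2 -> topcoef (q1 * q2) (d1 + d2) (l1 * l2).
Proof.
move=> [s1 <-] [s2 <-]; split.
  apply: leq_trans (size_polyMleq _ _) _.
  by have := leq_add s1 s2; rewrite addSn addnS; case: (_ + _)%N.
rewrite coefM (bigD1 (inord d1)) //= big1 ?addr0 => [|i ni].
  by rewrite inordK ?addKn // ltnS leq_addr.
have [lt|ge] := ltnP i d1.
  by rewrite [q2`__]nth_default ?mulr0 // (leq_trans s2) // ltn_subRL ltn_add2r.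
rewrite nth_default ?mul0r // (leq_trans s1) // ltn_neqAle ge andbT.
apply: contra ni => /eqP e; apply/eqP/val_inj; rewrite /= inordK ?ltnS ?leq_addr //.
Qed.

Lemma shp_top p d : p \is d.-homog -> topcoef (shp p) d (p.@[v0])%:MP.
Proof.
move=> hp; rewrite /shp /mmap mevalE /topcoef.
have mon m : mdeg m = d -> topcoef (mmap1 (fun i => ('X_i)%:P + (v0 i)%:MP *: 'X) m) d (\prod_i v0 i ^+ m i)%:MP.
  rewrite mdegE => <-; rewrite /mmap1 rmorph_prod /=.
  apply: (big_ind3 (fun q e l => topcoef q e l)) => [|q1 e1 l1 q2 e2 l2|i _].
  - by split; rewrite ?size_poly1 // coef1.
  - exact: topcoefM.
  elim: (m i) => [|k IH]; first by split; rewrite ?size_poly1 // coef1.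
  rewrite !exprS mpolyCM -add1n; apply: topcoefM IH; split.
    apply: leq_trans (size_polyD _ _) _; rewrite geq_max size_polyC.
    rewrite (leq_trans (size_scale_leq _ _)) ?size_polyX //.
    by case: (_ != 0).
  by rewrite coefD coefC coefZ coefX mulr1 add0r.
have sub q : {subset q <= msupp p} ->
    topcoef (\sum_(m <- q) (p@_m)%:MP%:P * mmap1 (fun i => ('X_i)%:P + (v0 i)%:MP *: 'X) m) d
      (\sum_(m <- q) p@_m * \prod_i v0 i ^+ m i)%:MP.
  elim: q => [|m q IH] hq; first by rewrite !big_nil mpolyC0; split; rewrite ?size_poly0 // coef0.
  rewrite !big_cons; have [|s2 c2] := IH; first by move=> m' m'q; apply: hq; rewrite inE m'q orbT.
  have [s1 c1] := mon m (dhomog_mf hp (hq m (mem_head _ _))).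
  rewrite mul_polyC mpolyCD mpolyCM; split; last by rewrite coefD coefZ c1 c2.
  by rewrite (leq_trans (size_polyD _ _)) // geq_max s2 (leq_trans (size_scale_leq _ _)).
by apply: sub.
Qed.

End Shift.

Lemma irredp_dvdM (F : fieldType) (p q r : {poly F}) :
  irreducible_poly p -> p %| q * r -> p %| q \/ p %| r.
Proof.
move=> irr h; have [e|e] := irredp_XsubCP irr (dvdp_gcdl p q).
  by right; rewrite -(Gauss_dvdpr _ (_ : coprimep p q)) // /coprimep size_poly_eq1.
by left; rewrite -(eqp_dvdl _ e) dvdp_gcdr.
Qed.

(** For v0 off F = 0 the polynomial F(X + t v0) has a constant leading coefficient in t. At each
    point x its d roots are roots of a(x + t v0), so it divides the d-th power even when roots
    coincide. The remainder vanishes at every x, and t = 0 gives the claim. *)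
Lemma nullstellensatz (K : closedFieldType) n d (F a : {mpoly K[n]}) :
  F \is d.-homog -> F != 0 -> (forall v, F.@[v] = 0 -> a.@[v] = 0) ->
  exists s, a ^+ d = F * s.
Proof.
move=> hF Fn0 hFa.
have [v0 Fv0] : exists v0, F.@[v0] != 0.
  apply: NNPP => /not_ex_all_not h; move/eqP: Fn0; apply; apply: meval_pointwise0 => v.
  by have /negP := h v; rewrite negbK => /eqP.
have [sf cf] := shp_top v0 hF.
pose u := (F.@[v0])^-1; have un0 : u != 0 by rewrite invr_eq0.
pose f := u%:MP *: shp v0 F.
have fd : f`_d = 1 by rewrite /f coefZ cf -mpolyCM mulVf.
have szf : size f = d.+1.
  apply/eqP; rewrite eqn_leq (leq_trans (size_scale_leq _ _)) // ltnNge.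
  by apply/negP => le; move/eqP: fd; rewrite nth_default // eq_sym oner_eq0.
have fmon : f \is monic by rewrite monicE lead_coefE szf /= fd.
have := Pdiv.RingMonic.rdivp_eq fmon (shp v0 a ^+ d).
set q := Pdiv.CommonRing.rdivp _ _; set r := Pdiv.CommonRing.rmodp _ _ => e.
have szr : (size r < d.+1)%N by rewrite -szf Pdiv.Ring.ltn_rmodpN0 // monic_neq0.
have r0 : r = 0.
  apply/polyP => i; rewrite coef0; apply: meval_pointwise0 => x.
  pose ex := map_poly (meval x).
  suff : ex r = 0 by move/(congr1 (fun q : {poly K} => q`_i)); rewrite coef_map coef0.
  have exf : size (ex f) = d.+1.
    by rewrite /ex size_map_poly_id0 ?szf // (monicP fmon) rmorph1 oner_neq0.
  have exn0 : ex f != 0 by rewrite -size_poly_eq0 exf.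
  have dv : ex f %| ex (shp v0 a ^+ d).
    rewrite [ex (_ ^+ _)]rmorphXn -/ex /=; have [rs ers] := closed_field_poly_normal (ex f).
    have szrs : size rs = d.
      have := congr1 (fun p : {poly K} => size p) ers.
      rewrite size_scale ?lead_coef_eq0 // size_prod_XsubC exf; by case.
    rewrite ers dvdpZl ?lead_coef_eq0 // -szrs.
    have : all (fun z => root (ex (shp v0 a)) z) rs.
      apply/allP => z zrs; rewrite /root /ex shp_eval; apply/eqP; apply: hFa.
      have : root (ex f) z by rewrite ers rootZ ?lead_coef_eq0 // root_prod_XsubC.
      rewrite /root /ex /f map_polyZ /= hornerZ shp_eval mulf_eq0 mevalC (negbTE un0).
      by move/eqP.
    elim: rs {ers szrs} => [|z rs IH]; first by rewrite big_nil expr0 dvdpp.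
    by move=> /= /andP[hz /IH h]; rewrite big_cons exprS dvdp_mul // dvdp_XsubCl.
  have dr : ex f %| ex r.
    move: dv; rewrite e /ex rmorphD rmorphM /= -/ex.
    by rewrite dvdp_addr // dvdp_mull.
  apply/eqP/negPn/negP => rn0; have := dvdp_leq rn0 dr; rewrite exf.
  by rewrite leqNgt (leq_ltn_trans (size_poly _ _) szr).
exists (u%:MP * q.[0]).
have := congr1 (fun p => p.[0]) e; rewrite r0 addr0 hornerM horner_exp !shp0 => ->.
by rewrite /f hornerZ shp0; ring.
Qed.

Lemma linear_part (K : closedFieldType) n (s : {mpoly K[n]}) (x : 'I_n -> K) :
  ((scaleX s)`_1).@[x] = \sum_i x i * s@_U_(i).
Proof.
have -> : (scaleX s)`_1 = \sum_i s@_U_(i) *: 'X_i.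
  apply/mpolyP => m; rewrite scaleX_coef raddf_sum /=.
  under eq_bigr => i _ do rewrite mcoeffZ mcoeffX.
  case: eqP => [/eqP/mdeg1P[j /eqP ->]|ne]; last first.
    rewrite big1 // => i _; case: eqP => [e|_]; last by rewrite mulr0.
    by case: ne; rewrite -e mdeg1.
  rewrite (bigD1 j) //= eqxx mulr1 big1 ?addr0 // => i /negbTE ne.
  by rewrite eq_mnm1 ne mulr0.
by rewrite raddf_sum; apply: eq_bigr => i _; rewrite /= mevalZ mevalXU mulrC.
Qed.

Lemma scaleX_eval (K : closedFieldType) n (s : {mpoly K[n]}) (x : 'I_n -> K) t :
  (map_poly (meval x) (scaleX s)).[t] = s.@[fun i => t * x i].
Proof.
rewrite -[LHS]/((horner_eval t \o map_poly (meval x)) (scaleX s)) /scaleX rmorph_mmap.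
apply: eq_mmap => [a|i] /=; rewrite /horner_eval.
  by rewrite map_polyC hornerC /= mevalC.
by rewrite map_polyZ map_polyX /= mevalXU hornerZ hornerX mulrC.
Qed.

Lemma frac_shuffle (L : fieldType) (a b x y : L) : x != 0 -> a * b * y = x * y * (a * (b / x)).
Proof. by move=> x0; field. Qed.

Section PrimeCubic.
Variables (K : closedFieldType) (n : nat) (F : {mpoly K[n]}) (C : tensor3 K n).
Hypothesis hF : F \is 3.-homog.
Hypothesis FC : forall v : 'rV[K]_n, F.@[fun i => v 0 i] = tri C v v v.
Hypothesis nohyp : forall l : 'cV[K]_n, l != 0 -> exists v, v *m l = 0 /\ tri C v v v != 0.

(* A rational section x |-> x + s(x) v0 of the cubic is polynomial by normality, then linear
   by homogeneity, and then the hyperplane s = 0 lies on the cubic. *)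
Lemma no_section (v0 : 'rV[K]_n) (s : {mpoly K[n]}) : tri C v0 v0 v0 != 0 ->
  ~ (forall x : 'rV[K]_n, tri C (x + s.@[fun i => x 0 i] *: v0) (x + s.@[fun i => x 0 i] *: v0)
       (x + s.@[fun i => x 0 i] *: v0) = 0).
Proof.
move=> Fv0 hs.
have lin (x : 'rV[K]_n) : s.@[fun i => x 0 i] = \sum_i x 0 i * s@_U_(i).
  pose rho := map_poly (meval (fun i => x 0 i)) (scaleX s).
  have rhoE t : rho.[t] = s.@[fun i => (t *: x) 0 i].
    by rewrite /rho scaleX_eval; apply: meval_eq => i; rewrite mxE.
  have r0 : rho.[0] = 0.
    have := hs (0 *: x); rewrite -rhoE scale0r add0r !triE => /eqP.
    by rewrite !mulf_eq0 (negbTE Fv0) !orbF !orbb => /eqP.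
  (* On the line through x the section is t rho'(t). Dividing F(t x + t rho'(t) v0) = 0 by t^3 makes
     rho' a root of a nonzero polynomial with constant coefficients, so rho' is constant. *)
  have [rho' er] : exists rho', rho = rho' * 'X.
    by have /dvdpP[q eq] : 'X %| rho; [rewrite -['X]subr0 -[0]/(0%:P) dvdp_XsubCl /root r0 | exists q].
  pose f : {poly K} := (tri C x x x)%:P + cub1 C x v0 *: 'X + cub1 C v0 x *: 'X^2 + tri C v0 v0 v0 *: 'X^3.
  have fE t : f.[t] = tri C (x + t *: v0) (x + t *: v0) (x + t *: v0).
    by rewrite cub_expand /f !hornerD !hornerZ !hornerXn hornerX hornerC; ring.
  have fn0 : f != 0.
    apply: contraNneq Fv0 => /(congr1 (fun q : {poly K} => q`_3)).
    by rewrite /f !coefD !coefZ !coefXn coefX coefC coef0 /= !mulr0 !add0r mulr1 => ->.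
  have comp0 : f \Po rho' = 0.
    have : 'X * (f \Po rho') = 0.
      apply: poly_pointwise0 => t; rewrite hornerM hornerX horner_comp.
      have [->|tn0] := eqVneq t 0; first by rewrite mul0r.
      have := hs (t *: x); rewrite -rhoE er hornerM hornerX mulrC -scalerA -scalerDr !(tri1Z, tri2Z, tri3Z) -fE.
      move=> /eqP; rewrite !mulf_eq0 (negbTE tn0) /= => /eqP.
      by move=> ->; rewrite mulr0.
    by move/eqP; rewrite mulf_eq0 polyX_eq0 => /eqP.
  have : (size rho' <= 1)%N.
    rewrite leqNgt; apply/negP => sz; move/eqP: comp0.
    by rewrite comp_poly_eq0 // (negbTE fn0).
  move/size1_polyC => er'; move: er; rewrite er'; set a := rho'`_0 => er.
  have -> : s.@[fun i => x 0 i] = a.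
    by rewrite -[x]scale1r -rhoE er hornerM hornerC hornerX mulr1.
  by rewrite -linear_part -coef_map -/rho er coefCM coefX mulr1.
pose l : 'cV[K]_n := \col_i s@_U_(i).
have sl (x : 'rV[K]_n) : s.@[fun i => x 0 i] = (x *m l) 0 0.
  by rewrite lin mxE; apply: eq_bigr => i _; rewrite mxE.
have l0 : l != 0.
  apply/eqP => l0; have := hs v0; rewrite sl l0 mulmx0 mxE scale0r addr0.
  by move/eqP; rewrite (negbTE Fv0).
have [v [vl /eqP Fv]] := nohyp l0; apply: Fv.
by have := hs v; rewrite sl vl mxE scale0r addr0.
Qed.

(** In the variable t, F(X + t v0) is a unit times a monic cubic. Over the field of fractions it is
    irreducible unless it has a root, and a root is a polynomial section by normality. Hence it is
    prime there, and division by a monic polynomial brings divisibility back to polynomials. *)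
Lemma prime_cubic (a b : {mpoly K[n]}) (l : 'cV[K]_n) : l != 0 ->
  (forall v, F.@[v] = 0 -> a.@[v] * b.@[v] = 0) ->
  (exists s, a = F * s) \/ (exists s, b = F * s).
Proof.
move=> ln0 hab.
have [v0 [_ Fv0]] := nohyp ln0.
have F0n0 : F.@[fun i => v0 0 i] != 0 by rewrite FC.
have Fn0 : F != 0 by apply: contraNneq F0n0 => ->; rewrite meval0.
have [|w ew] := @nullstellensatz K n 3 F (a * b) hF Fn0.
  by move=> v /hab; rewrite mevalM.
pose vv := fun i => v0 0 i.
have [sf cf] := shp_top vv hF.
pose u := (F.@[vv])^-1; have un0 : u != 0 by rewrite invr_eq0.
pose f := u%:MP *: shp vv F.
have fd : f`_3 = 1 by rewrite /f coefZ cf -mpolyCM mulVf.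
have szf : size f = 4.
  apply/eqP; rewrite eqn_leq (leq_trans (size_scale_leq _ _)) // ltnNge.
  by apply/negP => le; move/eqP: fd; rewrite nth_default // eq_sym oner_eq0.
have fmon : f \is monic by rewrite monicE lead_coefE szf /= fd.
pose Q := {fraction {mpoly K[n]}}.
pose toQ := map_poly (@FracField.tofrac {mpoly K[n]}).
have szQ p : size (toQ p) = size p.
  by apply: size_map_inj_poly; [move=> x y /eqP; rewrite tofrac_eq => /eqP | rewrite tofrac0].
have irr : irreducible_poly (toQ f).
  apply: cubic_irreducible; first by rewrite szQ szf.
  move=> r; apply/negP => /rootP rt.
  have [p [q [qn0 er]]] := fracP r.
  have qF : q%:F != 0 by rewrite tofrac_eq0.
  have [|s es] := @mpoly_normal n K f p q qn0 fmon.
    apply/eqP; rewrite -tofrac_eq0 rmorph_sum /=.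
    move: rt; rewrite horner_coef szQ szf => rt.
    have -> : \sum_(i < 4) (f`_i * p ^+ i * q ^+ (3 - i))%:F =
        q%:F ^+ 3 * (\sum_(i < 4) (toQ f)`_i * r ^+ i).
      rewrite big_distrr /=; apply: eq_bigr => i _.
      rewrite !tofracM !tofracXn coef_map /= er expr_div_n.
      have -> : q%:F ^+ 3 = q%:F ^+ i * q%:F ^+ (3 - i) by rewrite -exprD subnKC // -ltnS.
      by apply: frac_shuffle; rewrite expf_neq0.
    by rewrite rt mulr0.
  apply: (@no_section v0 s Fv0) => x.
  have : f.[s] = 0.
    apply/eqP; rewrite -tofrac_eq0 -horner_map /= -/toQ.
    suff -> : s%:F = r by rewrite rt.
    by rewrite er es tofracM mulrC mulKf.
  rewrite /f hornerZ => /eqP; rewrite mulf_eq0 mpolyC_eq0 (negbTE un0) /= => /eqP e.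
  have := congr1 (meval (fun i => x 0 i)) e; rewrite -horner_map /= shp_eval meval0.
  rewrite -FC => <-; apply: meval_eq => i; by rewrite !mxE.
have main (p : {mpoly K[n]}) : toQ f %| toQ (shp vv p) -> exists s, p = F * s.
  move=> dv; have := Pdiv.RingMonic.rdivp_eq fmon (shp vv p).
  set q := Pdiv.CommonRing.rdivp _ _; set r := Pdiv.CommonRing.rmodp _ _ => e.
  have szr : (size r < 4)%N by have := Pdiv.Ring.ltn_rmodpN0 (shp vv p) (monic_neq0 fmon); rewrite szf.
  have r0 : r = 0.
    have dr : toQ f %| toQ r by move: dv; rewrite e /toQ rmorphD rmorphM /= -/toQ dvdp_addr // dvdp_mull.
    apply/eqP/negPn/negP => rn0; have rQ : toQ r != 0 by rewrite -size_poly_eq0 szQ size_poly_eq0.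
    by have := dvdp_leq rQ dr; rewrite !szQ szf leqNgt szr.
  exists (u%:MP * q.[0]).
  have := congr1 (fun p => p.[0]) e; rewrite r0 addr0 hornerM !shp0 => ->.
  by rewrite /f hornerZ shp0; ring.
have : toQ f %| toQ (shp vv a) ^+ 3 * toQ (shp vv b) ^+ 3.
  rewrite -exprMn -/(toQ (shp vv a)) /toQ -rmorphM -rmorphXn /= -rmorphM -rmorphXn /= ew.
  rewrite rmorphM /= rmorphM /= dvdp_mulr // /f map_polyZ /= dvdpZl // tofrac_eq0 mpolyC_eq0.
  exact: un0.
case/(irredp_dvdM irr) => h; [left|right]; apply: main.
- move: h; rewrite !exprS expr0 mulr1.
  by case/(irredp_dvdM irr) => //; case/(irredp_dvdM irr).
- move: h; rewrite !exprS expr0 mulr1.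
  by case/(irredp_dvdM irr) => //; case/(irredp_dvdM irr).
Qed.
End PrimeCubic.

(** * The hyperdiscriminant *)

Section AltExtension.
Variables (R : comNzRingType) (n : nat).

(** A determinant of Kronecker deltas: for fixed s = (a, b, d), the alternating array of e_a ^ e_b ^
    e_d. *)
Definition sgn3 (t s : 'I_n * 'I_n * 'I_n) : R :=
  let e (a b : 'I_n) := (a == b)%:R in
  e t.1.1 s.1.1 * e t.1.2 s.1.2 * e t.2 s.2 - e t.1.1 s.1.1 * e t.1.2 s.2 * e t.2 s.1.2
  - e t.1.1 s.1.2 * e t.1.2 s.1.1 * e t.2 s.2 + e t.1.1 s.1.2 * e t.1.2 s.2 * e t.2 s.1.1
  + e t.1.1 s.2 * e t.1.2 s.1.1 * e t.2 s.1.2 - e t.1.1 s.2 * e t.1.2 s.1.2 * e t.2 s.1.1.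

(* The alternating array with prescribed independent coordinates. *)
Definition altx (v : triple n -> R) : tensor3 R n := [ffun t => \sum_s v s * sgn3 t (val s)].

Lemma altx_alt v : alternating (altx v).
Proof.
split=> [i l|i j l]; rewrite !ffunE.
  by split; rewrite big1 // => s _; rewrite /sgn3 /=; ring.
by split; rewrite -sumrN; apply: eq_bigr => s _; rewrite /sgn3 /=; ring.
Qed.

Lemma sgn3_sorted (t s : 'I_n * 'I_n * 'I_n) :
  (t.1.1 < t.1.2)%N && (t.1.2 < t.2)%N -> (s.1.1 < s.1.2)%N && (s.1.2 < s.2)%N ->
  sgn3 t s = (t == s)%:R.
Proof.
have prod3 (p q r : bool) : p%:R * q%:R * r%:R = (p && q && r)%:R :> R.
  by case: p; case: q; case: r; rewrite ?mulr1 ?mulr0 ?mul0r.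
have no (a b d x y z : 'I_n) : ~ [/\ a = x, b = y & d = z] -> (a == x) && (b == y) && (d == z) = false.
  by move=> h; apply/negP => /andP[/andP[/eqP e1 /eqP e2] /eqP e3]; apply: h.
case: t => [[a b] d]; case: s => [[a' b'] d'] /= /andP[ab bd] /andP[ab' bd'].
rewrite /sgn3 !prod3 /= !xpair_eqE; set i := (_ && _ && _).
rewrite !no; first by rewrite !subr0 !addr0.
all: by move=> [e1 e2 e3]; subst; lia.
Qed.

Lemma altx_triple v (s : triple n) : altx v (val s) = v s.
Proof.
have srt (s' : triple n) : ((val s').1.1 < (val s').1.2)%N && ((val s').1.2 < (val s').2)%N.
  by case: s'.
rewrite ffunE (bigD1 s) //= big1 ?addr0; first by rewrite sgn3_sorted ?srt // eqxx mulr1.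
by move=> s' ne; rewrite sgn3_sorted ?srt // eq_sym val_eqE (negbTE ne) mulr0.
Qed.

Lemma alternating_eq (c c' : tensor3 R n) : alternating c -> alternating c' ->
  (forall s : triple n, c (val s) = c' (val s)) -> c = c'.
Proof.
move=> [h1 h2] [h1' h2'] e; apply/ffunP => -[[i j] l].
have srt (a b d : 'I_n) : (a < b)%N -> (b < d)%N -> c (a, b, d) = c' (a, b, d).
  move=> ab bd; have h : (a < b)%N && (b < d)%N by rewrite ab.
  exact: (e (exist _ (a, b, d) h : triple n)).
have s12 a b d : c (b, a, d) = - c (a, b, d) /\ c' (b, a, d) = - c' (a, b, d).
  by have [-> _] := h2 a b d; have [-> _] := h2' a b d.
have s23 a b d : c (a, d, b) = - c (a, b, d) /\ c' (a, d, b) = - c' (a, b, d).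
  by have [_ ->] := h2 a b d; have [_ ->] := h2' a b d.
have eq12 a d : c (a, a, d) = c' (a, a, d) by have [-> _ _] := h1 a d; have [-> _ _] := h1' a d.
have eq23 a d : c (a, d, d) = c' (a, d, d) by have [_ -> _] := h1 a d; have [_ -> _] := h1' a d.
have eq13 a d : c (a, d, a) = c' (a, d, a) by have [_ _ ->] := h1 a d; have [_ _ ->] := h1' a d.
have [ij|ji|/val_inj->] := ltngtP i j; last exact: eq12.
  have [jl|lj|/val_inj->] := ltngtP j l; [exact: srt| |exact: eq23].
  have [il|li|/val_inj->] := ltngtP i l; last exact: eq13.
    by have [-> ->] := s23 i l j; rewrite srt.
  have [-> ->] := s23 i l j; have [-> ->] := s12 l i j; by rewrite srt.
have [jl|lj|/val_inj->] := ltngtP j l; last exact: eq23.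
  have [il|li|/val_inj->] := ltngtP i l; last exact: eq13.
    by have [-> ->] := s12 j i l; rewrite srt.
  have [-> ->] := s12 j i l; have [-> ->] := s23 j l i; by rewrite srt.
have [-> ->] := s12 j i l; have [-> ->] := s23 j l i; have [-> ->] := s12 l j i; by rewrite srt.
Qed.

Lemma altx_coords (c : tensor3 R n) : alternating c -> altx (fun s => c (val s)) = c.
Proof.
by move=> altc; apply: alternating_eq => // [|s]; [exact: altx_alt | exact: altx_triple].
Qed.

End AltExtension.

Section Hyperdiscriminant.
Variable f16 : {mpoly int[#|{: triple 8}|]}.
Hypothesis f16P : hyperdiscriminant f16.

Definition f16v (R : comNzRingType) (c : tensor3 R 8) : R := eval3 intr f16 c.

Lemma f16v_map (R S : comNzRingType) (f : {rmorphism R -> S}) (c : tensor3 R 8) :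
  f16v (cmap f c) = f (f16v c).
Proof.
rewrite /f16v /eval3 rmorph_mmap; apply: eq_mmap => [a|i] /=; first by rewrite rmorph_int.
by rewrite ffunE.
Qed.

Lemma eq_f16v (R : comNzRingType) (c c' : tensor3 R 8) :
  (forall s : triple 8, c (val s) = c' (val s)) -> f16v c = f16v c'.
Proof. by move=> e; apply: eq_mmap => // i; rewrite e. Qed.

Lemma f16v_scale (R : comNzRingType) a (c : tensor3 R 8) :
  f16v [ffun t => a * c t] = a ^+ 16 * f16v c.
Proof.
have [hom _ _] := f16P; rewrite /f16v /eval3 /mmap big_distrr /= big_seq [RHS]big_seq.
apply: eq_bigr => m mf; rewrite mulrCA; congr (_ * _).
have em : mdeg m = 16%N := dhomog_mf hom mf.
rewrite -em mdegE /mmap1 -prodrXr -big_split /=.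
by apply: eq_bigr => i _; rewrite ffunE exprMn.
Qed.

Lemma wedge3_scale (R : comNzRingType) n m a (g : 'M[R]_(m, n)) c :
  wedge3 (a *: g) c = [ffun t => a ^+ 3 * wedge3 g c t].
Proof.
apply/ffunP => -[[i j] l]; rewrite [RHS]ffunE !wedge3E.
have rw k : row k (a *: g) = a *: row k g by apply/rowP => x; rewrite !mxE.
by rewrite !rw !triE; ring.
Qed.

(** Write g as lam times a matrix of determinant 1, with lam^8 = det g: the scalar acts by lam^(3 *
    16) = (det g)^6. *)
Lemma f16v_algC (g : 'M[algC]_8) (c : tensor3 algC 8) : alternating c -> \det g != 0 ->
  f16v (wedge3 g c) = \det g ^+ 6 * f16v c.
Proof.
move=> altc dn0; have [_ _ inv] := f16P.
pose lam : algC := 8.-root (\det g).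
have lam8 : lam ^+ 8 = \det g by rewrite rootCK.
have lamn0 : lam != 0 by apply: contraNneq dn0 => l0; rewrite -lam8 l0 expr0n.
have eg : g = lam *: (lam^-1 *: g) by rewrite scalerA divff // scale1r.
rewrite {1}eg wedge3_scale f16v_scale -!exprM.
rewrite /f16v inv //; first by rewrite -lam8 -exprM.
  exact: Cpchar.
by rewrite detZ exprVn lam8 mulVf.
Qed.

Lemma altx_map (R S : comNzRingType) (f : {rmorphism R -> S}) (v : triple 8 -> R) :
  cmap f (altx v) = altx (fun s => f (v s)).
Proof.
apply/ffunP => t; rewrite !ffunE rmorph_sum; apply: eq_bigr => s _; rewrite rmorphM; congr (_ * _).
have pr (a b d : bool) : f (a%:R * b%:R * d%:R) = a%:R * b%:R * d%:R.
  by case: a; case: b; case: d; rewrite ?mulr1 ?mulr0 ?mul0r ?rmorph1 ?rmorph0.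
by rewrite /sgn3 rmorphB rmorphD rmorphD rmorphB rmorphB !pr.
Qed.

Lemma wedge3_map (R S : comNzRingType) (f : {rmorphism R -> S}) m n (g : 'M[R]_(m, n)) c :
  cmap f (wedge3 g c) = wedge3 (map_mx f g) (cmap f c).
Proof.
apply/ffunP => t; rewrite !ffunE rmorph_sum; apply: eq_bigr => i _; rewrite rmorph_sum.
apply: eq_bigr => j _; rewrite rmorph_sum; apply: eq_bigr => l _.
by rewrite !ffunE !mxE !rmorphM.
Qed.

(* The identity is checked on the generic matrix and the generic alternating array
   over a polynomial ring with integer coefficients, by evaluation over algC. *)
Lemma f16v_semiinv (R : comNzRingType) (g : 'M[R]_8) (c : tensor3 R 8) : alternating c ->
  f16v (wedge3 g c) = \det g ^+ 6 * f16v c.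
Proof.
move=> altc.
pose I : finType := ('I_8 * 'I_8 + triple 8)%type.
pose A : comNzRingType := {mpoly int[#|I|]}.
pose X (i : I) : A := 'X_(enum_rank i).
pose gX : 'M[A]_8 := \matrix_(i, j) X (inl (i, j)).
pose cX : tensor3 A 8 := altx (fun s => X (inr s)).
pose E : A := f16v (wedge3 gX cX) - \det gX ^+ 6 * f16v cX.
pose pt (S : comNzRingType) (h : 'M[S]_8) (v : tensor3 S 8) (i : 'I_#|I|) : S :=
  match enum_val i with inl p => h p.1 p.2 | inr s => v (val s) end.
pose ev (S : comNzRingType) (h : 'M[S]_8) (v : tensor3 S 8) : {rmorphism A -> S} :=
  mmap (intr : int -> S) (pt S h v).
have evX S h v i : ev S h v (X i) = match i with inl p => h p.1 p.2 | inr s => v (val s) end.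
  by rewrite /ev /X /= mmapX mmap1U /pt enum_rankK.
have evg S h v : map_mx (ev S h v) gX = h.
  by apply/matrixP => i j; rewrite !mxE evX.
have evc S h v : alternating v -> cmap (ev S h v) cX = v.
  move=> altv; rewrite altx_map -[RHS]altx_coords //.
  by apply/ffunP => t; rewrite !ffunE; apply: eq_bigr => s _; rewrite evX.
have evE S h v : alternating v -> ev S h v E = f16v (wedge3 h v) - \det h ^+ 6 * f16v v.
  move=> altv; have a1 := f16v_map (ev S h v) (wedge3 gX cX); have a2 := f16v_map (ev S h v) cX.
  have a3 : ev S h v (\det gX) = \det h by rewrite -det_map_mx evg.
  rewrite wedge3_map evg evc // in a1; rewrite evc // in a2.
  by rewrite a1 a2 -a3 /E; move: (f16v _) (f16v _) (\det _) => u1 u2 u3; rewrite rmorphB rmorphM rmorphXn.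
suff E0 : E = 0.
  by apply/eqP; rewrite -subr_eq0 -evE // E0 rmorph0.
have dX : \det gX != 0.
  apply/eqP => d0; have := congr1 (ev int 1%:M [ffun=> 0]) d0.
  by rewrite -det_map_mx evg det1 rmorph0 => /eqP; rewrite oner_eq0.
(* Over [algC] the identity is known for invertible matrices only; the extra factor makes it hold at
   every matrix. *)
suff : E * \det gX = 0 by move/eqP; rewrite mulf_eq0 (negbTE dX) orbF => /eqP.
have inj : injective (intr : int -> algC) by exact: intr_inj.
suff : map_mpoly (intr : int -> algC) (E * \det gX) = 0.
  move=> /mpolyP m0; apply/mpolyP => m; apply: inj.
  by rewrite -mcoeff_map_mpoly m0 !mcoeff0.
apply: meval_pointwise0 => w.
pose h : 'M[algC]_8 := \matrix_(i, j) w (enum_rank (inl (i, j) : I)).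
pose v : tensor3 algC 8 := altx (fun s => w (enum_rank (inr s : I))).
have altv : alternating v by exact: altx_alt.
have ptw : pt algC h v =1 w.
  move=> i; rewrite /pt -[in RHS](enum_valK i); case: (enum_val i) => [[a b]|s].
    by rewrite mxE.
  by rewrite /v altx_triple.
have -> : (map_mpoly (intr : int -> algC) (E * \det gX)).@[w] = ev algC h v (E * \det gX).
  rewrite /meval mmap_map_mpoly /ev /=; apply: eq_mmap => // i; by rewrite ptw.
rewrite rmorphM evE // -det_map_mx evg.
have [->|dn0] := eqVneq (\det h) 0; first by rewrite mulr0.
by rewrite f16v_algC // subrr mul0r.
Qed.

(** By primitivity: a characteristic p dividing all coefficients would be a unit in the integers,
    and in characteristic 0 all coefficients would be zero, hence divisible by 2. *)
Lemma f16v_nonzero (K : closedFieldType) : exists c : tensor3 K 8, alternating c /\ f16v c != 0.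
Proof.
have [_ prim _] := f16P.
have fn0 : map_mpoly (intr : int -> K) f16 != 0.
  apply/eqP => f0.
  have fm m : (f16@_m)%:~R = 0 :> K by rewrite -mcoeff_map_mpoly f0 mcoeff0.
  have nat0 (z : int) : z%:~R = 0 :> K -> (`|z|%N)%:R == 0 :> K.
    by case: z => k; rewrite ?NegzE ?mulrNz => /eqP; rewrite ?oppr_eq0.
  have [p pK] : exists p, p \in [pchar K].
    apply: NNPP => npK.
    have z m : f16@_m = 0.
      apply/eqP; rewrite -absz_eq0; apply/eqP/eqP; rewrite eqn0Ngt; apply/negP => gt0.
      by have [p pK] := natf0_pchar gt0 (nat0 _ (fm m)); apply: npK; exists p.
    have : (2 : int) \is a GRing.unit by apply: prim => m; rewrite z dvdz0.
    by [].
  have pp := pcharf_prime pK.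
  have : p%:Z \is a GRing.unit.
    by apply: prim => m; rewrite dvdzE /= (dvdn_pcharf pK) nat0.
  by case: p pp {pK} => [|[|p]].
have [w hw] : exists w, (map_mpoly (intr : int -> K) f16).@[w] != 0.
  apply: NNPP => /not_ex_all_not h; move/eqP: fn0; apply; apply: meval_pointwise0 => v.
  by have /negP := h v; rewrite negbK => /eqP.
exists (altx (fun s => w (enum_rank s))); split; first exact: altx_alt.
move: hw; rewrite /meval mmap_map_mpoly; congr (_ != 0); apply: eq_mmap => // i /=.
by rewrite altx_triple enum_valK.
Qed.

(* Scaling the complement of U by t turns c into t^2 c'_t with c'_t polynomial in t, while
   semi-invariance gives t^30 f16(c) = t^32 f16(c'_t). *)
Lemma f16v_bad (K : closedFieldType) (c : tensor3 K 8) (x y z : 'rV_8) : alternating c ->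
  indep3 x y z -> (forall w, tri c x y w = 0) -> (forall w, tri c x z w = 0) ->
  (forall w, tri c y z w = 0) -> f16v c = 0.
Proof.
move=> altc ind hxy hxz hyz.
pose F (k : 'I_3) := nth 0 [:: x; y; z] k.
have fU : row_free (\matrix_k F k).
  apply: row_free_lincomb => u; rewrite !big_ord_recl big_ord0 /F /= addr0 addrA => /ind[h0 h1 h2].
  apply/rowP => i; rewrite [RHS]mxE; case: i => [[|[|[|[|//]]]] lti] //.
  - by rewrite -[RHS]h0; congr (u _ _); apply/val_inj.
  - by rewrite -[RHS]h1; congr (u _ _); apply/val_inj.
  - by rewrite -[RHS]h2; congr (u _ _); apply/val_inj.
have [V uB] := @complete_basis K 3 5 _ fU.
set B := col_mx _ V in uB.
have rB (i : 'I_8) : (i < 3)%N -> row i B = nth 0 [:: x; y; z] i.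
  move=> lti; transitivity (row (lshift 5 (Ordinal lti)) B); first by congr row; apply/val_inj.
  rewrite rowKu; exact: rowK.
have FF (i j : 'I_8) w : (i < 3)%N -> (j < 3)%N -> tri c (row i B) (row j B) w = 0.
  move=> lti ltj; rewrite !rB //; case: i lti => -[|[|[|//]]] _ /= _;
    case: j ltj => -[|[|[|//]]] _ /= _; rewrite ?triA //;
    by rewrite tri_swap12 // ?hxy ?hxz ?hyz oppr0.
pose cB : tensor3 K 8 := wedge3 (B : 'M_8) c.
have altcB : alternating cB by exact: wedge3_alt.
have dB : \det (B : 'M_8) != 0 by move: uB; rewrite unitmxE unitfE.
suff fB : f16v cB = 0.
  by apply/eqP; have := fB; rewrite f16v_semiinv // => /eqP; rewrite mulf_eq0 expf_eq0 (negbTE dB).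
have cB0 (i j l : 'I_8) : (1 < (i < 3) + (j < 3) + (l < 3))%N -> cB (i, j, l) = 0.
  move=> h; rewrite wedge3E; move: h; case hi: (i < 3)%N; case hj: (j < 3)%N; case hl: (l < 3)%N => // _.
  - by rewrite FF.
  - by rewrite FF.
  - by rewrite tri_swap23 // FF // oppr0.
  - by rewrite tri_swap12 // tri_swap23 // FF // !oppr0.
pose P : tensor3 {poly K} 8 := [ffun t => (cB t)%:P *
  (if ((t.1.1 < 3) || (t.1.2 < 3) || (t.2 < 3))%N then 1 else 'X)].
pose q := f16v P.
pose D (t : K) : 'M[K]_8 := diag_mx (\row_i (if (i < 3)%N then 1 else t)).
have detD t : \det (D t) = t ^+ 5.
  by rewrite det_diag !big_ord_recl big_ord0 !mxE /=; ring.
have key t : t ^+ 30 * f16v cB = t ^+ 32 * q.[t].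
  have -> : t ^+ 30 = \det (D t) ^+ 6 by rewrite detD -exprM.
  rewrite -f16v_semiinv // (_ : t ^+ 32 = (t ^+ 2) ^+ 16); last by rewrite -exprM.
  rewrite -[q.[t]]/(horner_eval t q) /q -f16v_map -f16v_scale.
  apply: eq_f16v => s; case: (val s) => [[i j] l]; rewrite wedge3E [RHS]ffunE [cmap _ _ _]ffunE [P _]ffunE /=.
  have rD k : row k (D t) = (if (k < 3)%N then 1 else t) *: delta_mx 0 k.
    by rewrite /D row_diag_mx !mxE.
  rewrite !rD !triE tri_delta /horner_eval hornerM hornerC.
  have := cB0 i j l; move: (cB (i, j, l)) => b.
  case: (i < 3)%N; case: (j < 3)%N; case: (l < 3)%N => /= b0;
    try (have -> : b = 0 by exact: b0); rewrite -?[1 : {poly K}]/(1%:P) ?hornerC ?hornerX; ring.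
have : 'X^30 * ((f16v cB)%:P - 'X^2 * q) = 0.
  apply: poly_pointwise0 => t; rewrite hornerM hornerXn hornerD hornerN hornerC hornerM hornerXn.
  by rewrite mulrBr key mulrA -exprD subrr.
move/eqP; rewrite mulf_eq0 expf_eq0 polyX_eq0 /= => /eqP/(congr1 (fun p : {poly K} => p.[0])).
by rewrite hornerD hornerN hornerC hornerM hornerXn horner0 expr0n mul0r subr0.
Qed.

End Hyperdiscriminant.

(** * Normal form in dimension 8 *)

Section Rows4.
Variables (K : fieldType) (n : nat).
Implicit Types x y z : 'rV[K]_n.

Definition rows4 x0 x1 x2 x3 : 'M[K]_(4, n) := \matrix_k nth 0 [:: x0; x1; x2; x3] k.

Lemma rows4E x0 x1 x2 x3 (M := rows4 x0 x1 x2 x3) :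
  ((row ('o4 0) M = x0) * (row ('o4 1) M = x1) * (row ('o4 2) M = x2) * (row ('o4 3) M = x3))%type.
Proof. by do !split; rewrite rowK inordK. Qed.

Lemma mul_rows4 (u : 'rV_4) x0 x1 x2 x3 : u *m rows4 x0 x1 x2 x3 =
  u 0 ('o4 0) *: x0 + u 0 ('o4 1) *: x1 + u 0 ('o4 2) *: x2 + u 0 ('o4 3) *: x3.
Proof. by rewrite mulmx_sum_row sum4 !rows4E. Qed.

Lemma rv4_eq0 (u : 'rV[K]_4) :
  u 0 ('o4 0) = 0 -> u 0 ('o4 1) = 0 -> u 0 ('o4 2) = 0 -> u 0 ('o4 3) = 0 -> u = 0.
Proof. by move=> *; apply/rowP; elim/ord4P; rewrite [RHS]mxE. Qed.

End Rows4.

Section Isotropic.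
Variables (K : closedFieldType) (n : nat) (c : tensor3 K n).
Hypothesis altc : alternating c.
Variables (s : 'rV[K]_n) (e : nat -> 'rV[K]_n) (xi : nat -> K).

(** Vanishing of the 4-form xi ^ T on (e_i, e_j, e_k, e_l). *)
Definition wedge4 i j k l : Prop := xi i * tri c (e j) (e k) (e l) - xi j * tri c (e i) (e k) (e l)
  + xi k * tri c (e i) (e j) (e l) - xi l * tri c (e i) (e j) (e k) = 0.

Lemma wedge4_swap12 i j k l : wedge4 i j k l -> wedge4 j i k l.
Proof.
rewrite /wedge4 (tri_swap12 altc (e i) (e j) (e l)) (tri_swap12 altc (e i) (e j) (e k)) => h.
by rewrite -[RHS]oppr0 -h; ring.
Qed.

Lemma wedge4_swap23 i j k l : wedge4 i j k l -> wedge4 i k j l.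
Proof.
rewrite /wedge4 (tri_swap12 altc (e j) (e k) (e l)) (tri_swap23 altc (e i) (e j) (e k)) => h.
by rewrite -[RHS]oppr0 -h; ring.
Qed.

Lemma wedge4_swap34 i j k l : wedge4 i j k l -> wedge4 i j l k.
Proof.
rewrite /wedge4 (tri_swap23 altc (e j) (e k) (e l)) (tri_swap23 altc (e i) (e k) (e l)) => h.
by rewrite -[RHS]oppr0 -h; ring.
Qed.

(** From xi ^ T = 0 and xi(e_i0) != 0, T vanishes on the four vectors [a i], which lie in the kernel
    of xi. The functionals that their bivectors define vanish on their span, so these have rank at
    most n - 4 <= 4, and a decomposable bivector giving the zero functional spans a bad subspace
    with s. *)
Lemma wedge4_bad i0 i1 i2 i3 i4 : (n <= 8)%N -> notbad c -> xi i0 != 0 ->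
  (forall a b0 b1 b2 b3 b4, a *: s + b0 *: e i0 + b1 *: e i1 + b2 *: e i2 + b3 *: e i3 + b4 *: e i4 = 0 ->
    [/\ a = 0, b0 = 0, b1 = 0, b2 = 0 & b3 = 0] /\ b4 = 0) ->
  (forall i w, tri c s (e i) w = 0) ->
  wedge4 i0 i1 i2 i3 -> wedge4 i0 i1 i2 i4 -> wedge4 i0 i1 i3 i4 -> wedge4 i0 i2 i3 i4 -> False.
Proof.
move=> n8 nb x0 ind se w123 w124 w134 w234.
pose a i := e i - (xi i / xi i0) *: e i0.
pose P := rows4 (a i1) (a i2) (a i3) (a i4).
have fP : row_free (col_mx s P).
  rewrite -kermx_eq0; apply/eqP/row_matrixP => i; rewrite row0.
  set u := row i _; have : u *m col_mx s P = 0 by apply/sub_kermxP; exact: row_sub.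
  rewrite -[u]hsubmxK; move: (lsubmx u) (rsubmx u) => a0 b; rewrite mul_row_col.
  rewrite [a0]mx11_scalar mul_scalar_mx mul_rows4 /a; move: (a0 0 0) => {}a0.
  move: (b 0 ('o4 0)) (b 0 ('o4 1)) (b 0 ('o4 2)) (b 0 ('o4 3)) (@rv4_eq0 K b) => b1 b2 b3 b4 bE h.
  have : a0 *: s + (- (b1 * (xi i1 / xi i0) + b2 * (xi i2 / xi i0) + b3 * (xi i3 / xi i0)
     + b4 * (xi i4 / xi i0))) *: e i0 + b1 *: e i1 + b2 *: e i2 + b3 *: e i3 + b4 *: e i4 = 0.
    rewrite -[RHS]h; apply/rowP => l; rewrite !mxE; ring.
  by move=> /ind[[-> _ b10 b20 b30] b40]; rewrite bE // raddf0 row_mx0.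
have ijk i j k : wedge4 i0 i j k -> tri c (a i) (a j) (a k) = 0.
  rewrite /wedge4 /a => h; rewrite !triE !triA //.
  rewrite (tri_swap12 altc (e i0) (e i)) (tri_swap23 altc (e i) (e i0)) (tri_swap12 altc (e i0) (e i)).
  apply: (mulfI x0); rewrite [RHS]mulr0 -[RHS]h; field.
  exact: x0.
have PP i j k : tri c (row i P) (row j P) (row k P) = 0.
  have s12 x y z : tri c x y z = 0 -> tri c y x z = 0 by move=> h; rewrite tri_swap12 // h oppr0.
  have s23 x y z : tri c x y z = 0 -> tri c x z y = 0 by move=> h; rewrite tri_swap23 // h oppr0.
  have t1 := ijk _ _ _ w123; have t2 := ijk _ _ _ w124; have t3 := ijk _ _ _ w134; have t4 := ijk _ _ _ w234.
  have t1' := s12 _ _ _ t1; have t2' := s12 _ _ _ t2; have t3' := s12 _ _ _ t3; have t4' := s12 _ _ _ t4.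
  elim/ord4P: i; elim/ord4P: j; elim/ord4P: k; rewrite /P !rows4E ?triA //;
    do ?[by [] | by apply: s23 | by apply: s12; apply: s23 | by apply: s23; apply: s12].
have NP : Nmx c P *m P^T = 0.
  apply/matrixP => i j; rewrite [RHS]mxE.
  have -> : (Nmx c P *m P^T) i j = ((delta_mx 0 i : 'rV_6) *m Nmx c P *m (row j P)^T) 0 0.
    rewrite -rowE [LHS]mxE [RHS]mxE; apply: eq_bigr => l _.
    by rewrite [row i _ _ _]mxE tr_row [col j _ _ _]mxE.
  by rewrite NmxE !PP !mulr0 !addr0.
have Ps : P *m phi_matrix c s^T = 0.
  apply/row_matrixP => i; rewrite row0 row_mul; apply/sub_kermxP/tri_kermx_phi => w.
  elim/ord4P: i; rewrite /P rows4E !triE !se; ring.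
have rP : \rank P = 4%N.
  apply/eqP; rewrite -/(row_free P) -kermx_eq0; apply/eqP/row_matrixP => i; rewrite row0.
  set u := row i _; have uP : u *m P = 0 by apply/sub_kermxP; exact: row_sub.
  have : row_mx 0 u = 0 :> 'rV_(1 + 4).
    by apply: (row_free_inj fP); rewrite mul0mx mul_row_col mul0mx add0r.
  by rewrite -[X in _ = X -> _]row_mx0 => /eq_row_mx[].
have rN : (\rank (Nmx c P) <= 4)%N.
  by have := mulmx0_rank_max NP; rewrite mxrank_tr rP => h; rewrite -(leq_add2r 4); exact: leq_trans h n8.
have [u [v [wn0 wN]]] := wedge_dec rN.
exact: (notbad_wedge altc nb fP Ps wn0 wN).
Qed.

End Isotropic.

Section Rank.
Variables (K : closedFieldType) (c : tensor3 K 8).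
Hypotheses (altc : alternating c) (nb : notbad c).

Lemma kernel_basis8 k (x : 'rV[K]_8) : x != 0 -> (\rank (phi_matrix c x^T) + k.+1 <= 8)%N ->
  exists P : 'M_(k, 8), row_free (col_mx x P) /\ P *m phi_matrix c x^T = 0.
Proof.
move=> x0 r; have [|P [fP /sub_kermxP Px]] := @extend_basis K 8 1 8 k x (kermx (phi_matrix c x^T)) (row_free1 x0).
  by rewrite mxrank_ker leq_subRL ?rank_leq_row // r.
by exists P.
Qed.

(* A 3-form on a 5-dimensional space is divisible by a linear form xi, the kernel of an
   alternating 5 x 5 matrix, so it vanishes on a hyperplane. *)
Lemma notbad_rank_gt2 (s : 'rV[K]_8) : s != 0 -> (2 < \rank (phi_matrix c s^T))%N.
Proof.
move=> s0; rewrite ltnNge; apply/negP => le2.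
have [P [fP Ps]] : exists P : 'M_(5, 8), row_free (col_mx s P) /\ P *m phi_matrix c s^T = 0.
  by apply: kernel_basis8 => //; exact: (leq_add le2 (leqnn 6)).
pose e (i : nat) := row (inord i : 'I_5) P.
pose T i j k := tri c (e i) (e j) (e k).
(* The 3-form on five vectors as an alternating form on the dual space: entry (i, j) is up to sign
   its value on the three other vectors, and u b = 0 says xi ^ T = 0. *)
pose b : 'M[K]_5 := \matrix_(i, j) nth 0 (nth [::] [::
  [:: 0; T 2 3 4; - T 1 3 4; T 1 2 4; - T 1 2 3]; [:: - T 2 3 4; 0; T 0 3 4; - T 0 2 4; T 0 2 3];
  [:: T 1 3 4; - T 0 3 4; 0; T 0 1 4; - T 0 1 3]; [:: - T 1 2 4; T 0 2 4; - T 0 1 4; 0; T 0 1 2];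
  [:: T 1 2 3; - T 0 2 3; T 0 1 3; - T 0 1 2; 0]] i) j.
have altb : altmx b.
  split=> [|i]; last by rewrite mxE; case: i => [[|[|[|[|[]]]]]].
  by apply/matrixP => -[[|[|[|[|[]]]]] // ?] [[|[|[|[|[]]]]] // ?]; rewrite !mxE /= ?opprK ?oppr0.
have /rowV0Pn[u /sub_kermxP ub u0] : kermx b != 0.
  rewrite kermx_eq0 /row_free; have [od _] := altmx_rank_det altb.
  by apply: contraNneq od => ->.
pose xi (i : nat) := u 0 (inord i).
have ub_ j : \sum_(i < 5) u 0 i * b i j = 0 by have := congr1 (fun r : 'rV_5 => r 0 j) ub; rewrite !mxE.
have sum5 (V : nmodType) (G : 'I_5 -> V) : \sum_i G i = G (inord 0) + G (inord 1) + G (inord 2) + G (inord 3) + G (inord 4).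
  rewrite !big_ord_recl big_ord0 addr0 !addrA.
  by congr (_ + _ + _ + _ + _); congr (G _); apply/val_inj; rewrite /= inordK.
have rel (j : 'I_5) (b' := nth [::] [::
  [:: 0; - T 2 3 4; T 1 3 4; - T 1 2 4; T 1 2 3]; [:: T 2 3 4; 0; - T 0 3 4; T 0 2 4; - T 0 2 3];
  [:: - T 1 3 4; T 0 3 4; 0; - T 0 1 4; T 0 1 3]; [:: T 1 2 4; - T 0 2 4; T 0 1 4; 0; - T 0 1 2];
  [:: - T 1 2 3; T 0 2 3; - T 0 1 3; T 0 1 2; 0]] j) :
    xi 0%N * nth 0 b' 0 + xi 1%N * nth 0 b' 1 + xi 2 * nth 0 b' 2 + xi 3 * nth 0 b' 3 + xi 4 * nth 0 b' 4 = 0.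
  rewrite -[RHS](ub_ j) sum5 !mxE !inordK // /b' /xi.
  by case: j {b'} => [[|[|[|[|[]]]]] // ?].
have w4 : wedge4 c e xi 0 1 2 3.
  by rewrite /wedge4 -[RHS]oppr0 -(rel (inord 4)) inordK //= /T; ring.
have w3 : wedge4 c e xi 0 1 2 4.
  by apply: etrans (rel (inord 3)); rewrite inordK //= /T; ring.
have w2 : wedge4 c e xi 0 1 3 4.
  by rewrite /wedge4 -[RHS]oppr0 -(rel (inord 2)) inordK //= /T; ring.
have w1 : wedge4 c e xi 0 2 3 4.
  by apply: etrans (rel (inord 1)); rewrite inordK //= /T; ring.
have w0 : wedge4 c e xi 1 2 3 4.
  by rewrite /wedge4 -[RHS]oppr0 -(rel (inord 0)) inordK //= /T; ring.
have se i w : tri c s (e i) w = 0.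
  by apply: kermx_phi_tri; apply/sub_kermxP; rewrite -row_mul Ps row0.
have ind a b0 b1 b2 b3 b4 :
    a *: s + b0 *: e 0%N + b1 *: e 1%N + b2 *: e 2 + b3 *: e 3 + b4 *: e 4 = 0 ->
    [/\ a = 0, b0 = 0, b1 = 0, b2 = 0 & b3 = 0] /\ b4 = 0.
  move=> h; pose r : 'rV[K]_5 := \row_i nth 0 [:: b0; b1; b2; b3; b4] i.
  have : row_mx a%:M r = 0 :> 'rV_(1 + 5).
    apply: (row_free_inj fP); rewrite mul0mx mul_row_col mul_scalar_mx mulmx_sum_row sum5.
    by rewrite !mxE !inordK //= !addrA.
  rewrite -[X in _ = X -> _]row_mx0 => /eq_row_mx[/matrixP/(_ 0 0)]; rewrite !mxE eqxx mulr1n => -> r0.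
  have r_ i : (i < 5)%N -> nth 0 [:: b0; b1; b2; b3; b4] i = 0.
    by move=> lti; have := congr1 (fun q : 'rV_5 => q 0 (inord i)) r0; rewrite !mxE inordK.
  by split; [split=> //; [exact: (r_ 0%N)|exact: (r_ 1%N)|exact: (r_ 2)|exact: (r_ 3)]|exact: (r_ 4)].
have [i xin0] : exists i : 'I_5, xi i != 0.
  apply: NNPP => /not_ex_all_not h; move/eqP: u0; apply; apply/rowP => i; rewrite [RHS]mxE.
  by have /negP := h i; rewrite negbK /xi inord_val => /eqP.
have s12 := wedge4_swap12 altc; have s23 := wedge4_swap23 altc; have s34 := wedge4_swap34 altc.
case: i xin0 => [[|[|[|[|[]]]]] // ?] /= xin0.
- exact: (wedge4_bad altc (leqnn _) nb xin0 ind se w4 w3 w2 w1).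
- apply: (wedge4_bad altc (leqnn _) nb xin0 (i1 := 0) (i2 := 2) (i3 := 3) (i4 := 4) _ se); last exact: w0.
  + move=> a b0 b1 b2 b3 b4 h; have [|[-> -> -> -> ->] ->] := ind a b1 b0 b2 b3 b4; last by split.
    by rewrite -h; congr (_ + _ + _ + _); rewrite addrAC.
  + by apply: s12.
  + by apply: s12.
  + by apply: s12.
- apply: (wedge4_bad altc (leqnn _) nb xin0 (i1 := 0) (i2 := 1) (i3 := 3) (i4 := 4) _ se).
  + move=> a b0 b1 b2 b3 b4 h; have [|[-> -> -> -> ->] ->] := ind a b1 b2 b0 b3 b4; last by split.
    by rewrite -h; apply/rowP => l; rewrite !mxE; ring.
  + by apply: s12; apply: s23.
  + by apply: s12; apply: s23.
  + by apply: s12.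
  + by apply: s12.
- apply: (wedge4_bad altc (leqnn _) nb xin0 (i1 := 0) (i2 := 1) (i3 := 2) (i4 := 4) _ se).
  + move=> a b0 b1 b2 b3 b4 h; have [|[-> -> -> -> ->] ->] := ind a b1 b2 b3 b0 b4; last by split.
    by rewrite -h; apply/rowP => l; rewrite !mxE; ring.
  + by apply: s12; apply: s23; apply: s34.
  + by apply: s12; apply: s23.
  + by apply: s12; apply: s23.
  + by apply: s12; apply: s23.
- apply: (wedge4_bad altc (leqnn _) nb xin0 (i1 := 0) (i2 := 1) (i3 := 2) (i4 := 3) _ se).
  + move=> a b0 b1 b2 b3 b4 h; have [|[-> -> -> -> ->] ->] := ind a b1 b2 b3 b4 b0; last by split.
    by rewrite -h; apply/rowP => l; rewrite !mxE; ring.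
  + by apply: s12; apply: s23; apply: s34.
  + by apply: s12; apply: s23; apply: s34.
  + by apply: s12; apply: s23; apply: s34.
  + by apply: s12; apply: s23; apply: s34.
Qed.

End Rank.

Section Rank4.
Variables (K : closedFieldType) (c : tensor3 K 8).
Hypotheses (altc : alternating c) (nb : notbad c).

Lemma rank_4_or_6 (x : 'rV[K]_8) : x != 0 ->
  \rank (phi_matrix c x^T) = 4%N \/ \rank (phi_matrix c x^T) = 6%N.
Proof.
move=> x0; have [ev _] := altmx_rank_det (phi_altmx x altc).
have gt2 := notbad_rank_gt2 altc nb x0.
have : (\rank (phi_matrix c x^T) < 8)%N.
  have /mulmx0_rank_max : x *m phi_matrix c x^T = 0 by exact: phi_kerl.
  by rewrite rank_rV x0.
move: ev gt2; move: (\rank _) => r.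
by case: r => [|[|[|[|[|[|[|[|]]]]]]]] //; [left|right].
Qed.

(** If x has rank 6, let x, y span its kernel. Among the y - t x, the form on a complement W
    degenerates when t is an eigenvalue of A(y) A(x)^-1. That vector has x, y and a vector of W in
    its kernel, so its rank is below 6. *)
Lemma rank4_exists : exists s : 'rV[K]_8, s != 0 /\ \rank (phi_matrix c s^T) = 4%N.
Proof.
pose x : 'rV[K]_8 := delta_mx 0 0.
have x0 : x != 0.
  by apply/eqP => /(congr1 (fun r : 'rV_8 => r 0 0)) /eqP; rewrite !mxE oner_eq0.
have [r4|r6] := rank_4_or_6 x0; first by exists x.
have [y [fxy yx]] : exists y : 'M_(1, 8), row_free (col_mx x y) /\ y *m phi_matrix c x^T = 0.
  by apply: kernel_basis8; rewrite // r6.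
have xx : x *m phi_matrix c x^T = 0 by exact: phi_kerl.
have Pxy : col_mx x y *m phi_matrix c x^T = 0 by rewrite mul_col_mx xx yx col_mx0.
have [W uB] := @complete_basis K 2 6 _ fxy.
pose A v := W *m phi_matrix c v^T *m W^T.
have rx : A x \in unitmx.
  rewrite -row_free_unit /row_free /A (@rank_on_complement K 2 6 8 _ (col_mx x y)) ?r6 //.
  - exact: phi_altmx.
  - by rewrite row_free_unit.
have /closed_rootP[t] : size (char_poly (A y *m invmx (A x))) != 1%N.
  by rewrite size_char_poly.
rewrite -eigenvalue_root_char => /eigenvalueP[w ew w0].
pose s := (- t) *: x + y.
have eA : w *m A s = 0.
  rewrite /A phi_matrixP mulmxDr mulmxDl -scalemxAr -scalemxAl mulmxDr -!/(A _) -scalemxAr.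
  by rewrite -[w *m A y](mulmxKV rx) -(mulmxA w (A y)) ew -scalemxAl scaleNr addNr.
have s0 : s != 0.
  apply/eqP => s0; have : row_mx (- t)%:M 1%:M = 0 :> 'rV_(1 + 1).
    by apply: (row_free_inj fxy); rewrite mul0mx mul_row_col mul_scalar_mx mul1mx.
  rewrite -[X in _ = X -> _]row_mx0 => /eq_row_mx[_ /matrixP/(_ 0 0)/eqP].
  by rewrite !mxE eqxx oner_eq0.
exists s; split=> //.
have Ty v : tri c x y v = 0 by apply: kermx_phi_tri; exact/sub_kermxP.
have xs : x *m phi_matrix c s^T = 0.
  rewrite phi_matrixP mulmxDr -scalemxAr xx scaler0 add0r.
  by apply/sub_kermxP/tri_kermx_phi => v; rewrite tri_swap12 // Ty oppr0.
have ys : y *m phi_matrix c s^T = 0.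
  rewrite phi_matrixP mulmxDr -scalemxAr yx scaler0 add0r; exact: phi_kerl.
have ws : w *m W *m phi_matrix c s^T = 0.
  pose Z := - (phi_matrix c s^T *m (W^T *m w^T)).
  have eZ : (w *m W *m phi_matrix c s^T)^T = Z by rewrite !trmx_mul phi_trmx // mulNmx.
  have BZ : col_mx (col_mx x y) W *m Z = 0.
    have xZ : x *m Z = 0 by rewrite /Z mulmxN mulmxA xs mul0mx oppr0.
    have yZ : y *m Z = 0 by rewrite /Z mulmxN mulmxA ys mul0mx oppr0.
    have WZ : W *m Z = 0.
      by apply: trmx_inj; rewrite -eZ trmx_mul trmxK trmx0 -[RHS]eA /A !mulmxA.
    by rewrite !mul_col_mx xZ yZ WZ !col_mx0.
  by apply: trmx_inj; rewrite eZ trmx0 -[LHS](mulKmx uB) BZ mulmx0.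
have fw : row_free (col_mx (col_mx x y) (w *m W)).
  rewrite -kermx_eq0; apply/eqP/row_matrixP => i; rewrite row0.
  set u := row i _; have : u *m col_mx (col_mx x y) (w *m W) = 0 by apply/sub_kermxP; exact: row_sub.
  rewrite -[u]hsubmxK mul_row_col [rsubmx u]mx11_scalar mul_scalar_mx => h.
  have fB : row_free (col_mx (col_mx x y) W) by rewrite row_free_unit.
  have : row_mx (lsubmx u) (rsubmx u 0 0 *: w) = 0 :> 'rV_(2 + 6).
    by apply: (row_free_inj fB); rewrite mul0mx mul_row_col -scalemxAl.
  rewrite -[X in _ = X -> _]row_mx0 => /eq_row_mx[-> /eqP]; rewrite scaler_eq0 (negbTE w0) orbF => /eqP ->.
  by rewrite raddf0 row_mx0.
have := @mulmx0_rank_max _ _ _ _ (col_mx (col_mx x y) (w *m W)) (phi_matrix c s^T).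
rewrite !mul_col_mx xs ys ws !col_mx0 (eqP fw) => /(_ erefl).
by have [->|->] := rank_4_or_6 s0.
Qed.

End Rank4.

Lemma tri_cyc (R : comNzRingType) n (c : tensor3 R n) x y z : alternating c -> tri c y z x = tri c x y z.
Proof. by move=> altc; rewrite tri_swap23 // (tri_swap12 altc x y) opprK. Qed.

Section GoodVector.
Variables (K : closedFieldType) (c : tensor3 K 8).
Hypotheses (altc : alternating c) (nb : notbad c).
Local Notation T := (tri c).

Lemma basis_ext (M N : 'M[K]_(4, 8)) x y :
  (forall u v : 'rV_4, u *m M + v *m N = 0 -> u = 0 /\ v = 0) ->
  (forall i, T x y (row i M) = 0) -> (forall i, T x y (row i N) = 0) -> forall w, T x y w = 0.
Proof.
move=> ind hM hN w.
have uB : (col_mx M N : 'M_8) \in unitmx.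
  rewrite -row_free_unit -kermx_eq0; apply/eqP/row_matrixP => i; rewrite row0.
  set u := row i _; have : u *m (col_mx M N : 'M_8) = 0 by apply/sub_kermxP; exact: row_sub.
  rewrite -[u](@hsubmxK K 1 4 4) => h; have [] := ind (@lsubmx K 1 4 4 u) (@rsubmx K 1 4 4 u).
    by rewrite -[LHS]mul_row_col.
  by move=> -> ->; rewrite row_mx0.
have eB (u v : 'rV[K]_4) : T x y (u *m M + v *m N) = 0.
  rewrite tri3D !mulmx_sum_row !tri3_sum !big1 ?addr0 // => i _; rewrite tri3Z ?hM ?hN mulr0 //.
rewrite -[w](mulmxKV uB); move: (w *m invmx _) => u.
rewrite -[u](@hsubmxK K 1 4 4); have := eB (@lsubmx K 1 4 4 u) (@rsubmx K 1 4 4 u).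
by rewrite -mul_row_col.
Qed.

(** The kernel of T(z, -, -) contains z, p, q, r, and the 3-form that it inherits modulo z does not
    vanish. *)
Definition goodvec z p q r : Prop := [/\ z != 0, forall w, T z p w = 0, forall w, T z q w = 0,
  forall w, T z r w = 0 & T p q r != 0].

(** T vanishes on k1, k2, k3, so s is not good, and z = k1 + a s is tried with s, t, n1 in its
    kernel up to corrections. The scalar a makes T(z, t, n1) = 0; multiples of k2 and k3, which pair
    with n3 and n2, remove the other values. The value required of a good vector is then T(s, t,
    n1). *)
Lemma goodvec_core s k1 k2 k3 t n1 n2 n3 :
  (forall x y, T x y s = 0 -> T x y k1 = 0 -> T x y k2 = 0 -> T x y k3 = 0 ->
     T x y t = 0 -> T x y n1 = 0 -> T x y n2 = 0 -> T x y n3 = 0 -> forall w, T x y w = 0) ->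
  (forall w, T s k1 w = 0) -> (forall w, T s k2 w = 0) -> (forall w, T s k3 w = 0) -> T k1 k2 k3 = 0 ->
  [/\ T k1 k2 t = 0, T k1 k2 n1 = 0, T k1 k2 n2 = 0 & T k1 k2 n3 = 1] ->
  [/\ T k3 k1 t = 0, T k3 k1 n1 = 0, T k3 k1 n2 = 1 & T k3 k1 n3 = 0] ->
  T s t n1 != 0 -> exists z p q r, goodvec z p q r.
Proof.
move=> bas s1 s2 s3 k123 [k12t k121 k122 k123'] [k31t k311 k312 k313] lam.
pose a := - T k1 t n1 / T s t n1; pose z := k1 + a *: s.
have zt1 : T z t n1 = 0 by rewrite /z !triE /a mulrC; field.
have cyc := tri_cyc; have sw12 := tri_swap12 altc; have sw23 := tri_swap23 altc.
have zs w : T z s w = 0 by rewrite /z !triE triA // sw12 s1; ring.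
have k13 w : T k1 k3 w = - T k3 k1 w by exact: sw12.
have E y m3 m2 w : T z (y - m3 *: k2 + m2 *: k3) w = T z y w - m3 * T k1 k2 w - m2 * T k3 k1 w.
  by rewrite /z !triE s2 s3 k13; ring.
have zk1 y : T z y k1 = 0 by rewrite /z !triE triA // (sw23 s k1) s1; ring.
have zs3 y : T z y s = 0 by rewrite sw23 zs oppr0.
have zk2 y : T z y k2 = - T k1 k2 y by rewrite /z !triE (sw23 s k2) s2 (sw23 k1 k2); ring.
have zk3 y : T z y k3 = T k3 k1 y by rewrite /z !triE (sw23 s k3) s3 (sw23 k1 k3) k13; ring.
have k12s : T k1 k2 s = 0 by rewrite cyc // s1.
have k31s : T k3 k1 s = 0 by rewrite cyc // s3.
have k312' : T k3 k1 k2 = 0 by rewrite -cyc.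
exists z, s, (t - T z t n3 *: k2 + T z t n2 *: k3), (n1 - T z n1 n3 *: k2 + T z n1 n2 *: k3); split.
- apply/eqP => z0; have : T z k2 n3 = 0 by rewrite z0 tri10.
  by rewrite /z !triE s2 k123' mulr0 addr0 => /eqP; rewrite oner_eq0.
- exact: zs.
- apply: bas; rewrite E ?zs3 ?zk1 ?zk2 ?zk3 ?triA // ?k12s ?k31s ?k123 ?k312' ?k12t ?k31t ?k121 ?k311
    ?k122 ?k312 ?k123' ?k313 ?zt1; ring.
- have z1t : T z n1 t = 0 by rewrite sw23 zt1 oppr0.
  apply: bas; rewrite E ?zs3 ?zk1 ?zk2 ?zk3 ?triA // ?k12s ?k31s ?k123 ?k312' ?k12t ?k31t ?k121 ?k311
    ?k122 ?k312 ?k123' ?k313 ?z1t; ring.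
- rewrite !triE !s2 !s3 (sw23 s k2) (sw23 s k3) s2 s3.
  by rewrite !(mulr0, oppr0, addr0).
Qed.

(** A relation with a1 != 0 makes s, a1 k2 - a2 k1, a1 k3 - a3 k1 span a bad subspace: the wedge of
    the last two is a1 times the relation. *)
Lemma indep_pair3 s k1 k2 k3 a1 a2 a3 :
  (forall a b1 b2 b3, a *: s + b1 *: k1 + b2 *: k2 + b3 *: k3 = 0 -> [/\ a = 0, b1 = 0, b2 = 0 & b3 = 0]) ->
  (forall w, T s k1 w = 0) -> (forall w, T s k2 w = 0) -> (forall w, T s k3 w = 0) ->
  (forall w, a1 * T k2 k3 w + a2 * T k3 k1 w + a3 * T k1 k2 w = 0) -> a1 = 0.
Proof.
move=> ind s1 s2 s3 h; apply/eqP/negP => /negP a10.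
apply: (nb (x := s) (y := a1 *: k2 - a2 *: k1) (z := a1 *: k3 - a3 *: k1)).
- move=> a b d e; have [] := ind a (- (b * a2 + d * a3)) (b * a1) (d * a1).
    by rewrite -[RHS]e; apply/rowP => l; rewrite !mxE; ring.
  by move=> -> _ /eqP; rewrite mulf_eq0 (negbTE a10) orbF => /eqP -> /eqP;
    rewrite mulf_eq0 (negbTE a10) orbF => /eqP ->.
- by move=> w; rewrite !triE s1 s2; ring.
- by move=> w; rewrite !triE s1 s3; ring.
- move=> w; rewrite !triE triA // (tri_swap12 altc k3 k1) (tri_swap12 altc k1 k2).
  by rewrite -[RHS](mulr0 a1) -[in RHS](h w); ring.
Qed.

(** Let s have rank 4 and kernel s, k1, k2, k3 with T(k1, k2, k3) = 0. The functionals T(k_i, k_j,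
    -) are independent, the n_i are dual to them, and t is taken in their common kernel, of
    dimension 5, but outside the kernel of s, of dimension 4. Then some T(s, t, n_i) is nonzero, and
    cyclic symmetry leads to [goodvec_core]. *)
Lemma goodvec_exists : exists z p q r, goodvec z p q r.
Proof.
have [s [s0 r4]] := rank4_exists altc nb.
have [P [fP Ps]] : exists P : 'M_(3, 8), row_free (col_mx s P) /\ P *m phi_matrix c s^T = 0.
  by apply: kernel_basis8; rewrite // r4.
pose k1 := row 0 P; pose k2 := row 1 P; pose k3 := row 2 P.
have kk i w : T s (row i P) w = 0.
  by apply: kermx_phi_tri; apply/sub_kermxP; rewrite -row_mul Ps row0.
have s1 w : T s k1 w = 0 by exact: kk.
have s2 w : T s k2 w = 0 by exact: kk.
have s3 w : T s k3 w = 0 by exact: kk.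
have [k0|kn0] := eqVneq (T k1 k2 k3) 0; last by exists s, k1, k2, k3.
have ind a b1 b2 b3 : a *: s + b1 *: k1 + b2 *: k2 + b3 *: k3 = 0 -> [/\ a = 0, b1 = 0, b2 = 0 & b3 = 0].
  move=> h; pose r : 'rV[K]_3 := \row_i nth 0 [:: b1; b2; b3] i.
  have : row_mx a%:M r = 0 :> 'rV_(1 + 3).
    apply: (row_free_inj fP); rewrite mul0mx mul_row_col mul_scalar_mx mulmx_sum_row.
    rewrite !big_ord_recl big_ord0 !mxE /= addr0 -[RHS]h -!addrA.
    by congr (_ + (_ *: _ + (_ *: _ + _ *: _))); congr (row _ P); apply/val_inj.
  rewrite -[X in _ = X -> _]row_mx0 => /eq_row_mx[/matrixP/(_ 0 0)]; rewrite !mxE eqxx mulr1n => -> r0.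
  have r_ (i : 'I_3) : nth 0 [:: b1; b2; b3] i = 0.
    by have := congr1 (fun q : 'rV_3 => q 0 i) r0; rewrite !mxE.
  by split=> //; [exact: (r_ 0)|exact: (r_ 1)|exact: (r_ 2)].
pose g (i : 'I_3) : 'rV[K]_8 := nth 0 [:: k3 *m phi_matrix c k2^T; k1 *m phi_matrix c k3^T; k2 *m phi_matrix c k1^T] i.
pose th (i : 'I_3) w := nth 0 [:: T k2 k3 w; T k3 k1 w; T k1 k2 w] i.
have gth i w : (g i *m w^T) 0 0 = th i w.
  by case: i => [[|[|[|]]]] // ?; rewrite /g /th /= tri_phi.
have fG : row_free (\matrix_i g i).
  apply: row_free_lincomb => u hu; apply/rowP => i; rewrite [RHS]mxE.
  have hw w : u 0 0 * T k2 k3 w + u 0 1 * T k3 k1 w + u 0 2 * T k1 k2 w = 0.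
    have : ((\sum_k u 0 k *: g k) *m w^T) 0 0 = 0 by rewrite hu mul0mx mxE.
    rewrite mulmx_suml summxE; under eq_bigr => k _ do rewrite -scalemxAl mxE gth.
    rewrite !big_ord_recl big_ord0 addr0 addrA /th /= => <-.
    by congr (u 0 _ * _ + u 0 _ * _ + u 0 _ * _); apply/val_inj.
  have a1 := indep_pair3 ind s1 s2 s3 hw.
  have a2 : u 0 1 = 0.
    apply: (@indep_pair3 s k2 k3 k1 (u 0 1) (u 0 2) (u 0 0)) => //.
      move=> a b1 b2 b3 h; have [|-> -> -> ->] := ind a b3 b1 b2; last by split.
      by rewrite -[RHS]h; apply/rowP => l; rewrite !mxE; ring.
    by move=> w; rewrite -[RHS](hw w); ring.
  have a3 : u 0 2 = 0.
    apply: (@indep_pair3 s k3 k1 k2 (u 0 2) (u 0 0) (u 0 1)) => //.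
      move=> a b1 b2 b3 h; have [|-> -> -> ->] := ind a b2 b3 b1; last by split.
      by rewrite -[RHS]h; apply/rowP => l; rewrite !mxE; ring.
    by move=> w; rewrite -[RHS](hw w); ring.
  by case: i => [[|[|[|]]]] // lti; [rewrite -[RHS]a1|rewrite -[RHS]a2|rewrite -[RHS]a3];
    congr (u 0 _); apply/val_inj.
pose G := \matrix_i g i : 'M_(3, 8).
pose nn l := (col l (pinvmx G))^T.
have thn i l : th i (nn l) = (i == l)%:R.
  rewrite -gth /nn trmxK; have := congr1 (fun M : 'M_3 => M i l) (mulmxVp fG).
  rewrite [X in _ = X -> _]mxE => <-; rewrite [LHS]mxE [RHS]mxE; apply: eq_bigr => j _.
  by rewrite [col l _ _ _]mxE [(\matrix_i g i) _ _]mxE.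
have [i0 ti0] : exists i0, ~~ (row i0 (kermx G^T) <= kermx (phi_matrix c s^T))%MS.
  apply/row_subPn; apply/negP => /mxrankS; rewrite !mxrank_ker mxrank_tr (eqP fG) r4.
  by [].
pose t := row i0 (kermx G^T).
have tht i : th i t = 0.
  have tG : t *m G^T = 0 by apply/sub_kermxP; exact: row_sub.
  rewrite -gth -[g i](rowK g) -/G -row_mul mxE.
  have := congr1 (fun M : 'rV_3 => M 0 i) tG; rewrite [X in _ = X -> _]mxE => <-.
  by rewrite !mxE; apply: eq_bigr => j _; rewrite !mxE mulrC.
have th_k i : [/\ th i k1 = 0, th i k2 = 0 & th i k3 = 0].
  have k0' : T k3 k1 k2 = 0 by rewrite -tri_cyc.
  have k0'' : T k2 k3 k1 = 0 by rewrite tri_cyc.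
  by case: i => [[|[|[|]]]] // ?; rewrite /th /=; split; rewrite ?triA ?k0 ?k0' ?k0''.
have ths i : th i s = 0.
  by case: i => [[|[|[|]]]] // ?; rewrite /th /= tri_cyc // ?s1 ?s2 ?s3.
have th_add i a x y : th i (a *: x + y) = a * th i x + th i y.
  by case: i => [[|[|[|]]]] // ?; rewrite /th /= tri3P.
pose n1 := nn 0; pose n2 := nn 1; pose n3 := nn 2.
pose M := rows4 s k1 k2 k3; pose N := rows4 t n1 n2 n3.
have indMN (u v : 'rV_4) : u *m M + v *m N = 0 -> u = 0 /\ v = 0.
  rewrite !mul_rows4; move: (u 0 ('o4 0)) (u 0 ('o4 1)) (u 0 ('o4 2)) (u 0 ('o4 3)) (@rv4_eq0 K u).
  move: (v 0 ('o4 0)) (v 0 ('o4 1)) (v 0 ('o4 2)) (v 0 ('o4 3)) (@rv4_eq0 K v).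
  move=> b0 b1 b2 b3 bE a0 a1 a2 a3 aE h.
  have hth (i : 'I_3) : b1 * (i == 0)%:R + b2 * (i == 1)%:R + b3 * (i == 2)%:R = 0.
    have [e1 e2 e3] := th_k i.
    have := congr1 (th i) h; rewrite -[_ + (_ + b3 *: n3)]addr0 -!addrA.
    have th0 : th i 0 = 0 by case: (i) => [[|[|[|]]]] // ?; rewrite /th /= tri30.
    rewrite !th_add th0 e1 e2 e3 ths tht !thn !mulr0 !add0r addr0 addrA => -> //.
  have b10 : b1 = 0 by rewrite -[RHS](hth 0) /=; ring.
  have b20 : b2 = 0 by rewrite -[RHS](hth 1) /=; ring.
  have b30 : b3 = 0 by rewrite -[RHS](hth 2) /=; ring.
  have b00 : b0 = 0.
    apply/eqP/negP => /negP b0n; case/negP: ti0; apply: tri_kermx_phi => w; rewrite -/t.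
    have /(congr1 (fun x => T s x w)) := h; rewrite b10 b20 b30 !triE s1 s2 s3 triA // !(mulr0, mul0r, addr0, add0r).
    by move/eqP; rewrite mulf_eq0 (negbTE b0n) => /eqP.
  have [] := ind a0 a1 a2 a3; last by move=> *; split; [exact: aE | exact: bE].
  by rewrite -[RHS]h b00 b10 b20 b30 !scale0r !addr0.
have bas x y : T x y s = 0 -> T x y k1 = 0 -> T x y k2 = 0 -> T x y k3 = 0 ->
     T x y t = 0 -> T x y n1 = 0 -> T x y n2 = 0 -> T x y n3 = 0 -> forall w, T x y w = 0.
  move=> *; apply: (basis_ext indMN); elim/ord4P; by rewrite rows4E.
have thE x : (th 0 x = T k2 k3 x) * (th 1 x = T k3 k1 x) * (th 2 x = T k1 k2 x) by [].
have k01 : T k2 k3 k1 = 0 by rewrite tri_cyc.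
have k02 : T k3 k1 k2 = 0 by rewrite -tri_cyc.
have [l1|l1] := eqVneq (T s t n1) 0; last first.
  by apply: (goodvec_core bas) l1; rewrite // -?thE ?thn ?tht //.
have [l2|l2] := eqVneq (T s t n2) 0; last first.
  apply: (@goodvec_core s k2 k3 k1 t n2 n3 n1) l2; rewrite // -?thE ?thn ?tht //.
  by move=> x y *; apply: bas.
have [l3|l3] := eqVneq (T s t n3) 0; last first.
  apply: (@goodvec_core s k3 k1 k2 t n3 n1 n2) l3; rewrite // -?thE ?thn ?tht //.
  by move=> x y *; apply: bas.
case/negP: ti0; apply: tri_kermx_phi; rewrite -/t; apply: bas => //.
- by rewrite triA.
- by rewrite tri_swap23 // s1 oppr0.
- by rewrite tri_swap23 // s2 oppr0.
- by rewrite tri_swap23 // s3 oppr0.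
- by rewrite triA.
Qed.
End GoodVector.

(** Indices 0 to 7 stand for s, p, q, r, u1, u2, w1, w2; the triples listed are those where the
    normal form takes the value 1. *)
Definition normal_coef (t : 'I_8 * 'I_8 * 'I_8) : bool :=
  (nat_of_ord t.1.1, nat_of_ord t.1.2, nat_of_ord t.2) \in
    [:: (0, 4, 6); (0, 5, 7); (1, 4, 7); (2, 5, 6); (3, 4, 6); (1, 2, 3)]%N.

Definition normal_tensor (R : comNzRingType) : tensor3 R 8 :=
  altx (fun t : triple 8 => (normal_coef (val t))%:R).

Section NormalForm.
Variables (K : closedFieldType) (c : tensor3 K 8).
Hypotheses (altc : alternating c) (nb : notbad c).
Local Notation T := (tri c).

(** All values on the eight vectors except T(p, q, r) and those involving both w1 and w2, which are
    normalized afterwards. *)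
Record nform s p q r u1 u2 w1 w2 : Prop := NForm {
  nf_sp : forall w, T s p w = 0;
  nf_sq : forall w, T s q w = 0;
  nf_sr : forall w, T s r w = 0;
  nf_s : [/\ T s u1 u2 = 0, T s u1 w1 = 1, T s u1 w2 = 0, T s u2 w1 = 0 & T s u2 w2 = 1];
  nf_pq : [/\ T p q u1 = 0, T p q u2 = 0, T p q w1 = 0 & T p q w2 = 0];
  nf_pr : [/\ T p r u1 = 0, T p r u2 = 0, T p r w1 = 0 & T p r w2 = 0];
  nf_qr : [/\ T q r u1 = 0, T q r u2 = 0, T q r w1 = 0 & T q r w2 = 0];
  nf_p : [/\ T p u1 u2 = 0, T p u1 w1 = 0, T p u1 w2 = 1, T p u2 w1 = 0 & T p u2 w2 = 0];
  nf_q : [/\ T q u1 u2 = 0, T q u1 w1 = 0, T q u1 w2 = 0, T q u2 w1 = 1 & T q u2 w2 = 0];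
  nf_r : [/\ T r u1 u2 = 0, T r u1 w1 = 1, T r u1 w2 = 0, T r u2 w1 = 0 & T r u2 w2 = 0];
  nf_u : T u1 u2 w1 = 0 /\ T u1 u2 w2 = 0 }.

Record wform s p q r u1 u2 w1 w2 : Prop := WForm {
  wf_k : [/\ T s w1 w2 = 0, T p w1 w2 = 0, T q w1 w2 = 0 & T r w1 w2 = 0];
  wf_u : T u1 w1 w2 = 0 /\ T u2 w1 w2 = 0 }.

Lemma nform_indep s p q r u1 u2 w1 w2 a0 a1 a2 a3 b0 b1 b2 b3 : nform s p q r u1 u2 w1 w2 ->
  a0 *: s + a1 *: p + a2 *: q + a3 *: r + b0 *: u1 + b1 *: u2 + b2 *: w1 + b3 *: w2 = 0 ->
  [/\ a0 = 0, a1 = 0, a2 = 0 & a3 = 0] /\ [/\ b0 = 0, b1 = 0, b2 = 0 & b3 = 0].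
Proof.
move=> [sp sq sr [s1 s2 s3 s4 s5] [pq1 pq2 pq3 pq4] [pr1 pr2 pr3 pr4] [qr1 qr2 qr3 qr4]
  [p1 p2 p3 p4 p5] [q1 q2 q3 q4 q5] [r1 r2 r3 r4 r5] [uu1 uu2]] h.
have sw23 := tri_swap23 altc.
have E x y : T x y (a0 *: s + a1 *: p + a2 *: q + a3 *: r + b0 *: u1 + b1 *: u2 + b2 *: w1 + b3 *: w2) = 0.
  by rewrite h tri30.
have b2z : b2 = 0.
  by rewrite -[RHS](E s u1) !triE !triA // (sw23 s p) (sw23 s q) (sw23 s r) sp sq sr s1 s2 s3; ring.
have b3z : b3 = 0.
  by rewrite -[RHS](E s u2) !triE !triA // (sw23 s p) (sw23 s q) (sw23 s r) (sw23 s u1) sp sq sr s1 s4 s5; ring.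
subst b2 b3.
have b0z : b0 = 0.
  rewrite -[RHS]oppr0 -(E s w1) !triE !triA // (sw23 s p) (sw23 s q) (sw23 s r) (sw23 s u1 w1) (sw23 s u2 w1).
  by rewrite sp sq sr s2 s4; ring.
have b1z : b1 = 0.
  rewrite -[RHS]oppr0 -(E s w2) !triE !triA // (sw23 s p) (sw23 s q) (sw23 s r) (sw23 s u1 w2) (sw23 s u2 w2).
  by rewrite sp sq sr s3 s5; ring.
subst b0 b1.
have C x y z : T y z x = T x y z by exact: tri_cyc.
have a0z : a0 = 0 by rewrite -[RHS](E u2 w2) !triE !(C _ u2 w2) s5 p5 q5 r5; ring.
have a1z : a1 = 0 by rewrite -[RHS](E u1 w2) !triE !(C _ u1 w2) s3 p3 q3 r3; ring.
have a2z : a2 = 0 by rewrite -[RHS](E u2 w1) !triE !(C _ u2 w1) s4 p4 q4 r4; ring.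
have a3z : a3 = 0 by rewrite -[RHS](E u1 w1) !triE !(C _ u1 w1) a0z s2 p2 q2 r2; ring.
by [].
Qed.

Lemma nform_basis s p q r u1 u2 w1 w2 x y : nform s p q r u1 u2 w1 w2 ->
  T x y s = 0 -> T x y p = 0 -> T x y q = 0 -> T x y r = 0 ->
  T x y u1 = 0 -> T x y u2 = 0 -> T x y w1 = 0 -> T x y w2 = 0 -> forall w, T x y w = 0.
Proof.
move=> nf *; apply: (@basis_ext K c (rows4 s p q r) (rows4 u1 u2 w1 w2)); last 2 first.
- by elim/ord4P; rewrite rows4E.
- by elim/ord4P; rewrite rows4E.
move=> u v; rewrite !mul_rows4 !addrA => /(nform_indep nf)[[? ? ? ?] [? ? ? ?]].
by split; apply: rv4_eq0.
Qed.

Lemma normal_coords s p q r u1 u2 w1 w2 :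
  nform s p q r u1 u2 w1 w2 -> wform s p q r u1 u2 w1 w2 -> T p q r = 1 ->
  exists B : 'M_8, wedge3 B c = normal_tensor K /\ \det B != 0.
Proof.
move=> nf wf pqr.
pose b (i : 'I_8) := nth 0 [:: s; p; q; r; u1; u2; w1; w2] i.
exists (\matrix_i b i); split; last first.
  rewrite -unitfE -unitmxE -row_free_unit; apply: row_free_lincomb => u hu; apply/rowP => i; rewrite [RHS]mxE.
  have {hu} := hu; rewrite !big_ord_recl big_ord0 addr0 /b /= !addrA.
  move=> /(nform_indep nf)[[e0 e1 e2 e3] [e4 e5 e6 e7]].
  case: i => [[|[|[|[|[|[|[|[|]]]]]]]] lti] //;
    [rewrite -[RHS]e0|rewrite -[RHS]e1|rewrite -[RHS]e2|rewrite -[RHS]e3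
    |rewrite -[RHS]e4|rewrite -[RHS]e5|rewrite -[RHS]e6|rewrite -[RHS]e7];
    by congr (u 0 _); apply/val_inj.
apply: alternating_eq; [exact: wedge3_alt | exact: altx_alt |] => t.
rewrite altx_triple; case: t => [[[i j] l] /= /andP[ij jl]]; rewrite /normal_coef /= wedge3E !rowK /b.
move: nf => [sp sq sr [s1 s2 s3 s4 s5] [pq1 pq2 pq3 pq4] [pr1 pr2 pr3 pr4] [qr1 qr2 qr3 qr4]
  [p1 p2 p3 p4 p5] [q1 q2 q3 q4 q5] [r1 r2 r3 r4 r5] [uu1 uu2]].
move: wf => [[sw pw qw rw] [u1w u2w]].
case: i ij => -[|[|[|[|[|[|[|[|//]]]]]]]] _ /=; case: j jl => -[|[|[|[|[|[|[|[|//]]]]]]]] _ //=;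
  case: l => -[|[|[|[|[|[|[|[|//]]]]]]]] //= _ _ _; rewrite ?(sp, sq, sr) //.
Qed.

(** These weights preserve the values on one of s, p, q, r with one u and one w, and multiply T(p,
    q, r) by a^-3. *)
Lemma nform_scale s p q r u1 u2 w1 w2 a (s' := a^-1 *: s) (p' := a^-1 *: p) (q' := a^-1 *: q)
    (r' := a^-1 *: r) (u1' := a *: u1) (u2' := a *: u2) : a != 0 ->
  nform s p q r u1 u2 w1 w2 -> wform s p q r u1 u2 w1 w2 -> T p q r = a ^+ 3 ->
  [/\ nform s' p' q' r' u1' u2' w1 w2, wform s' p' q' r' u1' u2' w1 w2 & T p' q' r' = 1].
Proof.
move=> an0 [sp sq sr [s1 s2 s3 s4 s5] [pq1 pq2 pq3 pq4] [pr1 pr2 pr3 pr4] [qr1 qr2 qr3 qr4]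
  [p1 p2 p3 p4 p5] [q1 q2 q3 q4 q5] [r1 r2 r3 r4 r5] [uu1 uu2]] [[sw pw qw rw] [u1w u2w]] pqr.
split; last by rewrite /p' /q' /r' !triE pqr; field.
  split; do ?[move=> w]; rewrite /s' /p' /q' /r' /u1' /u2' !triE; rewrite ?(sp, sq, sr) ?mulr0 //;
  split; rewrite ?(s1, s2, s3, s4, s5, pq1, pq2, pq3, pq4) ?(pr1, pr2, pr3, pr4, qr1, qr2, qr3, qr4)
    ?(p1, p2, p3, p4, p5) ?(q1, q2, q3, q4, q5) ?(r1, r2, r3, r4, r5) ?uu1 ?uu2 ?mulr1 ?mulVf ?mulr0 //.
by split; split; rewrite /s' /p' /q' /r' /u1' /u2' !triE ?sw ?pw ?qw ?rw ?u1w ?u2w ?mulr0.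
Qed.

(** s, p, q, r pair perfectly with the four products u_i ^ w_j, so adding combinations of u1, u2 to
    w1, w2 removes their values on (w1, w2), and multiples of s remove those of u1, u2. The
    quadratic term carries T(x, u1, u2) = 0. *)
Lemma nform_adjust s p q r u1 u2 w1 w2 : nform s p q r u1 u2 w1 w2 ->
  exists w1' w2', nform s p q r u1 u2 w1' w2' /\ wform s p q r u1 u2 w1' w2'.
Proof.
move=> [sp sq sr [s1 s2 s3 s4 s5] [pq1 pq2 pq3 pq4] [pr1 pr2 pr3 pr4] [qr1 qr2 qr3 qr4]
  [p1 p2 p3 p4 p5] [q1 q2 q3 q4 q5] [r1 r2 r3 r4 r5] [uu1 uu2]].
have sw23 := tri_swap23 altc; have sw12 := tri_swap12 altc; have cyc x y z : T y z x = T x y z by exact: tri_cyc.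
pose y1 := T r w1 w2; pose x1 := - T p w1 w2; pose y2 := T q w1 w2; pose x2 := y1 - T s w1 w2.
pose b2 := - T u1 w1 w2; pose b1 := T u2 w1 w2.
have E x : T x (w1 + x1 *: u1 + x2 *: u2 + b1 *: s) (w2 + y1 *: u1 + y2 *: u2 + b2 *: s) =
  T x w1 w2 + x1 * T x u1 w2 + x2 * T x u2 w2 - y1 * T x u1 w1 - y2 * T x u2 w1
  + (x1 * y2 - x2 * y1) * T x u1 u2 - b1 * (T s x w2 + y1 * T s x u1 + y2 * T s x u2)
  + b2 * (T s x w1 + x1 * T s x u1 + x2 * T s x u2).
  rewrite !triE !triA // (sw23 x u1 w1) (sw23 x u2 w1) (sw23 x u1 u2) !(cyc s x) !(sw12 s x); ring.
have su21 : T s u2 u1 = 0 by rewrite sw23 s1 oppr0.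
exists (w1 + x1 *: u1 + x2 *: u2 + b1 *: s), (w2 + y1 *: u1 + y2 *: u2 + b2 *: s).
split; last first.
  split; split; rewrite E ?(s1, s2, s3, s4, s5) ?(sp, sq, sr) ?(p1, p2, p3, p4, p5) ?(q1, q2, q3, q4, q5)
    ?(r1, r2, r3, r4, r5) ?(sw12 u1 u2) ?uu1 ?uu2 ?triA // ?su21 /b1 /b2 /x1 /x2 /y1 /y2; ring.
have ext x y z a b d : T x y u1 = 0 -> T x y u2 = 0 -> T s x y = 0 ->
    T x y (z + a *: u1 + b *: u2 + d *: s) = T x y z.
  by move=> h1 h2 h3; rewrite !triE h1 h2 (cyc s x y) h3 !mulr0 !addr0.
have su11 : T s u1 u1 = 0 by rewrite triA.
have su22 : T s u2 u2 = 0 by rewrite triA.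
have px21 : T p u2 u1 = 0 by rewrite sw23 p1 oppr0.
have qx21 : T q u2 u1 = 0 by rewrite sw23 q1 oppr0.
have rx21 : T r u2 u1 = 0 by rewrite sw23 r1 oppr0.
by split=> //; split=> //; rewrite ext ?triA ?sp ?sq ?sr.
Qed.

Lemma nform_neq0 s p q r u1 u2 w1 w2 : nform s p q r u1 u2 w1 w2 -> T p q r != 0.
Proof.
move=> nf; apply/eqP => pqr; have [sp sq sr _ [pq1 pq2 pq3 pq4] _ _ _ _ _ _] := nf.
apply: (nb (x := s) (y := p) (z := q)) => //.
  move=> a b d e; have [|[-> -> -> _] _] := nform_indep (a0 := a) (a1 := b) (a2 := d) (a3 := 0)
    (b0 := 0) (b1 := 0) (b2 := 0) (b3 := 0) nf; last by split.
  by rewrite !scale0r !addr0.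
apply: (nform_basis nf); rewrite ?triA //; first by rewrite tri_cyc.
Qed.

Lemma nform_normal s p q r u1 u2 w1 w2 : nform s p q r u1 u2 w1 w2 ->
  exists B : 'M_8, wedge3 B c = normal_tensor K /\ \det B != 0.
Proof.
move=> /nform_adjust[{}w1 [{}w2 [nf wf]]]; have pqr := nform_neq0 nf.
have /closed_rootP[a] : size ('X^3 - (T p q r)%:P) != 1%N by rewrite size_XnsubC.
rewrite /root !hornerE subr_eq0 => /eqP ea.
have an0 : a != 0 by apply: contraNneq pqr => a0; rewrite -ea a0 expr0n.
by have [] := nform_scale an0 nf wf (esym ea); exact: normal_coords.
Qed.

End NormalForm.

Section NormalFormExists.
Variables (K : closedFieldType) (c : tensor3 K 8).
Hypotheses (altc : alternating c) (nb : notbad c).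
Local Notation T := (tri c).

(** W is a 4-dimensional space independent of s on which the three functionals given by p0, q0, r0
    vanish and T(s, -, -) is nondegenerate. Its bivectors pair with the four kernel vectors, so some
    decomposable one pairs to zero with all of them; it provides u1, u2, and w1, w2 are dual to them
    through s. *)
Lemma normal_form_exists : exists B : 'M_8, wedge3 B c = normal_tensor K /\ \det B != 0.
Proof.
have [s [p0 [q0 [r0 [s0 sp sq sr pqr]]]]] := goodvec_exists altc nb.
have sw23 := tri_swap23 altc; have sw12 := tri_swap12 altc; have cyc x y z : T y z x = T x y z by exact: tri_cyc.
have qrs : T q0 r0 s = 0 by rewrite cyc.
have rps : T r0 p0 s = 0 by rewrite cyc.
have pqs : T p0 q0 s = 0 by rewrite cyc.
have qrp : T q0 r0 p0 = T p0 q0 r0 by rewrite cyc.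
have rpq : T r0 p0 q0 = T p0 q0 r0 by rewrite -cyc.
have coefs a b d e : (fun x => [/\ T q0 r0 x = 0, T r0 p0 x = 0 & T p0 q0 x = 0])
    (a *: s + b *: p0 + d *: q0 + e *: r0) -> [/\ b = 0, d = 0 & e = 0].
  rewrite !triE !triA // qrs rps pqs qrp rpq !(mulr0, addr0, add0r) => -[/eqP h1 /eqP h2 /eqP h3].
  by move: h1 h2 h3; rewrite !mulf_eq0 (negbTE pqr) !orbF => /eqP-> /eqP-> /eqP->.
have ind a b d e : a *: s + b *: p0 + d *: q0 + e *: r0 = 0 -> [/\ a = 0, b = 0, d = 0 & e = 0].
  move=> h; have [|b0 d0 e0] := coefs a b d e; first by rewrite h !tri30.
  move: h; rewrite b0 d0 e0 !scale0r !addr0 => /eqP; rewrite scaler_eq0 (negbTE s0) orbF => /eqP->.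
  by split.
pose M := rows4 s p0 q0 r0.
have fM : row_free M.
  rewrite -kermx_eq0; apply/eqP/row_matrixP => i; rewrite row0.
  set u := row i _; have : u *m M = 0 by apply/sub_kermxP; exact: row_sub.
  by rewrite mul_rows4 => /ind[*]; apply: rv4_eq0.
have sMw i w : T s (row i M) w = 0 by move: i; elim/ord4P; rewrite rows4E ?triA.
have Mker : (M <= kermx (phi_matrix c s^T))%MS.
  by apply/row_subP => i; exact: tri_kermx_phi.
have r4 : \rank (phi_matrix c s^T) = 4%N.
  have := mxrankS Mker; rewrite mxrank_ker (eqP fM).
  by have [->|->] := rank_4_or_6 altc nb s0.
have kerM x : (forall w, T s x w = 0) -> exists a b d e, x = a *: s + b *: p0 + d *: q0 + e *: r0.
  move=> hx; have : (x <= M)%MS.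
    apply: submx_trans (tri_kermx_phi hx) _.
    by rewrite -(mxrank_leqif_sup Mker) mxrank_ker (eqP fM) r4.
  by move=> /submxP[u ->]; rewrite mul_rows4; do 4 eexists.
pose g (i : 'I_3) : 'rV[K]_8 := nth 0 [:: r0 *m phi_matrix c q0^T; p0 *m phi_matrix c r0^T; q0 *m phi_matrix c p0^T] i.
pose th (i : 'I_3) w := nth 0 [:: T q0 r0 w; T r0 p0 w; T p0 q0 w] i.
have gth i w : (g i *m w^T) 0 0 = th i w.
  by case: i => [[|[|[|]]]] // ?; rewrite /g /th /= tri_phi.
have [|W [fW WG]] := @extend_basis K 8 1 8 4 s (kermx (\matrix_i g i)^T) (row_free1 s0).
  have := rank_leq_row (\matrix_i g i); rewrite mxrank_ker mxrank_tr.
  by move: (\rank _) => k; case: k => [|[|[|[|]]]].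
have Wth i (u : 'rV_4) : th i (u *m W) = 0.
  have /sub_kermxP uG : (u *m W <= kermx (\matrix_i g i)^T)%MS by exact: submx_trans (submxMl _ _) WG.
  rewrite -gth; have := congr1 (fun M : 'rV_3 => M 0 i) uG; rewrite [X in _ = X -> _]mxE => <-.
  rewrite mxE [RHS]mxE; apply: eq_bigr => j _.
  by rewrite [X in _ * X]mxE [X in _ = _ * X]mxE [X in _ = _ * X]mxE mulrC.
have Wqr u : T q0 r0 (u *m W) = 0 by exact: (Wth 0).
have Wrp u : T r0 p0 (u *m W) = 0 by exact: (Wth 1).
have Wpq u : T p0 q0 (u *m W) = 0 by exact: (Wth 2).
have sW (u : 'rV_4) a : u *m W = a *: s -> u = 0.
  move=> h; have : row_mx (- a)%:M u = 0 :> 'rV_(1 + 4).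
    by apply: (row_free_inj fW); rewrite mul0mx mul_row_col mul_scalar_mx h -scalerDl addNr scale0r.
  by rewrite -[X in _ = X -> _]row_mx0 => /eq_row_mx[].
have kerW (u : 'rV_4) : (forall w, T s (u *m W) w = 0) -> u = 0.
  move=> /kerM[a [b [d [e h]]]]; have [|b0 d0 e0] := coefs a b d e; first by rewrite -h.
  by apply: (sW u a); rewrite h b0 d0 e0 !scale0r !addr0.
pose kQ x := [/\ T q0 r0 x = 0, T r0 p0 x = 0 & T p0 q0 x = 0].
have kkQ x (y y' : 'rV_4) : kQ x -> T (y *m M) (y' *m M) x = 0.
  move=> [h1 h2 h3]; rewrite !mul_rows4 !triE !triA // (sw12 s p0) (sw12 s q0) (sw12 s r0) !sp !sq !sr.
  by rewrite (sw12 p0 q0) (sw12 q0 r0) (sw12 r0 p0) h1 h2 h3; ring.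
have sM (y : 'rV_4) w : T s (y *m M) w = 0.
  by rewrite mul_rows4 !triE !triA // sp sq sr; ring.
have kQW u : kQ (u *m W) by split.
have kQs : kQ s by split.
have [u [v [wn0 wN]]] := @wedge_dec K 4 (Nmx c W *m M^T) (rank_leq_col _).
have uvM i : T (row i M) (u *m W) (v *m W) = 0.
  rewrite -cyc -wv_Nmx //; have := congr1 (fun X : 'rV_4 => X 0 i) wN.
  rewrite mulmxA [X in _ = X -> _]mxE => <-; rewrite mxE [RHS]mxE; apply: eq_bigr => j _.
  by rewrite [X in _ * X]mxE [X in _ = _ * X]mxE [X in _ * X = _]mxE.
have induv := wv_indep fW wn0.
have indMW (y t : 'rV_4) : y *m M + t *m W = 0 -> y = 0 /\ t = 0.
  move=> h; have eW : t *m W = - (y *m M) by apply/eqP; rewrite -addr_eq0 addrC h.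
  have : kQ (y *m M) by rewrite -[y *m M]opprK -eW; case: (kQW t) => h1 h2 h3; split; rewrite tri3N ?h1 ?h2 ?h3 oppr0.
  rewrite mul_rows4 => hk; have [b0 d0 e0] := coefs _ _ _ _ hk.
  move: eW; rewrite mul_rows4 b0 d0 e0 !scale0r !addr0 -scaleNr => /sW t0.
  move: h; rewrite t0 mul0mx addr0 => h; split=> //.
  by apply: (row_free_inj fM); rewrite h mul0mx.
pose H : 'M[K]_(2, 4) := \matrix_i \row_k T s (nth 0 [:: u; v] i *m W) (row k W).
have fH : row_free H.
  apply: row_free_lincomb => y hy.
  have e0 : (y 0 0 *: u + y 0 1 *: v) = 0.
    apply: kerW; apply: (basis_ext indMW) => i.
      by rewrite sw23 sMw oppr0.
    have := congr1 (fun X : 'rV_4 => X 0 i) hy; rewrite summxE [X in _ = X -> _]mxE => <-.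
    rewrite !big_ord_recl big_ord0 !mxE /= addr0 mulmxDl -!scalemxAl !triE.
    by congr (_ + y _ _ * _); apply/val_inj.
  have [|_ y0 y1] := induv 0 (y 0 0) (y 0 1).
    by rewrite scale0r add0r !scalemxAl -mulmxDl e0 mul0mx.
  by apply/rowP; elim/ord2P; rewrite [RHS]mxE.
pose w_ j : 'rV[K]_8 := (col j (pinvmx H))^T *m W.
have sw (i j : 'I_2) : T s (nth 0 [:: u; v] i *m W) (w_ j) = (i == j)%:R.
  have := congr1 (fun X : 'M_2 => X i j) (mulmxVp fH); rewrite [X in _ = X -> _]mxE => <-.
  rewrite /w_ (mulmx_sum_row (col j _)^T) tri3_sum mxE; apply: eq_bigr => k _.
  by rewrite tri3Z [(col j _)^T _ _]mxE [col j _ _ _]mxE [H _ _]mxE [X in _ = X * _]mxE mulrC.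
pose w1 := w_ 0; pose w2 := w_ 1.
(* The multiples of s kill T(u1, u2, w1) and T(u1, u2, w2) and leave the values with kernel vectors
   unchanged. *)
pose u1 := u *m W - T (u *m W) (v *m W) w2 *: s; pose u2 := v *m W + T (u *m W) (v *m W) w1 *: s.
have s11 : T s u1 w1 = 1 by rewrite /u1 !triE triA // mulr0 subr0; exact: (sw 0 0).
have s12 : T s u1 w2 = 0 by rewrite /u1 !triE triA // mulr0 subr0; exact: (sw 0 1).
have s21 : T s u2 w1 = 0 by rewrite /u2 !triE triA // mulr0 addr0; exact: (sw 1 0).
have s22 : T s u2 w2 = 1 by rewrite /u2 !triE triA // mulr0 addr0; exact: (sw 1 1).
have Mu i : T (row i M) u1 u2 = 0.
  rewrite /u1 /u2 !triE uvM !triA // !(cyc s (row i M)) !(sw12 s (row i M)) !sMw; ring.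
have uuw : T u1 u2 w1 = 0 /\ T u1 u2 w2 = 0.
  have h1 : T s (u *m W) w1 = 1 := sw 0 0; have h2 : T s (u *m W) w2 = 0 := sw 0 1.
  have h3 : T s (v *m W) w1 = 0 := sw 1 0; have h4 : T s (v *m W) w2 = 1 := sw 1 1.
  by rewrite /u1 /u2; split; rewrite !triE triA // (sw12 s (u *m W)) ?h1 ?h2 ?h3 ?h4; ring.
have MUy (y : 'rV_4) : T (y *m M) u1 u2 = 0.
  by rewrite mulmx_sum_row tri1_sum big1 // => i _; rewrite tri1Z Mu mulr0.
have su12 : T s u1 u2 = 0 by have := Mu ('o4 0); rewrite rows4E.
have kQlin a x y : kQ x -> kQ y -> kQ (x + a *: y).
  by move=> [h1 h2 h3] [h1' h2' h3']; split; rewrite !triE ?(h1, h2, h3) ?(h1', h2', h3') mulr0 addr0.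
have kQu1 : kQ u1 by rewrite /u1 -scaleNr; apply: kQlin.
have kQu2 : kQ u2 by apply: kQlin.
have kQw1 : kQ w1 by exact: kQW.
have kQw2 : kQ w2 by exact: kQW.
clearbody u1 u2 w1 w2 M.
pose N := rows4 u1 u2 w1 w2.
have indMN (y t : 'rV_4) : y *m M + t *m N = 0 -> y = 0 /\ t = 0.
  rewrite (mul_rows4 t); move: (t 0 ('o4 0)) (t 0 ('o4 1)) (t 0 ('o4 2)) (t 0 ('o4 3)) (@rv4_eq0 K t).
  move=> b0 b1 b2 b3 bE h.
  have E x : T s x (y *m M + (b0 *: u1 + b1 *: u2 + b2 *: w1 + b3 *: w2)) = 0 by rewrite h tri30.
  have sM' x : T s x (y *m M) = 0 by rewrite sw23 sM oppr0.
  have b2z : b2 = 0 by rewrite -[RHS](E u1) !triE sM' triA // su12 s11 s12; ring.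
  have b3z : b3 = 0 by rewrite -[RHS](E u2) !triE sM' !triA // (sw23 s u1) su12 s21 s22; ring.
  subst b2 b3.
  have b0z : b0 = 0.
    by rewrite -[RHS]oppr0 -(E w1) !triE sM' (sw23 s u1 w1) (sw23 s u2 w1) s11 s21; ring.
  have b1z : b1 = 0.
    by rewrite -[RHS]oppr0 -(E w2) !triE sM' (sw23 s u1 w2) (sw23 s u2 w2) s12 s22; ring.
  split; last exact: bE.
  by apply: (row_free_inj fM); rewrite mul0mx -[RHS]h b0z b1z !scale0r !addr0.
(* The index runs over (u1, w1), (u1, w2), (u2, w1), (u2, w2). The pairing [R] of the kernel with
   these is invertible, since a null vector would span a bad subspace with u1, u2; the rows of the
   inverse yield p, q, r. *)
pose pu (k : 'I_4) := nth 0 [:: u1; u1; u2; u2] k.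
pose pw (k : 'I_4) := nth 0 [:: w1; w2; w1; w2] k.
pose R : 'M[K]_4 := \matrix_(i, k) T (row i M) (pu k) (pw k).
have Ry (y : 'rV_4) k : (y *m R) 0 k = T (y *m M) (pu k) (pw k).
  by rewrite mxE mulmx_sum_row tri1_sum; apply: eq_bigr => i _; rewrite tri1Z [R _ _]mxE.
have Ry_ (y : 'rV_4) : [/\ (y *m R) 0 ('o4 0) = T (y *m M) u1 w1, (y *m R) 0 ('o4 1) = T (y *m M) u1 w2,
    (y *m R) 0 ('o4 2) = T (y *m M) u2 w1 & (y *m R) 0 ('o4 3) = T (y *m M) u2 w2].
  by rewrite !Ry /pu /pw !inordK.
have uR : R \in unitmx.
  rewrite -row_free_unit -kermx_eq0; apply/negP => /negP/rowV0Pn[y /sub_kermxP yR y0].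
  have [] := Ry_ y; rewrite yR !mxE => /esym z11 /esym z12 /esym z21 /esym z22.
  apply: (nb (x := y *m M) (y := u1) (z := u2)).
  - move=> a b d e; have [] := @indMN (a *: y) (row4 b d 0 0).
      by rewrite mul_rows4 !row4E -scalemxAl !scale0r !addr0 addrA.
    move=> /eqP; rewrite scaler_eq0 (negbTE y0) orbF => /eqP -> h.
    have := congr1 (fun X : 'rV_4 => X 0 ('o4 0)) h; have := congr1 (fun X : 'rV_4 => X 0 ('o4 1)) h.
    by rewrite !row4E !mxE.
  - apply: (basis_ext indMN); first by move=> i; rewrite rowE cyc kkQ.
    by elim/ord4P; rewrite rows4E ?z11 ?z12 ?triA.
  - apply: (basis_ext indMN); first by move=> i; rewrite rowE cyc kkQ.
    by elim/ord4P; rewrite rows4E ?z21 ?z22 ?triA // sw23 MUy oppr0.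
  - apply: (basis_ext indMN); first by move=> i; rewrite cyc.
    by case: uuw => h1 h2; elim/ord4P; rewrite rows4E ?h1 ?h2 ?triA.
pose a_ k := row k (invmx R) *m M.
have aE k : [/\ T (a_ k) u1 w1 = (k == 'o4 0)%:R, T (a_ k) u1 w2 = (k == 'o4 1)%:R,
    T (a_ k) u2 w1 = (k == 'o4 2)%:R & T (a_ k) u2 w2 = (k == 'o4 3)%:R].
  have [<- <- <- <-] := Ry_ (row k (invmx R)).
  by rewrite -row_mul mulVmx // !mxE.
have o4 i j : (i < 4)%N -> (j < 4)%N -> (('o4 i == 'o4 j) = (i == j))%N.
  by move=> lti ltj; rewrite -val_eqE /= !inordK.
apply: (@nform_normal K c altc nb s (a_ ('o4 1)) (a_ ('o4 2)) (a_ ('o4 0)) u1 u2 w1 w2).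
have [p1 p2 p3 p4] := aE ('o4 1); have [q1 q2 q3 q4] := aE ('o4 2); have [r1 r2 r3 r4'] := aE ('o4 0).
split.
- by move=> w; exact: sM.
- by move=> w; exact: sM.
- by move=> w; exact: sM.
- by split.
- by split; exact: kkQ.
- by split; exact: kkQ.
- by split; exact: kkQ.
- by rewrite p1 p2 p3 p4 !o4 //; split=> //; exact: MUy.
- by rewrite q1 q2 q3 q4 !o4 //; split=> //; exact: MUy.
- by rewrite r1 r2 r3 r4' !o4 //; split=> //; exact: MUy.
- by [].
Qed.

End NormalFormExists.

(** [c] and a tensor with nonzero [f16v] have the same normal form, and [f16v] only changes by a
    nonzero factor along an orbit. *)
Lemma f16v_eq0_bad f16 (K : closedFieldType) (c : tensor3 K 8) :
  hyperdiscriminant f16 -> alternating c -> f16v f16 c = 0 -> ~ notbad c.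
Proof.
move=> f16P altc fc0 nb; have [c1 [altc1 fc1]] := f16v_nonzero f16P K.
have nb1 : notbad c1.
  by move=> x y z ind h1 h2 h3; move/eqP: fc1; apply; exact: (f16v_bad f16P altc1 ind h1 h2 h3).
have [B [eB dB]] := normal_form_exists altc nb; have [B1 [eB1 dB1]] := normal_form_exists altc1 nb1.
move/eqP: fc1; apply; apply/eqP.
have : \det B1 ^+ 6 * f16v f16 c1 == 0 by rewrite -f16v_semiinv // eB1 -eB f16v_semiinv // fc0 mulr0.
by rewrite mulf_eq0 expf_eq0 (negbTE dB1).
Qed.

(** * The sextic form *)

Lemma lift_eqF n (i : 'I_n) r : ((lift i r == i) = false) * ((i == lift i r) = false).
Proof. by rewrite eq_sym (negbTE (neq_lift i r)). Qed.

Section QuotientMatrix.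
Variable S : comNzRingType.
Implicit Types (x : 'cV[S]_9) (c : tensor3 S 9).

(* The rows x_i e_l - x_l e_i, l <> i, vanish at x; where x_i is invertible they
   identify the quotient by x with S^8. *)
Definition quomx x (i : 'I_9) : 'M[S]_(8, 9) :=
  \matrix_(r, l) (x i 0 * (l == lift i r)%:R - x (lift i r) 0 * (l == i)%:R).

Lemma mul_quomx x i (v : 'cV_9) r : (quomx x i *m v) r 0 = x i 0 * v (lift i r) 0 - x (lift i r) 0 * v i 0.
Proof.
rewrite mxE; under eq_bigr => l _ do rewrite !mxE mulrBl.
rewrite sumrB (bigD1 (lift i r)) //= eqxx big1 ?addr0.
  rewrite (bigD1 i) //= eqxx big1 ?addr0 ?mulr1 // => l ne.
  by rewrite (negbTE ne) mulr0 mul0r.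
by move=> l ne; rewrite (negbTE ne) mulr0 mul0r.
Qed.

Lemma quomx_ker x i : quomx x i *m x = 0.
Proof. by apply/colP => r; rewrite mul_quomx [RHS]mxE mulrC subrr. Qed.

(** Any other choice of quotient coordinates factors through [quomx] up to the scalar x_i, which
    makes the charts comparable. *)
Lemma quomx_factor x i (M : 'M_(8, 9)) : M *m x = 0 -> x i 0 *: M = col' i M *m quomx x i.
Proof.
move=> Mx; apply/matrixP => r l; rewrite [LHS]mxE [RHS]mxE.
under eq_bigr => j _ do rewrite !mxE mulrBr.
rewrite sumrB; have h : \sum_j M r j * x j 0 = 0.
  by have := congr1 (fun A : 'cV_8 => A r 0) Mx; rewrite !mxE.
case: (unliftP i l) => [l'|] ->.
  rewrite [X in _ - X]big1 ?subr0; last by move=> j _; rewrite lift_eqF !mulr0.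
  rewrite (bigD1 l') //= eqxx big1 ?addr0; first by rewrite mulr1 mulrC.
  by move=> j ne; rewrite (inj_eq lift_inj) eq_sym (negbTE ne) !mulr0.
rewrite big1 ?sub0r; last by move=> j _; rewrite lift_eqF !mulr0.
apply/eqP; rewrite -addr_eq0 -[X in _ == X]h (bigD1_ord i) //= mulrC; apply/eqP; congr (_ + _).
by apply: eq_bigr => j _; rewrite eqxx mulr1.
Qed.

Lemma col'_quomx x i : col' i (quomx x i) = (x i 0)%:M.
Proof.
apply/matrixP => r l; rewrite !mxE (inj_eq lift_inj) lift_eqF.
by rewrite mulr0 subr0 mulr_natr eq_sym.
Qed.

(* Signed maximal minors span the kernel of quomx. *)
Lemma det_col'_quomx x i j : (x j 0 * \det (col' i (quomx x j))) ^+ 2 = (x i 0 * x j 0 ^+ 8) ^+ 2.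
Proof.
case: (unliftP j i) => [r|] ->; last by rewrite col'_quomx det_scalar.
pose B v : 'M[S]_9 := col_mx v (quomx x j) : 'M_(1 + 8).
pose m : 'cV_9 := \col_l ((-1) ^+ l * \det (col' l (quomx x j))).
have Bm v : (v *m m) 0 0 = \det (B v).
  rewrite (expand_det_row _ (0 : 'I_9)) mxE; apply: eq_bigr => l _; rewrite mxE /cofactor.
  have -> : B v 0 l = v 0 l.
    by rewrite -[RHS](@col_mxEu S 1 8 9 v (quomx x j)); congr (B v _ _); apply/val_inj.
  rewrite add0n; congr (_ * (_ * \det _)); apply/matrixP => a b.
  rewrite [LHS]mxE [RHS]mxE [RHS]mxE -[LHS](@col_mxEd S 1 8 9 v (quomx x j)); congr (B v _ _).
  exact/val_inj.
have Qm : quomx x j *m m = 0.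
  apply/colP => a; rewrite [RHS]mxE; transitivity ((row a (quomx x j) *m m) 0 0).
    by rewrite -row_mul [RHS]mxE.
  rewrite Bm; apply: (determinant_alternate (i1 := 0) (i2 := lift 0 a)) => // l.
  transitivity (row a (quomx x j) 0 l).
    by rewrite -[RHS](@col_mxEu S 1 8 9 _ (quomx x j)); congr (B _ _ _); apply/val_inj.
  rewrite [LHS]mxE -[LHS](@col_mxEd S 1 8 9 (row a (quomx x j))); congr (B _ _ _); exact/val_inj.
have := congr1 (fun A : 'cV_8 => A r 0) Qm; rewrite mul_quomx !mxE col'_quomx det_scalar => /eqP.
rewrite subr_eq0 => /eqP h.
have sg n (a : S) : ((-1) ^+ n * a) ^+ 2 = a ^+ 2 by rewrite exprMn sqrr_sign mul1r.
rewrite -(sg (lift j r)) mulrCA h mulrCA.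
by rewrite sg.
Qed.

End QuotientMatrix.

Section Sextic.
Variable f16 : {mpoly int[#|{: triple 8}|]}.
Hypothesis f16P : hyperdiscriminant f16.

Definition quo16 (S : comNzRingType) (c : tensor3 S 9) (x : 'cV[S]_9) i : S :=
  f16v f16 (wedge3 (quomx x i) c).

Lemma quo16_factor (S : comNzRingType) (c : tensor3 S 9) (x : 'cV[S]_9) i (M : 'M_(8, 9)) :
  alternating c -> M *m x = 0 ->
  x i 0 ^+ 48 * f16v f16 (wedge3 M c) = \det (col' i M) ^+ 6 * quo16 c x i.
Proof.
move=> altc Mx; have := congr1 (fun A => f16v f16 (wedge3 A c)) (quomx_factor i Mx).
rewrite /= wedge3_scale f16v_scale // -exprM => ->.
by rewrite wedge3_mul f16v_semiinv //; exact: wedge3_alt.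
Qed.

(** The transition determinant is x_i x_j^7 up to sign and enters with power 6, while the scalar
    contributes x_i^48; 42 is both 6 * 7 and 48 - 6. *)
Lemma quo16_swap (S : idomainType) (c : tensor3 S 9) (x : 'cV[S]_9) i j :
  alternating c -> x i 0 != 0 -> x j 0 != 0 ->
  quo16 c x i * x j 0 ^+ 42 = x i 0 ^+ 42 * quo16 c x j.
Proof.
move=> altc xi xj; have := quo16_factor i altc (quomx_ker x j).
rewrite -/(quo16 c x j) => e.
have d := det_col'_quomx x i j.
apply: (mulfI (expf_neq0 6 (mulf_neq0 xi xj))).
transitivity (((x i 0 * x j 0 ^+ 8) ^+ 2) ^+ 3 * quo16 c x i); first by ring.
rewrite -d; transitivity (x j 0 ^+ 6 * (\det (col' i (quomx x j)) ^+ 6 * quo16 c x i)); first by ring.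
by rewrite -e; ring.
Qed.

Lemma quomx_map (R S : comNzRingType) (f : {rmorphism R -> S}) (x : 'cV[R]_9) i :
  map_mx f (quomx x i) = quomx (map_mx f x) i.
Proof.
apply/matrixP => a b; rewrite !mxE rmorphB !rmorphM.
by case: (_ == _); case: (_ == _); rewrite ?rmorph0 ?rmorph1.
Qed.

Lemma quo16_map (R S : comNzRingType) (f : {rmorphism R -> S}) (c : tensor3 R 9) (x : 'cV[R]_9) i :
  f (quo16 c x i) = quo16 (cmap f c) (map_mx f x) i.
Proof. by rewrite /quo16 -f16v_map wedge3_map quomx_map. Qed.

(** The chart forms p_i have degree 48 = 3 * 16, and by [quo16_swap] p_i = X_i^42 G with G of degree
    6. At a point with x_i != 0 the factor x_i^42 is a unit, and any other M differs from
    [quomx x i] by an invertible matrix. *)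
Lemma sextic_exists (k : fieldType) (c : tensor3 k 9) : alternating c ->
  exists G : {mpoly k[9]}, G \is 6.-homog /\
  forall (L : fieldType) (f : {rmorphism k -> L}) (x : 'cV[L]_9), x != 0 ->
    ((exists M : 'M[L]_(8, 9), [/\ \rank M = 8%N, M *m x = 0 & eval3 intr f16 (wedge3 M (cmap f c)) = 0])
       <-> mmap f (fun i => x i 0) G = 0).
Proof.
move=> altc; pose R := {mpoly k[9]}; pose X : 'cV[R]_9 := \col_i 'X_i.
pose cR := cmap (@mpolyC 9 k) c.
have altR : alternating cR by exact: cmap_alt.
have Xn0 (i : 'I_9) : X i 0 != 0 by rewrite mxE -msize_poly_eq0 msizeX.
have XE i : X i 0 = 'X_i by rewrite mxE.
pose p i := quo16 cR X i.
have [G eG0] : exists G, p 0 = 'X_0 ^+ 42 * G.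
  by apply: (@mpolyXi_dvd _ 9 0 1 42 _ (p 1)); rewrite // -!XE; apply: quo16_swap.
have eG i : p i = 'X_i ^+ 42 * G.
  apply: (mulIf (expf_neq0 42 (Xn0 0))); rewrite quo16_swap // -/(p 0) eG0 !XE; ring.
exists G; split.
  apply/scaleX_dhomog.
  pose sc : {rmorphism R -> {poly R}} := mmap (@polyC R \o @mpolyC 9 k) (fun i => 'X_i *: 'X).
  have scX : map_mx sc X = 'X *: map_mx (@polyC R) X.
    apply/matrixP => i j; rewrite !mxE /sc /= mmapX mmap1U -mul_polyC.
    by rewrite mulrC.
  have scc : cmap sc cR = cmap (@polyC R) cR by apply/ffunP => t; rewrite !ffunE /sc /= mmapC.
  have sp : sc (p 0) = 'X ^+ 48 * (p 0)%:P.
    rewrite /p (quo16_map sc) scX scc.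
    have -> : quo16 (cmap (@polyC R) cR) ('X *: map_mx (@polyC R) X) 0 =
        f16v f16 (wedge3 ('X *: quomx (map_mx (@polyC R) X) 0) (cmap (@polyC R) cR)).
      congr (f16v _ (wedge3 _ _)); apply/matrixP => a b; rewrite !mxE; ring.
    by rewrite wedge3_scale f16v_scale // -exprM quo16_map.
  apply: (mulfI (expf_neq0 42 (_ : 'X * ('X_0 : R)%:P != 0 :> {poly R}))).
    by rewrite mulf_neq0 ?polyX_eq0 // polyC_eq0 -XE.
  have sX : sc 'X_0 = 'X * ('X_0)%:P by have := congr1 (fun A : 'cV_9 => A 0 0) scX; rewrite !mxE.
  rewrite -{1}sX -rmorphXn -[scaleX G]/(sc G) -rmorphM -eG0 sp eG0 -mul_polyC.
  by rewrite rmorphM rmorphXn /= exprMn; ring.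
move=> L f x x0; pose ev : {rmorphism R -> L} := mmap f (fun i => x i 0).
have evX : map_mx ev X = x.
  by apply/matrixP => i j; rewrite ord1 !mxE /ev /= mmapX mmap1U.
have evc : cmap ev cR = cmap f c by apply/ffunP => t; rewrite !ffunE /ev /= mmapC.
have pe i : quo16 (cmap f c) x i = x i 0 ^+ 42 * ev G.
  rewrite -{1}evX -evc -quo16_map -/(p i) eG rmorphM rmorphXn /=; congr (_ ^+ _ * _).
  by rewrite mmapX mmap1U.
have [i xi] : exists i, x i 0 != 0.
  apply: NNPP => /not_ex_all_not h; move/eqP: x0; apply; apply/colP => i; rewrite [RHS]mxE.
  by have /negP := h i; rewrite negbK => /eqP.
have altf : alternating (cmap f c) by exact: cmap_alt.
have detq : \rank (col' i (quomx x i)) = 8%N.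
  by rewrite col'_quomx; apply/eqP; rewrite -/(row_free _) row_free_unit unitmxE det_scalar unitfE expf_neq0.
have col'E (M : 'M[L]_(8, 9)) : col' i M = M *m col' i 1%:M.
  apply/matrixP => a b; rewrite mxE [RHS]mxE (bigD1 (lift i b)) //= !mxE eqxx mulr1 big1 ?addr0 // => j ne.
  by rewrite !mxE (negbTE ne) mulr0.
split=> [[M [rM Mx M0]]|G0]; last first.
  exists (quomx x i); split; [|exact: quomx_ker|].
    by apply/eqP; rewrite eqn_leq rank_leq_row /= -{1}detq col'E mxrankM_maxl.
  by rewrite -[LHS]/(quo16 _ _ _) pe -/(ev G) /= G0 mulr0.
have := quo16_factor i altf Mx; rewrite -[f16v _ _]/(eval3 _ _ _) M0 mulr0 pe => /esym/eqP.
rewrite mulf_eq0 expf_eq0 mulf_eq0 (expf_eq0 (x i 0)) (negbTE xi) /= => /orP[/eqP d0|/eqP //].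
have : \rank (x i 0 *: M) = 8%N by rewrite (eqmx_scale _ xi) rM.
rewrite (quomx_factor i Mx) => h.
have : \rank (col' i M) = 8%N.
  by apply/eqP; rewrite eqn_leq rank_leq_row /= -{1}h mxrankM_maxl.
by move/eqP; rewrite -/(row_free _) row_free_unit unitmxE d0 unitr0.
Qed.

End Sextic.

(** * Gradients of the cubic and zeros of the sextic *)

Lemma eq_meval (R : comNzRingType) n (a : {mpoly R[n]}) (v w : 'I_n -> R) :
  v =1 w -> a.@[v] = a.@[w].
Proof. by move=> e; apply: eq_mmap. Qed.

Section PolynomialFunctions.
Variable K : closedFieldType.
Implicit Types g q : K -> K.

(** Records polynomial dependence on a parameter, so that a vanishing known for most values extends
    to all of them; this replaces limits. *)
Definition pfun g := exists p : {poly K}, forall s, p.[s] = g s.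

Lemma pfunC a : pfun (fun _ => a).
Proof. by exists a%:P => s; rewrite hornerC. Qed.

Lemma pfunX : pfun id.
Proof. by exists 'X => s; rewrite hornerX. Qed.

Lemma pfunD g q : pfun g -> pfun q -> pfun (fun s => g s + q s).
Proof. by move=> [p hp] [r hr]; exists (p + r) => s; rewrite hornerD hp hr. Qed.

Lemma pfunM g q : pfun g -> pfun q -> pfun (fun s => g s * q s).
Proof. by move=> [p hp] [r hr]; exists (p * r) => s; rewrite hornerM hp hr. Qed.

Lemma pfunN g : pfun g -> pfun (fun s => - g s).
Proof. by move=> [p hp]; exists (- p) => s; rewrite hornerN hp. Qed.

Lemma pfunXn g n : pfun g -> pfun (fun s => g s ^+ n).
Proof. by move=> [p hp]; exists (p ^+ n) => s; rewrite horner_exp hp. Qed.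

Lemma pfun_sum I (r : seq I) (g : I -> K -> K) :
  (forall i, pfun (g i)) -> pfun (fun s => \sum_(i <- r) g i s).
Proof.
move=> hg; elim: r => [|i r [p hp]]; first by exists 0 => s; rewrite big_nil horner0.
by have [q hq] := hg i; exists (q + p) => s; rewrite big_cons hornerD hp hq.
Qed.

Lemma pfun_prod I (r : seq I) (g : I -> K -> K) :
  (forall i, pfun (g i)) -> pfun (fun s => \prod_(i <- r) g i s).
Proof.
move=> hg; elim: r => [|i r [p hp]]; first by exists 1 => s; rewrite big_nil hornerC.
by have [q hq] := hg i; exists (q * p) => s; rewrite big_cons hornerM hp hq.
Qed.

Lemma pfun_meval n (a : {mpoly K[n]}) (v : 'I_n -> K -> K) :
  (forall i, pfun (v i)) -> pfun (fun s => a.@[fun i => v i s]).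
Proof.
move=> hv; have [p hp] : pfun (fun s => \sum_(m <- msupp a) a@_m * \prod_(i < n) v i s ^+ m i).
  apply: pfun_sum => m; apply: pfunM; first exact: pfunC.
  by apply: pfun_prod => i; apply: pfunXn.
by exists p => s; rewrite hp mevalE.
Qed.

Lemma pfun_tri n (C : tensor3 K n) (x y z : K -> 'rV[K]_n) :
  (forall i, pfun (fun s => x s 0 i)) -> (forall i, pfun (fun s => y s 0 i)) ->
  (forall i, pfun (fun s => z s 0 i)) -> pfun (fun s => tri C (x s) (y s) (z s)).
Proof.
move=> hx hy hz; rewrite /tri; apply: pfun_sum => i; apply: pfun_sum => j; apply: pfun_sum => l.
by do !apply: pfunM => //; exact: pfunC.
Qed.

Lemma pfun_cub1 n (C : tensor3 K n) (x y : K -> 'rV[K]_n) :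
  (forall i, pfun (fun s => x s 0 i)) -> (forall i, pfun (fun s => y s 0 i)) ->
  pfun (fun s => cub1 C (x s) (y s)).
Proof. by move=> hx hy; rewrite /cub1; do !apply: pfunD; apply: pfun_tri. Qed.

Lemma pfun_cub3 n (C : tensor3 K n) (x y z : K -> 'rV[K]_n) :
  (forall i, pfun (fun s => x s 0 i)) -> (forall i, pfun (fun s => y s 0 i)) ->
  (forall i, pfun (fun s => z s 0 i)) -> pfun (fun s => cub3 C (x s) (y s) (z s)).
Proof. by move=> hx hy hz; rewrite /cub3; do !apply: pfunD; apply: pfun_tri. Qed.

Lemma pfun_zero g q : pfun g -> pfun q -> (forall s, g s * q s = 0) -> (exists s, g s != 0) ->
  forall s, q s = 0.
Proof.
move=> [p hp] [r hr] h [s gs] t; have : p * r = 0.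
  by apply: poly_pointwise0 => u; rewrite hornerM hp hr.
move/eqP; rewrite mulf_eq0 => /orP[/eqP p0|/eqP r0]; last by rewrite -hr r0 horner0.
by move: gs; rewrite -hp p0 horner0 eqxx.
Qed.

End PolynomialFunctions.

Section GaussImage.
Variables (K : closedFieldType) (c C : tensor3 K 9).
Hypothesis altc : alternating c.
Hypothesis hadj : forall v, \adj (phi_matrix c v^T) = (tri C v v v) ^+ 2 *: (v^T *m v).
Hypothesis nb : notbad c.
Hypothesis rk2 : forall x : 'rV[K]_9, x != 0 -> (2 < \rank (phi_matrix c x^T))%N.

Definition gauss (x : 'rV[K]_9) (l : 'I_9) : K := cub1 C x (delta_mx 0 l).

Lemma meval_scale n d (a : {mpoly K[n]}) (t : K) (v : 'I_n -> K) :
  a \is d.-homog -> a.@[fun i => t * v i] = t ^+ d * a.@[v].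
Proof.
move=> ha; rewrite !mevalE big_distrr big_seq [RHS]big_seq; apply: eq_bigr => m mp /=.
have <- : mdeg m = d := dhomog_mf ha mp.
rewrite mulrCA mdegE -prodrXr -big_split; congr (_ * _); apply: eq_bigr => i _ /=.
by rewrite exprMn.
Qed.

(** If x has rank 6, T(-, y, z) is a multiple of the gradient at x. If x has rank 4 it is a singular
    point, and T(-, y, z) is a limit of gradients: by [rank4_polar] it is proportional to the polar
    form of some h at x, which gradients on the cubic near x in directions close to h approach. *)
Lemma gauss_tangent d (a : {mpoly K[9]}) x y z :
  a \is d.-homog -> (forall v, tri C v v v = 0 -> a.@[gauss v] = 0) ->
  indep3 x y z -> (forall w, tri c x y w = 0) -> (forall w, tri c x z w = 0) ->
  a.@[fun l => tri c (delta_mx 0 l) y z] = 0.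
Proof.
move=> ha aF ind xy xz.
have x0 : x != 0.
  apply/eqP => x0; have [] := ind 1 0 0; first by rewrite x0 scaler0 !scale0r !addr0.
  by move/eqP; rewrite oner_eq0.
have xx : x *m phi_matrix c x^T = 0 by exact: phi_kerl.
have yx : y *m phi_matrix c x^T = 0 by apply/sub_kermxP/tri_kermx_phi.
have zx : z *m phi_matrix c x^T = 0 by apply/sub_kermxP/tri_kermx_phi.
have f3 := row_free_indep3 ind.
have Fx : tri C x x x = 0.
  apply/eqP; rewrite -(cubic_rank_le6 altc hadj x0).
  have := @mulmx0_rank_max _ _ _ _ (col_mx x (col_mx y z)) (phi_matrix c x^T).
  rewrite !mul_col_mx xx yx zx !col_mx0 (eqP f3) => /(_ erefl) h.
  by rewrite -(leq_add2l 3).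
have [r4|r6] := cubic_zero_rank altc hadj rk2 x0 Fx; last first.
  have [k1 [k1n0 hk1]] := rank6_cub1 altc hadj ind xy xz r6.
  have := aF _ Fx; rewrite (_ : a.@[gauss x] = a.@[fun l => k1 * tri c (delta_mx 0 l) y z]).
    by rewrite (meval_scale _ _ ha) => /eqP; rewrite mulf_eq0 expf_eq0 (negbTE k1n0) andbF => /eqP.
  by apply: eq_meval => l; rewrite /gauss hk1.
have [|E [fE Ex]] := @extend_basis K 9 3 9 2 _ (kermx (phi_matrix c x^T)) f3.
  by rewrite mxrank_ker r4.
pose k3 := row 0 E; pose k4 := row 1 E.
have eE : E = col_mx k3 k4.
  by apply/row_matrixP; apply: ord2P; rewrite (row2_0, row2_1).
pose P := col_mx (col_mx y z) (col_mx k3 k4).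
have fP : row_free (col_mx x P).
  rewrite /P col_mxA row_free_castmx; move: fE; rewrite eE; exact.
have kx : col_mx k3 k4 *m phi_matrix c x^T = 0 by rewrite -eE; apply/sub_kermxP.
have Px : P *m phi_matrix c x^T = 0 by rewrite mul_col_mx kx mul_col_mx yx zx !col_mx0.
have PE : P = rows4 y z k3 k4 by rewrite -[RHS]col_mx_rows4 !rows4E.
(* By [tdim] the six values on pairs from y, z, k3, k4 can be prescribed. This gives h as in
   [rank4_polar], and w1 at which the quadratic term at x is nonzero. *)
have pres (r : 'rV_6) : exists h, row6 (tri c y z h) (tri c y k3 h) (tri c y k4 h)
    (tri c z k3 h) (tri c z k4 h) (tri c k3 k4 h) = r.
  have rN := tdim altc nb fP Px.
  have : (r <= (Nmx c P)^T)%MS by apply: submx_full; rewrite /row_full mxrank_tr rN.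
  by move=> /submxP[h ->]; exists h; rewrite NmxT // PE !rows4E.
have row6inj a0 a1 a2 a3 a4 a5 b0 b1 b2 b3 b4 b5 : row6 a0 a1 a2 a3 a4 a5 = row6 b0 b1 b2 b3 b4 b5 :> 'rV[K]_6 ->
    [/\ a0 = b0, a1 = b1, a2 = b2, a3 = b3 & a4 = b4] /\ a5 = b5.
  move=> /rowP e; do !split; [have := e ('o6 0)|have := e ('o6 1)|have := e ('o6 2)|have := e ('o6 3)
    |have := e ('o6 4)|have := e ('o6 5)]; by rewrite !row6E.
have cyc u v w : tri c v w u = tri c u v w by exact: tri_cyc.
have [h /row6inj[[h1 h2 h3 h4 h5] h6]] := pres (row6 0 0 0 0 0 1).
have [w1 /row6inj[[w11 w12 w13 w14 w15] w16]] := pres (row6 1 0 0 0 0 1).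
have [g1 g2 g3] : [/\ tri c h y z = 0, tri c h y k3 = 0 & tri c h y k4 = 0] by split; rewrite -cyc.
have [g4 g5 g6] : [/\ tri c h z k3 = 0, tri c h z k4 = 0 & tri c h k3 k4 != 0].
  by split; rewrite -cyc ?h4 ?h5 ?h6 ?oner_eq0.
have [hx0 [k1 [k1n0 hk1]]] := rank4_polar altc hadj fP Px r4 g1 g2 g3 g4 g5 g6.
have [dFx [k0 [k0n0 hk0]]] := rank4_cub altc hadj fP Px r4.
have Pf1 : cub1 C w1 x != 0.
  rewrite -sqrf_eq0 hk0 mulf_neq0 ?expf_neq0 //.
  suff : \det (col_mx (col_mx y z) (col_mx k3 k4) *m phi_matrix c w1^T *m
      (col_mx (col_mx y z) (col_mx k3 k4))^T) != 0 by [].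
  rewrite col_mx_congr.
  have off (Y Z : 'M[K]_(2, 9)) : (forall i j, tri c w1 (row i Y) (row j Z) = 0) ->
      Y *m phi_matrix c w1^T *m Z^T = 0.
    by move=> hYZ; apply/matrixP => i j; rewrite mul_phi_entry hYZ mxE.
  rewrite (off (col_mx y z) (col_mx k3 k4)).
    by rewrite det_lblock !det_phi2 // mulf_neq0 // expf_neq0 // -cyc ?w11 ?w16 oner_eq0.
  by do 2 (apply: ord2P); rewrite !(row2_0, row2_1) -cyc.
have fin : a.@[fun l => cub3 C x h (delta_mx 0 l)] = 0 -> a.@[fun l => tri c (delta_mx 0 l) y z] = 0.
  rewrite (_ : a.@[_] = a.@[fun l => k1 * tri c (delta_mx 0 l) y z]).
    by rewrite (meval_scale _ _ ha) => /eqP; rewrite mulf_eq0 expf_eq0 (negbTE k1n0) andbF => /eqP.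
  by apply: eq_meval => l; rewrite hk1.
apply: fin.
(* If F(h) = 0, the line joining h and x lies on the cubic, and s times the gradient at h + s^-1 x
   is the polar form plus s times the gradient at h; its value at s = 0 is wanted. *)
have [Fh|Fh] := eqVneq (tri C h h h) 0.
  pose q s := a.@[fun l => cub3 C x h (delta_mx 0 l) + s * gauss h l].
  suff h0 : forall s, q s = 0.
    by rewrite -[RHS](h0 0); apply: eq_meval => l; rewrite mul0r addr0.
  apply: (@pfun_zero K id q (@pfunX K)); last by exists 1; rewrite oner_eq0.
    apply: pfun_meval => l; apply: pfunD; first exact: pfunC.
    by apply: pfunM; [exact: pfunX | exact: pfunC].
  move=> s; have [->|s0] := eqVneq s 0; first by rewrite mul0r.
  have aF' : a.@[gauss (h + s^-1 *: x)] = 0.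
    by apply: aF; rewrite cub_expand Fh hx0 dFx Fx; ring.
  have -> : q s = s ^+ d * a.@[gauss (h + s^-1 *: x)]; last by rewrite aF' !mulr0.
  rewrite -(meval_scale _ _ ha); apply: eq_meval => l.
  by rewrite /gauss cub1_expand dFx (cub3_swap C x h); field.
(* Projection from the singular point x: F(v) x - cub1(v, x) v lies on the cubic for every v, and
   its gradient is -cub1(v, x) times the argument of [q]. As cub1(h, x) = 0, v moves from h towards
   w1 to make this factor generically nonzero. *)
pose w s := h + s *: (w1 - h).
have hw i : pfun (fun s => w s 0 i).
  have [p hp] : pfun (fun s => h 0 i + s * (w1 - h) 0 i).
    by apply: pfunD; [exact: pfunC | apply: pfunM; [exact: pfunX | exact: pfunC]].
  by exists p => s; rewrite hp /w [RHS]mxE [X in _ = _ + X]mxE.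
pose q s := a.@[fun l => tri C (w s) (w s) (w s) * cub3 C x (w s) (delta_mx 0 l) - cub1 C (w s) x * gauss (w s) l].
have q0 : forall s, q s = 0.
  apply: (@pfun_zero K (fun s => (- cub1 C (w s) x) ^+ d) q).
  - apply: pfunXn; apply: pfunN; apply: pfun_cub1 => // i; exact: pfunC.
  - apply: pfun_meval => l; apply: pfunD.
      apply: pfunM; first exact: pfun_tri.
      by apply: pfun_cub3 => // i; exact: pfunC.
    apply: pfunN; apply: pfunM; first by apply: pfun_cub1 => // i; exact: pfunC.
    by apply: pfun_cub1 => // i; exact: pfunC.
  - move=> s; rewrite -(meval_scale _ _ ha); move: (w s) => v; have [Fv eFv] : exists t, tri C v v v = t by eexists.
    rewrite eFv.
    rewrite -[RHS](aF (Fv *: x + (- cub1 C v x) *: v)).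
      apply: eq_meval => l; rewrite /gauss; have e0 := dFx (delta_mx 0 l).
      have -> a' b : cub1 C (a' *: x + b *: v) (delta_mx 0 l) =
        a' ^+ 2 * cub1 C x (delta_mx 0 l) + a' * b * cub3 C x v (delta_mx 0 l) + b ^+ 2 * cub1 C v (delta_mx 0 l).
        by rewrite /cub1 /cub3 !triE; ring.
      by rewrite e0; ring.
    have -> b : tri C (Fv *: x + b *: v) (Fv *: x + b *: v) (Fv *: x + b *: v) =
        Fv ^+ 3 * tri C x x x + Fv ^+ 2 * b * cub1 C x v + Fv * b ^+ 2 * cub1 C v x + b ^+ 3 * tri C v v v.
      by rewrite /cub1 !triE; ring.
    by rewrite Fx dFx eFv; ring.
  - by exists 1; rewrite expf_neq0 // oppr_eq0 /w scale1r addrC subrK.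
have := q0 0; rewrite /q /w scale0r addr0 hx0.
rewrite (_ : a.@[_] = a.@[fun l => tri C h h h * cub3 C x h (delta_mx 0 l)]).
  by rewrite (meval_scale _ _ ha) => /eqP; rewrite mulf_eq0 expf_eq0 (negbTE Fh) andbF => /eqP.
by apply: eq_meval => l; rewrite mul0r subr0.
Qed.

End GaussImage.

Section SexticPoints.
Variable f16 : {mpoly int[#|{: triple 8}|]}.
Hypothesis f16P : hyperdiscriminant f16.
Variables (K : closedFieldType) (c : tensor3 K 9).
Hypotheses (altc : alternating c) (nb : notbad c).
Local Notation T := (tri c).

Definition sextic_zero (l : 'cV[K]_9) : Prop :=
  exists M : 'M[K]_(8, 9), [/\ \rank M = 8%N, M *m l = 0 & eval3 intr f16 (wedge3 M c) = 0].

(** On the span of x, y, z the form T takes values in the multiples of l. An alternating form in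
    dimension 3 has a radical vector, written here by means of a3 != 0; it replaces x. *)
Lemma kerline_triple (x y z : 'rV[K]_9) (l : 'cV_9) a1 a2 a3 : indep3 x y z -> a3 != 0 ->
  (forall w, T x y w = a1 * (w *m l) 0 0) -> (forall w, T x z w = a2 * (w *m l) 0 0) ->
  (forall w, T y z w = a3 * (w *m l) 0 0) ->
  exists x' y' z', [/\ indep3 x' y' z', forall w, T x' y' w = 0, forall w, T x' z' w = 0
    & exists a, a != 0 /\ forall w, T w y' z' = a * (w *m l) 0 0].
Proof.
move=> ind a30 h1 h2 h3.
exists (x - (a2 / a3) *: y + (a1 / a3) *: z), y, z; split.
- move=> a b d e; have [|-> b0 d0] := ind a (b - a * (a2 / a3)) (d + a * (a1 / a3)).
    by rewrite -[RHS]e; apply/rowP => i; rewrite !mxE; ring.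
  by split=> //; [move: b0|move: d0]; rewrite mul0r => e0; [rewrite -[RHS]e0|rewrite -[RHS]e0]; ring.
- by move=> w; rewrite !triE triA // (tri_swap12 altc y z) h1 h3; field.
- by move=> w; rewrite !triE triA // h2 h3; field.
- by exists a3; split=> // w; rewrite -tri_cyc.
Qed.

(** The rows of M span the hyperplane l = 0. A bad subspace U there has T(U, U, -) in the multiples
    of l; these are not all zero since [c] is not bad, and one of three orders of the basis fits
    [kerline_triple]. *)
Lemma sextic_zero_triple (l : 'cV[K]_9) : l != 0 -> sextic_zero l ->
  exists x y z, [/\ indep3 x y z, forall w, T x y w = 0, forall w, T x z w = 0
    & exists a, a != 0 /\ forall w, T w y z = a * (w *m l) 0 0].
Proof.
move=> l0 [M [rM Ml fM]].
have altM : alternating (wedge3 M c) by exact: wedge3_alt.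
apply: NNPP => hno; apply: (f16v_eq0_bad f16P altM fM) => x y z ind hxy hxz hyz; apply: hno.
have fMr : row_free M by rewrite /row_free rM.
have ind' : indep3 (x *m M) (y *m M) (z *m M).
  move=> a b d; rewrite !scalemxAl -!mulmxDl => e; apply: ind.
  by apply: (row_free_inj fMr); rewrite e mul0mx.
have [w0 hw0] : exists w0 : 'rV_9, (w0 *m l) 0 0 != 0.
  apply: NNPP => /not_ex_all_not h; move/eqP: l0; apply; apply/colP => i; rewrite [RHS]mxE.
  by have /negP := h (delta_mx 0 i); rewrite negbK -rowE mxE => /eqP.
have kerM (w : 'rV_9) : w *m l = 0 -> (w <= M)%MS.
  move=> wl; have Mk : (M <= kermx l)%MS by apply/sub_kermxP.
  apply: submx_trans (_ : (kermx l <= M)%MS); first exact/sub_kermxP.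
  rewrite -(mxrank_leqif_sup Mk) mxrank_ker rM.
  by rewrite -mxrank_tr rank_rV (_ : (l^T != 0)) // -trmx0 (inj_eq trmx_inj).
have lin u v : (forall w, T (u *m M) (v *m M) (w *m M) = 0) ->
    forall w, T (u *m M) (v *m M) w = T (u *m M) (v *m M) w0 / (w0 *m l) 0 0 * (w *m l) 0 0.
  move=> h w; have /submxP[r er] : (w - ((w *m l) 0 0 / (w0 *m l) 0 0) *: w0 <= M)%MS.
    apply: kerM; rewrite mulmxDl mulNmx -scalemxAl; apply/matrixP => i j; rewrite !ord1.
    rewrite [RHS]mxE [LHS]mxE [X in _ + X]mxE [X in _ - X]mxE; field; exact: hw0.
  have := h r; rewrite -er !triE => /eqP; rewrite subr_eq0 => /eqP ->; ring.
pose a u v := T (u *m M) (v *m M) w0 / (w0 *m l) 0 0.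
have hxy' : forall w, T (x *m M) (y *m M) w = a x y * (w *m l) 0 0.
  by apply: lin => w; rewrite -tri_wedge3.
have hxz' : forall w, T (x *m M) (z *m M) w = a x z * (w *m l) 0 0.
  by apply: lin => w; rewrite -tri_wedge3.
have hyz' : forall w, T (y *m M) (z *m M) w = a y z * (w *m l) 0 0.
  by apply: lin => w; rewrite -tri_wedge3.
have [e3|] := eqVneq (a y z) 0; last by move=> e; exact: kerline_triple ind' e hxy' hxz' hyz'.
have [e2|e2] := eqVneq (a x z) 0; last first.
  apply: (kerline_triple (x := y *m M) (y := x *m M) (z := z *m M) (a1 := - a x y) _ e2 _ hyz' hxz').
    move=> r s t e; have [|-> -> ->] := ind' s r t; last by split.
    by rewrite -[RHS]e; apply/rowP => i; rewrite !mxE; ring.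
  by move=> w; rewrite tri_swap12 // hxy' mulNr.
have [e1|e1] := eqVneq (a x y) 0; last first.
  apply: (kerline_triple (x := z *m M) (y := x *m M) (z := y *m M) (a1 := - a x z) (a2 := - a y z) _ e1 _ _ hxy').
  - move=> r s t e; have [|-> -> ->] := ind' s t r; last by split.
    by rewrite -[RHS]e; apply/rowP => i; rewrite !mxE; ring.
  - by move=> w; rewrite tri_swap12 // hxz' mulNr.
  - by move=> w; rewrite tri_swap12 // hyz' mulNr.
case: (nb ind') => w; first by rewrite hxy' e1 mul0r.
  by rewrite hxz' e2 mul0r.
by rewrite hyz' e3 mul0r.
Qed.

(** T(x, y, z) = 0 and alternation put x, y, z in the hyperplane l = 0, where T(y, z, -) vanishes
    too, so they span a bad subspace of it. *)
Lemma triple_sextic_zero (x y z : 'rV[K]_9) (l : 'cV[K]_9) a : l != 0 -> indep3 x y z ->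
  (forall w, T x y w = 0) -> (forall w, T x z w = 0) -> a != 0 ->
  (forall w, a * T w y z = (w *m l) 0 0) -> sextic_zero l.
Proof.
move=> l0 ind xy xz an0 hl.
have [B eB] : exists B : 'M_(8, 9), (B :=: kermx l)%MS.
  apply: row_base_rank; rewrite mxrank_ker.
  by rewrite -mxrank_tr rank_rV (_ : (l^T != 0)) // -trmx0 (inj_eq trmx_inj).
have Bl : B *m l = 0 by apply/sub_kermxP; rewrite eB.
have inB (w : 'rV[K]_9) : (w *m l) 0 0 = 0 -> exists w', w = w' *m B.
  by move=> wl; apply/submxP; rewrite eB; apply/sub_kermxP; rewrite [LHS]mx11_scalar wl raddf0.
have [|x' ex] := inB x; first by rewrite -hl xy mulr0.
have [|y' ey] := inB y; first by rewrite -hl tri12 // mulr0.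
have [|z' ez] := inB z; first by rewrite -hl tri13 // mulr0.
exists B; split=> //.
  by rewrite eB mxrank_ker -mxrank_tr rank_rV (_ : (l^T != 0)) // -trmx0 (inj_eq trmx_inj).
have altB : alternating (wedge3 B c) by exact: wedge3_alt.
apply: (@f16v_bad _ f16P _ _ x' y' z' altB).
- move=> r s t e; apply: ind; rewrite ex ey ez !scalemxAl -!mulmxDl e mul0mx //.
- by move=> w; rewrite tri_wedge3 -ex -ey xy.
- by move=> w; rewrite tri_wedge3 -ex -ez xz.
- move=> w; rewrite tri_wedge3 -ey -ez (tri_cyc _ _ _ altc); apply: (mulfI an0).
  by rewrite hl -mulmxA Bl mulmx0 mulr0 mxE.
Qed.

Variable C : tensor3 K 9.
Hypothesis hadj : forall v, \adj (phi_matrix c v^T) = (tri C v v v) ^+ 2 *: (v^T *m v).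
Hypothesis rk2 : forall x : 'rV[K]_9, x != 0 -> (2 < \rank (phi_matrix c x^T))%N.

Lemma gauss_mul (x v : 'rV[K]_9) : (v *m \col_l gauss C x l) 0 0 = cub1 C x v.
Proof.
rewrite mxE [in RHS](row_sum_delta v) /cub1 tri1_sum tri2_sum tri3_sum -!big_split.
by apply: eq_bigr => l _; rewrite mxE /gauss /cub1 !triE !mulrDr.
Qed.

Lemma gauss_sextic_zero (x : 'rV[K]_9) : tri C x x x = 0 -> \col_l gauss C x l != 0 ->
  sextic_zero (\col_l gauss C x l).
Proof.
move=> Fx dn0; have x0 : x != 0.
  apply: contraNneq dn0 => ->; apply/eqP/colP => l; rewrite !mxE /gauss /cub1.
  by rewrite !triE !addr0.
have r6 : \rank (phi_matrix c x^T) = 6%N.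
  have [r4|//] := cubic_zero_rank altc hadj rk2 x0 Fx.
  have [|P [fP Px]] := @kernel_basis _ c 4 x x0; first by rewrite r4.
  have [d0 _] := rank4_cub altc hadj fP Px r4.
  by case/negP: dn0; apply/eqP/colP => l; rewrite !mxE /gauss d0.
have [y [z [ind xy xz]]] := kernel_basis2 x0 r6.
have [k1 [k10 hk]] := rank6_cub1 altc hadj ind xy xz r6.
by apply: (triple_sextic_zero dn0 ind xy xz k10) => w; rewrite gauss_mul hk.
Qed.

Lemma vanish_gauss_sextic d (a : {mpoly K[9]}) (l : 'cV[K]_9) : a \is d.-homog ->
  (forall v, tri C v v v = 0 -> a.@[gauss C v] = 0) -> l != 0 -> sextic_zero l ->
  a.@[fun i => l i 0] = 0.
Proof.
move=> ha aF l0 /(sextic_zero_triple l0)[x [y [z [ind xy xz [b [b0 hb]]]]]].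
have := gauss_tangent altc hadj nb rk2 ha aF ind xy xz.
rewrite (_ : a.@[fun i => T _ _ _] = a.@[fun i => b * l i 0]).
  by rewrite (meval_scale b (fun i => l i 0) ha) => /eqP; rewrite mulf_eq0 expf_eq0 (negbTE b0) andbF => /eqP.
by apply: eq_meval => i; rewrite hb -rowE mxE.
Qed.

End SexticPoints.

(** * Dimension counts for spaces of forms *)

Lemma linear_kernel (K : fieldType) (U W : vectType K) (f : {linear U -> W}) :
  (dim W < dim U)%N -> exists u, u != 0 /\ f u = 0.
Proof.
move=> lt; have := limg_ker_dim (linfun f) {:U}; rewrite capfv dimvf => e.
have : lker (linfun f) != 0%VS.
  apply/eqP => k0; move: e lt; rewrite k0 dimv0 add0n => <-.
  by rewrite ltnNge -[dim W]dimvf dimvS ?subvf.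
rewrite -vpick0 => h; exists (vpick (lker (linfun f))); split=> //.
by have := memv_pick (lker (linfun f)); rewrite memv_ker lfunE => /eqP.
Qed.

(** Rank and nullity for (a, b) |-> f a - g b; the binomials count monomials in n + 1 variables. *)
Lemma homog_pair_kernel (K : fieldType) n N M P (f g : {linear {mpoly K[n.+1]} -> {mpoly K[n.+1]}}) :
  (forall a, a \is N.-homog -> f a \is P.-homog) -> (forall b, b \is M.-homog -> g b \is P.-homog) ->
  ('C(P + n, P) < 'C(N + n, N) + 'C(M + n, M))%N ->
  exists a b, [/\ a \is N.-homog, b \is M.-homog, (a != 0) || (b != 0) & f a = g b].
Proof.
move=> hf hg lt.
pose U := (dhomog n.+1 K N * dhomog n.+1 K M)%type.
have hF (u : U) : f (val u.1) - g (val u.2) \is P.-homog.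
  by apply: rpredB; [apply: hf | apply: hg]; exact: dhomog_is_dhomog.
pose F (u : U) : dhomog n.+1 K P := DHomog (hF u).
have linF : linear F.
  move=> t u v; apply/val_inj; transitivity (f (t *: val u.1 + val v.1) - g (t *: val u.2 + val v.2)) => //.
  rewrite (linearP f) (linearP g) opprD addrACA -scalerN -scalerDr //.
pose FL : {linear U -> dhomog n.+1 K P} := HB.pack F (GRing.isLinear.Build K U (dhomog n.+1 K P) _ F linF).
have [|[a b] [ab0 /(congr1 val)/eqP]] := @linear_kernel K _ _ FL; first exact: lt.
rewrite /= subr_eq0 => /eqP e; exists (val a), (val b); split=> //; try exact: dhomog_is_dhomog.
apply: contraR ab0; rewrite negb_or !negbK => /andP[/eqP a0 /eqP b0].
by apply/eqP; congr (_, _); apply/val_inj.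
Qed.

Lemma bin8 N : ('C(N + 8, N) * 8`! = (N + 8) * (N + 7) * (N + 6) * (N + 5) * (N + 4) * (N + 3) * (N + 2) * (N + 1))%N.
Proof.
have -> : 'C(N + 8, N) = 'C(N + 8, 8) by rewrite -[LHS]bin_sub ?leq_addr // addKn.
rewrite bin_ffact !addnS addn0 !ffactnS ffactn0 /= muln1 !mulnA //.
Qed.

(** The numbers of forms of degrees 2N and 2N - 3 differ by a polynomial of degree 7 in N, while
    forms of degree N are counted by one of degree 8. The factor 32 comes from 2N + i <= 2 (N + i)
    for the five common factors, and 96 from the difference of the remaining cubic factors. *)
Lemma bin8_lt N M : (32 * 96 <= N)%N -> (N + N = M + 3)%N ->
  ('C(N + N + 8, N + N) < 'C(N + 8, N) + 'C(M + 8, M))%N.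
Proof.
move=> hN eM; rewrite -(ltn_pmul2r (fact_gt0 8)) mulnDl !bin8.
pose A := ((N + N + 5) * (N + N + 4) * (N + N + 3) * (N + N + 2) * (N + N + 1))%N.
pose B := ((N + 5) * (N + 4) * (N + 3) * (N + 2) * (N + 1))%N.
have B0 : (0 < B)%N by rewrite !muln_gt0 !addnS.
have AB : (A <= 32 * B)%N.
  have -> : (32 * B = (2 * (N + 5)) * (2 * (N + 4)) * (2 * (N + 3)) * (2 * (N + 2)) * (2 * (N + 1)))%N.
    by rewrite /B; ring.
  by rewrite /A; do !apply: leq_mul; lia.
have e1 : ((N + N + 8) * (N + N + 7) * (N + N + 6) = (M + 3) * (M + 2) * (M + 1) + (96 * (N * N) + 288 * N + 336))%N.
  by nia.
have e2 : (96 * (N * N) + 288 * N + 336 <= 96 * ((N + 7) * (N + 6)))%N by nia.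
have -> : ((N + N + 8) * (N + N + 7) * (N + N + 6) * (N + N + 5) * (N + N + 4) * (N + N + 3) * (N + N + 2) * (N + N + 1)
  = A * ((M + 3) * (M + 2) * (M + 1)) + A * (96 * (N * N) + 288 * N + 336))%N.
  by rewrite -mulnDr -e1 /A; ring.
have -> : ((M + 8) * (M + 7) * (M + 6) * (M + 5) * (M + 4) * (M + 3) * (M + 2) * (M + 1) = A * ((M + 3) * (M + 2) * (M + 1)))%N.
  by rewrite /A eM; ring.
rewrite addnC ltn_add2r.
have -> : ((N + 8) * (N + 7) * (N + 6) * (N + 5) * (N + 4) * (N + 3) * (N + 2) * (N + 1) = B * ((N + 7) * (N + 6)) * (N + 8))%N.
  by rewrite /B; ring.
apply: leq_ltn_trans (leq_mul AB e2) _.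
have -> : (32 * B * (96 * ((N + 7) * (N + 6))) = B * ((N + 7) * (N + 6)) * (32 * 96))%N by ring.
rewrite ltn_pmul2l ?muln_gt0 ?B0 ?addnS //; lia.
Qed.

Lemma tri_map (R S : comNzRingType) (f : {rmorphism R -> S}) n (c : tensor3 R n) x y z :
  f (tri c x y z) = tri (cmap f c) (map_mx f x) (map_mx f y) (map_mx f z).
Proof.
rewrite /tri rmorph_sum; apply: eq_bigr => i _; rewrite rmorph_sum; apply: eq_bigr => j _.
by rewrite rmorph_sum; apply: eq_bigr => l _; rewrite !rmorphM !mxE ffunE.
Qed.

Lemma cub1_map (R S : comNzRingType) (f : {rmorphism R -> S}) n (c : tensor3 R n) x h :
  f (cub1 c x h) = cub1 (cmap f c) (map_mx f x) (map_mx f h).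
Proof. by rewrite /cub1 !rmorphD !tri_map. Qed.

Lemma mmap_scale n d (R S : comNzRingType) (f : R -> S) (t : S) (h : 'I_n -> S) (p : {mpoly R[n]}) :
  p \is d.-homog -> mmap f (fun i => t * h i) p = t ^+ d * mmap f h p.
Proof.
move=> hp; rewrite /mmap big_distrr big_seq [RHS]big_seq; apply: eq_bigr => m mp /=.
have <- : mdeg m = d := dhomog_mf hp mp.
rewrite mulrCA mdegE -prodrXr -big_split; congr (_ * _); apply: eq_bigr => i _ /=.
by rewrite exprMn.
Qed.

Section GaussPolynomial.
Variables (K : closedFieldType) (C : tensor3 K 9).
Let X : 'rV[{mpoly K[9]}]_9 := \row_i 'X_i.

Definition gaussp : 9.-tuple {mpoly K[9]} :=
  [tuple cub1 (cmap (@mpolyC 9 K) C) X (delta_mx 0 l) | l < 9].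

Lemma map_delta (R S : comNzRingType) (f : {rmorphism R -> S}) (l : 'I_9) :
  map_mx f (delta_mx 0 l : 'rV_9) = delta_mx 0 l.
Proof. by apply/rowP => i; rewrite !mxE; case: (_ && _); rewrite ?rmorph0 ?rmorph1. Qed.

Lemma comp_gaussp (a : {mpoly K[9]}) (x : 'rV[K]_9) :
  (a \mPo gaussp).@[fun i => x 0 i] = a.@[gauss C x].
Proof.
rewrite comp_mpoly_meval; apply: eq_meval => l; rewrite tnth_mktuple.
rewrite (cub1_map (meval (fun i => x 0 i))) map_delta /gauss; congr (cub1 _ _ _).
  by apply/ffunP => t; rewrite !ffunE /= mevalC.
by apply/rowP => i; rewrite !mxE /= mevalXU.
Qed.

Lemma comp_gaussp_homog N (a : {mpoly K[9]}) : a \is N.-homog -> a \mPo gaussp \is (N + N).-homog.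
Proof.
move=> ha; apply/scaleX_dhomog.
pose sc : {rmorphism {mpoly K[9]} -> {poly {mpoly K[9]}}} :=
  mmap (@polyC _ \o @mpolyC 9 K) (fun i => 'X_i *: 'X).
have scX : map_mx sc X = 'X *: map_mx (@polyC _) X.
  apply/rowP => i; rewrite !mxE /sc /= mmapX mmap1U -mul_polyC.
  by rewrite mulrC.
have scC : cmap sc (cmap (@mpolyC 9 K) C) = cmap (@polyC _) (cmap (@mpolyC 9 K) C).
  by apply/ffunP => t; rewrite !ffunE /sc /= mmapC.
have scg l : sc (tnth gaussp l) = 'X ^+ 2 * (tnth gaussp l)%:P.
  rewrite tnth_mktuple (cub1_map sc) scX scC map_delta.
  transitivity ('X ^+ 2 * cub1 (cmap (@polyC _) (cmap (@mpolyC 9 K) C)) (map_mx (@polyC _) X) (delta_mx 0 l)).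
    by rewrite /cub1 !triE; ring.
  by rewrite (cub1_map (@polyC {mpoly K[9]})) map_delta.
rewrite -[scaleX _]/(sc _) /comp_mpoly rmorph_mmap.
transitivity (mmap (@polyC _ \o @mpolyC 9 K) (fun i => 'X ^+ 2 * (tnth gaussp i)%:P) a).
  by apply: eq_mmap => [t|i] /=; [rewrite /sc /= mmapC | exact: scg].
rewrite (mmap_scale _ _ _ ha) -exprM mul2n -addnn -mul_polyC mulrC; congr (_ * _).
by rewrite (rmorph_mmap (@polyC {mpoly K[9]})).
Qed.

End GaussPolynomial.

Section SexticNonzero.
Variable f16 : {mpoly int[#|{: triple 8}|]}.
Hypothesis f16P : hyperdiscriminant f16.
Variables (K : closedFieldType) (c C : tensor3 K 9) (F : {mpoly K[9]}).
Hypotheses (altc : alternating c) (nb : notbad c).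
Hypothesis hadj : forall v, \adj (phi_matrix c v^T) = (tri C v v v) ^+ 2 *: (v^T *m v).
Hypothesis rk2 : forall x : 'rV[K]_9, x != 0 -> (2 < \rank (phi_matrix c x^T))%N.
Hypotheses (hF : F \is 3.-homog) (F0 : F != 0).
Hypothesis FC : forall v : 'rV[K]_9, F.@[fun i => v 0 i] = tri C v v v.

(* For large N there are more pairs (a, b) of forms of degrees N and 2N - 3 than forms of
   degree 2N, so a(dF) = F b for some a <> 0, and a vanishes on the sextic. *)
Lemma sextic_neq0 : exists l, l != 0 /\ ~ sextic_zero f16 c l.
Proof.
apply: NNPP => hno; have all0 l : l != 0 -> sextic_zero f16 c l.
  by move=> l0; apply: NNPP => hl; apply: hno; exists l.
have [N hN] : exists N, (32 * 96 <= N)%N by exists (32 * 96)%N.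
have [M eM] : exists M, (N + N = M + 3)%N.
  exists (N + N - 3)%N; rewrite subnK // (leq_trans _ (leq_addr _ _)) // (leq_trans _ hN) //.
have linM : linear (fun b : {mpoly K[9]} => F * b).
  by move=> t u v; rewrite mulrDr scalerAr.
pose g : {linear {mpoly K[9]} -> {mpoly K[9]}} :=
  HB.pack (fun b : {mpoly K[9]} => F * b) (GRing.isLinear.Build K {mpoly K[9]} {mpoly K[9]} _ _ linM).
have hg b : b \is M.-homog -> g b \is (N + N).-homog.
  by move=> hb; rewrite eM addnC; apply: dhomogM.
have [a [b [ha hb ab0 eab]]] := homog_pair_kernel (@comp_gaussp_homog K C N) hg (bin8_lt hN eM).
have a0 : a != 0.
  apply/eqP => a0; move: ab0; rewrite a0 eqxx /= => /negP; apply.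
  by move/esym/eqP: eab; rewrite a0 raddf0 mulf_eq0 (negbTE F0).
have aF v : tri C v v v = 0 -> a.@[gauss C v] = 0.
  by move=> Fv; rewrite -comp_gaussp eab /= mevalM FC Fv mul0r.
have N0 : (0 < N)%N by apply: leq_trans hN.
have az (l : 'cV[K]_9) : l != 0 -> a.@[fun i => l i 0] = 0.
  by move=> l0; apply: (vanish_gauss_sextic f16P altc nb hadj rk2 ha aF l0); exact: all0.
move/eqP: a0; apply; apply: meval_pointwise0 => v.
have [v0|vn0] := eqVneq (\col_i v i) 0; last first.
  by rewrite -[RHS](az _ vn0); apply: eq_meval => i; rewrite mxE.
transitivity (a.@[fun i => 0 * v i]).
  by apply: eq_meval => i; have := congr1 (fun X : 'cV_9 => X i 0) v0; rewrite !mxE mul0r.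
by rewrite (meval_scale _ _ ha) expr0n -leqn0 leqNgt N0 mul0r.
Qed.

End SexticNonzero.

(** * Irreducibility *)

Lemma homog_map (R S : nzRingType) (f : {rmorphism R -> S}) n d (p : {mpoly R[n]}) :
  p \is d.-homog -> map_mpoly f p \is d.-homog.
Proof.
move=> hp; apply/dhomogP => m; rewrite mcoeff_msupp mcoeff_map_mpoly => fm.
apply: (dhomog_mf hp); rewrite mcoeff_msupp; apply/eqP => e; by move: fm; rewrite /= e rmorph0 eqxx.
Qed.

(** Restrict to the affine line e0 + t e1. Either a root exists, or H is a constant b there; then
    homogeneity gives H(s e0 + e1) = s^d b, which vanishes at s = 0. *)
Lemma homog_has_zero (K : closedFieldType) n d (H : {mpoly K[n.+2]}) : (0 < d)%N -> H \is d.-homog ->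
  exists v : 'cV[K]_n.+2, v != 0 /\ H.@[fun i => v i 0] = 0.
Proof.
move=> d0 hH; pose e0 : 'cV[K]_n.+2 := delta_mx 0 0; pose e1 : 'cV[K]_n.+2 := delta_mx 1 0.
pose pt (s t : K) := s *: e0 + t *: e1.
have line (x y : K -> K) : pfun x -> pfun y -> pfun (fun t => H.@[fun i => pt (x t) (y t) i 0]).
  move=> hx hy; apply: pfun_meval => i.
  have [p hp] : pfun (fun t => x t * e0 i 0 + y t * e1 i 0) by apply: pfunD; apply: pfunM => //; exact: pfunC.
  by exists p => t; rewrite hp !mxE.
have [p hp] := line (fun=> 1) id (pfunC 1) (@pfunX K).
have [sp|sp] := eqVneq (size p) 1%N; last first.
  have [t /rootP pt0] := closed_rootP _ sp; exists (pt 1 t); rewrite -hp; split=> //.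
  by apply/eqP => /(congr1 (fun v : 'cV_n.+2 => v 0 0))/eqP; rewrite !mxE /= mulr1 mulr0 addr0 oner_eq0.
exists e1; split.
  by apply/eqP => /(congr1 (fun v : 'cV_n.+2 => v 1 0))/eqP; rewrite !mxE /= oner_eq0.
have /size_poly1P[b _ eb] : size p == 1%N by rewrite sp.
have hq : pfun (fun s => H.@[fun i => pt s 1 i 0] - s ^+ d * b).
  apply: pfunD; first by apply: line; [exact: pfunX | exact: pfunC].
  by apply: pfunN; apply: pfunM; [apply: pfunXn; exact: pfunX | exact: pfunC].
have := @pfun_zero K id _ (@pfunX K) hq _ _ 0; rewrite expr0n eqn0Ngt d0 mul0r subr0.
rewrite (_ : H.@[fun i => pt 0 1 i 0] = H.@[fun i => e1 i 0]); last first.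
  by apply: eq_meval => i; rewrite !mxE mul0r add0r mul1r.
apply; last by exists 1; rewrite oner_eq0.
move=> s; have [->|s0] := eqVneq s 0; first by rewrite mul0r.
rewrite -(hornerC b s^-1) -eb hp -(meval_scale _ _ hH) (_ : H.@[_] = H.@[fun i => s * pt 1 s^-1 i 0]).
  by rewrite subrr mulr0.
by apply: eq_meval => i; rewrite !mxE; field.
Qed.

Section Irreducibility.
Variables (k : fieldType) (K : closedFieldType) (iota : {rmorphism k -> K}) (n : nat).
Variables (H : {mpoly k[n]}) (d : nat) (Z : point k n -> Prop).
Hypotheses (hH : H \is d.-homog) (H0 : H != 0) (ZH : forall P, Z P <-> vanishes H P).
Let HK := map_mpoly iota H.
Hypothesis Hzero : exists v : 'cV[K]_n, v != 0 /\ HK.@[fun i => v i 0] = 0.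
Hypothesis Hprime : forall (a b : {mpoly K[n]}) da db, a \is da.-homog -> b \is db.-homog ->
  (forall v : 'cV[K]_n, v != 0 -> HK.@[fun i => v i 0] = 0 -> a.@[fun i => v i 0] * b.@[fun i => v i 0] = 0) ->
  (forall v : 'cV[K]_n, v != 0 -> HK.@[fun i => v i 0] = 0 -> a.@[fun i => v i 0] = 0) \/
  (forall v : 'cV[K]_n, v != 0 -> HK.@[fun i => v i 0] = 0 -> b.@[fun i => v i 0] = 0).

(** A power of the form is divisible by H over K, hence over k by descent, and this divisibility can
    be evaluated at points over any extension of k. *)
Lemma vanish_closed_points (a : {mpoly k[n]}) da P : a \is da.-homog ->
  (forall v : 'cV[K]_n, v != 0 -> HK.@[fun i => v i 0] = 0 -> (map_mpoly iota a).@[fun i => v i 0] = 0) ->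
  Z P -> vanishes a P.
Proof.
move=> ha aZ /ZH HP; have haK := homog_map iota ha.
have HK0 : HK != 0.
  apply: contraNneq H0 => hk0; apply/eqP/mpolyP => m; apply: (fmorph_inj iota).
  by rewrite -mcoeff_map_mpoly -/HK hk0 !mcoeff0 rmorph0.
have [v0 [v0n0 Hv0]] := Hzero.
have aV v : HK.@[v] = 0 -> (map_mpoly iota a).@[v] = 0.
  (* The origin is not a projective point; writing it as 0 v0 with v0 a zero of H also covers forms
     of degree 0. *)
  move=> Hv; have [e|ne] := eqVneq (\col_i v i) 0.
    transitivity ((map_mpoly iota a).@[fun i => 0 * v0 i 0]).
      by apply: eq_meval => i; have := congr1 (fun X : 'cV_n => X i 0) e; rewrite !mxE mul0r.
    by rewrite (meval_scale _ _ haK) aZ // mulr0.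
  have ev (g : {mpoly K[n]}) : g.@[fun i => (\col_j v j) i 0] = g.@[v] by apply: eq_meval => i; rewrite mxE.
  by have := aZ _ ne; rewrite !ev; apply.
have [s es] := nullstellensatz (homog_map iota hH) HK0 aV.
have [s' es'] : exists s', a ^+ d = H * s'.
  by apply: (mpoly_dvd_descent (f := iota) (s := s)); rewrite -es rmorphXn.
have : mmap (pt_emb P) (fun i => pt_vec P i 0) (a ^+ d) = 0 by rewrite es' rmorphM /= HP mul0r.
by rewrite rmorphXn => /eqP; rewrite expf_eq0 => /andP[_ /eqP].
Qed.

Lemma irreducible_of_prime : irreducible Z.
Proof.
have [v0 [v0n0 Hv0]] := Hzero.
have kpt (v : 'cV[K]_n) (v1 : v != 0) (a : {mpoly k[n]}) :
    vanishes a (Point iota v1) <-> (map_mpoly iota a).@[fun i => v i 0] = 0.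
  by rewrite /vanishes /= /meval mmap_map_mpoly; split=> <-; apply: eq_mmap.
split; first by exists (Point iota v0n0); apply/ZH/kpt.
move=> Z1 Z2 [S1 [hS1 eS1]] [S2 [hS2 eS2]] cov.
apply: NNPP => /not_or_and[h1 h2].
have out (Z' : point k n -> Prop) (S : {mpoly k[n]} -> Prop) :
    (forall P, Z' P <-> forall F, S F -> vanishes F P) -> ~ (forall P, Z P -> Z' P) ->
    exists F P, [/\ S F, Z P & ~ vanishes F P].
  move=> eS hn; apply: NNPP => hno; apply: hn => P ZP; apply/eS => F SF.
  by apply: NNPP => hv; apply: hno; exists F, P.
have [a [P [Sa ZP aP]]] := out _ _ eS1 h1; have [b [Q [Sb ZQ bQ]]] := out _ _ eS2 h2.
have [da ha] := hS1 _ Sa; have [db hb] := hS2 _ Sb.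
have [v vn0 Hv|aZ|bZ] := Hprime (homog_map iota ha) (homog_map iota hb).
- have [Zv|Zv] := cov (Point iota vn0) ((ZH _).2 ((kpt _ _ _).2 Hv)).
    by have /kpt -> := (eS1 _).1 Zv _ Sa; rewrite mul0r.
  by have /kpt -> := (eS2 _).1 Zv _ Sb; rewrite mulr0.
- by apply: aP; exact: (vanish_closed_points ha).
- by apply: bQ; exact: (vanish_closed_points hb).
Qed.

End Irreducibility.

Lemma closed_prime_origin (K : closedFieldType) n (a b : {mpoly K[n]}) da db (v0 v : 'I_n -> K) :
  a \is da.-homog -> b \is db.-homog -> a.@[v0] * b.@[v0] = 0 -> v =1 (fun=> 0) -> a.@[v] * b.@[v] = 0.
Proof.
move=> ha hb h v00.
have e (c : {mpoly K[n]}) : c.@[v] = c.@[fun i => 0 * v0 i] by apply: eq_meval => i; rewrite v00 mul0r.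
by rewrite !e (meval_scale _ _ ha) (meval_scale _ _ hb) mulrACA h mulr0.
Qed.

(** The dimension is a variable with an equation because [\dim {:V}] equals 9 only propositionally;
    in this form the equation can be substituted. *)
Lemma irreducible_loci (k : fieldType) (n : nat) (c : tensor3 k n) (K : closedFieldType)
  (iota : {rmorphism k -> K}) (f16 : {mpoly int[#|{: triple 8}|]}) (Y D : point k n -> Prop) :
  n = 9%N -> hyperdiscriminant f16 -> alternating c ->
  orbit_closed (cmap iota c) -> stabilizer_finite (cmap iota c) ->
  (forall P, Y P <-> (\rank (phi_matrix (cmap (pt_emb P) c) (pt_vec P)) <= 6)%N) ->
  (forall P, D P <-> exists M : 'M[pt_field P]_(8, n),
    [/\ \rank M = 8%N, M *m pt_vec P = 0 & eval3 intr f16 (wedge3 M (cmap (pt_emb P) c)) = 0]) ->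
  (hypersurface Y /\ irreducible Y) /\ (hypersurface D /\ irreducible D).
Proof.
move=> n9; subst n => f16P altc oc sf YP DP.
have altK : alternating (cmap iota c) by exact: cmap_alt.
have nb := stable_notbad altK oc sf; have rk2 := stable_rank_gt2 altK oc sf.
have [F [hF hadj]] := cubic_exists altc; have [C0 FC0] := cubic_tensor hF.
pose C := cmap iota C0; pose FK := map_mpoly iota F.
have evK (G : {mpoly k[9]}) (v : 'I_9 -> K) : (map_mpoly iota G).@[v] = mmap iota v G.
  by rewrite /meval mmap_map_mpoly; apply: eq_mmap.
have FKC (v : 'rV[K]_9) : FK.@[fun i => v 0 i] = tri C v v v by rewrite evK FC0.
have hadjK v : \adj (phi_matrix (cmap iota c) v^T) = (tri C v v v) ^+ 2 *: (v^T *m v).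
  by rewrite hadj /ev9 FC0.
have nohyp (l : 'cV[K]_9) : l != 0 -> exists v, v *m l = 0 /\ tri C v v v != 0.
  exact: (no_hyperplane altK hadjK nb rk2).
have hFK : FK \is 3.-homog by exact: homog_map.
have [l0 l0n0] : exists l : 'cV[K]_9, l != 0.
  exists (delta_mx 0 0); apply/eqP => /(congr1 (fun v : 'cV_9 => v 0 0))/eqP.
  by rewrite !mxE oner_eq0.
have FK0 : FK != 0.
  have [v [_ Fv]] := nohyp l0 l0n0; apply: contraNneq Fv => FK0.
  by rewrite -FKC FK0 meval0.
have F0 : F != 0 by apply: contraNneq FK0 => F0; rewrite /FK F0 rmorph0.
have YF P : Y P <-> vanishes F P.
  have := hadj _ (pt_emb P) (pt_vec P)^T => e.
  have v0 : (pt_vec P)^T != 0 by rewrite -trmx0 (inj_eq trmx_inj) pt_neq0.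
  rewrite YP; have := @rank_le6 _ _ _ _ (cmap_alt (pt_emb P) altc) v0 e.
  rewrite trmxK sqrf_eq0 => ->; rewrite /ev9 /vanishes.
  rewrite (eq_mmap (f' := pt_emb P) (h' := fun i => pt_vec P i 0)) // => [|i]; last by rewrite mxE.
  by split=> /eqP.
have FZ := homog_has_zero (isT : (0 < 3)%N) hFK.
have colrow (a : {mpoly K[9]}) (v : 'rV[K]_9) : a.@[fun i => v^T i 0] = a.@[fun i => v 0 i].
  by apply: eq_meval => i; rewrite mxE.
have primeF (a b : {mpoly K[9]}) : (forall v : 'rV[K]_9, FK.@[fun i => v 0 i] = 0 ->
     a.@[fun i => v 0 i] * b.@[fun i => v 0 i] = 0) ->
    (forall v, FK.@[v] = 0 -> a.@[v] = 0) \/ (forall v, FK.@[v] = 0 -> b.@[v] = 0).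
  move=> hab; have [|[s es]|[s es]] := prime_cubic hFK FKC nohyp (a := a) (b := b) l0n0.
  - move=> v; have ev (g : {mpoly K[9]}) : g.@[v] = g.@[fun i => (\row_j v j) 0 i].
      by apply: eq_meval => i; rewrite mxE.
    by rewrite !ev; exact: hab.
  - by left=> v Fv; rewrite es mevalM Fv mul0r.
  - by right=> v Fv; rewrite es mevalM Fv mul0r.
have [G [hG Gx]] := sextic_exists f16P altc.
pose GK := map_mpoly iota G.
have hGK : GK \is 6.-homog by exact: homog_map.
have GKx (l : 'cV[K]_9) : l != 0 -> (sextic_zero f16 (cmap iota c) l <-> GK.@[fun i => l i 0] = 0).
  by move=> ln0; rewrite evK; exact: Gx.
have G0 : G != 0.
  apply/eqP => G0; have [l [ln0 hl]] := sextic_neq0 f16P altK nb hadjK rk2 hFK FK0 FKC.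
  by apply: hl; apply/GKx => //; rewrite /GK G0 rmorph0 meval0.
have DG P : D P <-> vanishes G P.
  by rewrite DP; apply: Gx; exact: pt_neq0.
have GZ := homog_has_zero (isT : (0 < 6)%N) hGK.
split; split.
- by exists 3%N, F; split.
- apply: (irreducible_of_prime (iota := iota) hF F0 YF FZ) => a b da db ha hb hab.
  have [v0 [v0n0 Fv0]] := FZ.
  have [v Fv|h|h] := primeF a b; [|by left=> v _; exact: h|by right=> v _; exact: h].
  have [v00|vn0] := eqVneq v 0.
    by apply: (closed_prime_origin ha hb (hab _ v0n0 Fv0)) => i; rewrite v00 mxE.
  have := hab v^T; rewrite !colrow; apply=> //.
  by rewrite -trmx0 (inj_eq trmx_inj).
- by exists 6%N, G; split.
- apply: (irreducible_of_prime (iota := iota) hG G0 DG GZ) => a b da db ha hb hab.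
  have [v0 [v0n0 Gv0]] := GZ.
  have [v Fv|h|h] := primeF (a \mPo gaussp C) (b \mPo gaussp C).
  + rewrite !comp_gaussp; pose l := \col_i gauss C v i.
    have el (g : {mpoly K[9]}) : g.@[gauss C v] = g.@[fun i => l i 0] by apply: eq_meval => i; rewrite mxE.
    (* At a singular point of the cubic the gradient is zero and gives no point of the sextic. *)
    have [l00|ln0] := eqVneq l 0.
      by rewrite !el; apply: (closed_prime_origin ha hb (hab _ v0n0 Gv0)) => i; rewrite l00 mxE.
    rewrite !el; apply: hab => //; apply/GKx => //.
    by apply: (gauss_sextic_zero f16P altK hadjK rk2) => //; rewrite -FKC.
  + left=> l ln0 Gl; apply: (vanish_gauss_sextic f16P altK nb hadjK rk2 ha _ ln0); last exact/GKx.
    by move=> v Fv; rewrite -comp_gaussp h // FKC.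
  + right=> l ln0 Gl; apply: (vanish_gauss_sextic f16P altK nb hadjK rk2 hb _ ln0); last exact/GKx.
    by move=> v Fv; rewrite -comp_gaussp h // FKC.
Qed.

Lemma tv_coords_alt (k : fieldType) (V : vectType k) (gamma : trivector V) (K : fieldType)
  (iota : {rmorphism k -> K}) : alternating (tv_coords gamma iota).
Proof.
have sw12 x y z : gamma y x z = - gamma x y z.
  have a0 u : gamma u u z = 0 by exact: tv_alt12.
  have := a0 (1 *: x + y); rewrite tv_linear1 !tv_linear2 !a0 !mul1r add0r addr0 => /eqP.
  by rewrite addr_eq0 => /eqP ->; rewrite opprK.
have sw23 x y z : gamma x z y = - gamma x y z.
  have a0 u : gamma x u u = 0 by exact: tv_alt23.
  have := a0 (1 *: y + z); rewrite tv_linear2 !tv_linear3 !a0 !mul1r add0r addr0 => /eqP.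
  by rewrite addr_eq0 => /eqP ->; rewrite opprK.
split=> [i l|i j l]; rewrite !ffunE /=.
  by rewrite tv_alt12 tv_alt23 tv_alt13 rmorph0.
by split; rewrite -rmorphN; congr (iota _); [exact: sw12 | exact: sw23].
Qed.

Theorem corollary5p3
  (k : fieldType) (V : vectType k) (dimV : \dim {:V} = 9%N)
  (kbar : closedFieldType) (iota : {rmorphism k -> kbar})
  (iota_alg : forall z : kbar, algebraicOver iota z)
  (f16 : {mpoly int[#|{: triple 8}|]}) (f16P : hyperdiscriminant f16)
  (gamma : trivector V) (gamma_stable : stable iota gamma) :
  (hypersurface (Y_locus gamma) /\ irreducible (Y_locus gamma)) /\
  (hypersurface (D_locus f16 gamma) /\ irreducible (D_locus f16 gamma)).
Proof.
have [oc sf] := gamma_stable; pose c := tv_coords gamma (@idfun k : {rmorphism k -> k}).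
have ec (K : fieldType) (f : {rmorphism k -> K}) : tv_coords gamma f = cmap f c.
  by apply/ffunP => t; rewrite !ffunE.
rewrite ec in oc; rewrite ec in sf.
apply: (irreducible_loci dimV f16P _ oc sf); first exact: tv_coords_alt.
  by move=> P; rewrite /Y_locus ec.
by move=> P; rewrite /D_locus ec.
Qed.
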